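(* Let $M$ be a differential module over $K[\![t]\!]_0$ of rank $2$, and let \[ m'=\dim_K\bigl(M\otimes_{K[\![t]\!]_0}K\{t\}\bigr)^{\nabla=0}. \] Then \[ \bigl(M\otimes_{K[\![t]\!]_0}K[\![t]\!]_{m'-1}\bigr)^{\nabla=0}=\bigl(M\otimes_{K[\![t]\!]_0}K\{t\}\bigr)^{\nabla=0}. \]
   Context: $K$ is a complete discrete valuation field of mixed characteristic $(0,p)$, with multiplicative norm $|\cdot|$ normalized by $|p|=p^{-1}$. $K\{t\}$ is the ring of power series $\sum_{i\in\mathbb{N}}a_it^i$ over $K$ converging on the open unit disc $|t|<1$, i.e. $\lim_{i\to\infty}|a_i|\eta^i=0$ for all $\eta\in(0,1)$. $K[\![t]\!]_0$ is the subring of those with $\sup_i|a_i|<\infty$. For real $\delta\ge 0$, $K[\![t]\!]_\delta$ is the set of power series $\sum_{i\in\mathbb{N}}a_it^i$ over $K$ with $\sup_{i\in\mathbb{N}}|a_i|/(i+1)^\delta<\infty$ (order of log-growth at most $\delta$); for $\delta<0$ set $K[\![t]\!]_\delta=K[\![t]\!]_0$. Each $K[\![t]\!]_\delta$ is a $K[\![t]\!]_0$-submodule of $K\{t\}$ stable under $d=d/dt$. A differential module over $K[\![t]\!]_0$ is a finite free $K[\![t]\!]_0$-module $M$ with an additive map $D:M\to M$ satisfying $D(rm)=d(r)m+rD(m)$ for all $r\in K[\![t]\!]_0$, $m\in M$. $D$ extends to $M\otimes_{K[\![t]\!]_0}K\{t\}$ by $D(m\otimes f)=D(m)\otimes f+m\otimes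 df$, and preserves the submodule $M\otimes_{K[\![t]\!]_0}K[\![t]\!]_\delta$. The superscript $\nabla=0$ denotes the kernel of $D$. *)

(* Defs.v *)
From HB Require Import structures.
From mathcomp Require Import all_boot all_order all_algebra generic_quotient.
From mathcomp Require Import all_classical all_reals all_analysis.
From mathcomp Require Import ring lra.
Set Implicit Arguments.
Unset Strict Implicit.
Unset Printing Implicit Defensive.
Import Order.TTheory GRing.Theory Num.Theory.
Import numFieldNormedType.Exports.
Local Open Scope classical_set_scope.
Local Open Scope ring_scope.

HB.mixin Record Field_isCDVF (R : realType) (p : nat) K of GRing.Field K := {
  vnorm : K -> R;
  vnorm_prime : prime p;
  vnorm_ge0 : forall x, 0 <= vnorm x;
  vnorm_eq0 : forall x, vnorm x = 0 -> x = 0;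
  vnormM : forall x y, vnorm (x * y) = vnorm x * vnorm y;
  vnorm_ultra : forall x y, vnorm (x + y) <= Num.max (vnorm x) (vnorm y);
  (* the value group is infinite cyclic, generated by the norm of a uniformizer *)
  vnorm_discrete : exists pi : K, [/\ 0 < vnorm pi, vnorm pi < 1 &
    forall x, x != 0 -> exists n : int, vnorm x = vnorm pi ^ n];
  vnorm_complete : forall u : nat -> K,
    (forall e : R, 0 < e -> exists N, forall m n, (N <= m)%N -> (N <= n)%N ->
       vnorm (u m - u n) < e) ->
    exists l : K, forall e : R, 0 < e ->
      exists N, forall n, (N <= n)%N -> vnorm (u n - l) < e;
  pchar_cdvf : [pchar K] =i pred0;
  (* in particular p is in the maximal ideal: the residue characteristic is p *)
  vnorm_p : vnorm p%:R = p%:R^-1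
}.

#[short(type="cdvfType")]
HB.structure Definition CDVF (R : realType) (p : nat) :=
  {K of Field_isCDVF R p K & GRing.Field K}.

Section NormTheory.
Context {R : realType} {p : nat} {K : cdvfType R p}.
Implicit Types x y : K.

Lemma vnorm1 : vnorm (1 : K) = 1.
Proof.
have n0 : vnorm (1 : K) != 0.
  by apply/eqP => /vnorm_eq0 /eqP; rewrite oner_eq0.
by apply: (mulfI n0); rewrite -vnormM !mulr1.
Qed.

Lemma vnorm0 : vnorm (0 : K) = 0.
Proof.
have [pi [pi0 pi1 _]] := @vnorm_discrete R p K.
have : vnorm (0 : K) * (1 - vnorm pi) = 0.
  by rewrite mulrBr mulr1 -vnormM mul0r subrr.
by move/eqP; rewrite mulf_eq0 subr_eq0 [1 == _]gt_eqF // orbF => /eqP.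
Qed.

Lemma vnormN x : vnorm (- x) = vnorm x.
Proof.
suff h : vnorm (- 1 : K) = 1 by rewrite -mulN1r vnormM h mul1r.
have : vnorm (- 1 : K) ^+ 2 = 1 by rewrite expr2 -vnormM mulrNN mulr1 vnorm1.
move/eqP; rewrite sqrf_eq1 => /orP[/eqP //|/eqP h].
by have := vnorm_ge0 (- 1 : K); rewrite h oppr_ge0 ler10.
Qed.

Lemma vnorm_sum_le (I : Type) (r : seq I) (P : pred I) (F : I -> K) (C : R) :
  0 <= C -> (forall i, P i -> vnorm (F i) <= C) ->
  vnorm (\sum_(i <- r | P i) F i) <= C.
Proof.
move=> C0 h; elim/big_ind: _ => //; first by rewrite vnorm0.
move=> x y hx hy; apply: (le_trans (vnorm_ultra _ _)).
by rewrite ge_max hx hy.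
Qed.

Lemma vnorm_nat n : vnorm (n%:R : K) <= 1.
Proof.
elim: n => [|n ih]; first by rewrite vnorm0 ler01.
rewrite -natr1; apply: (le_trans (vnorm_ultra _ _)).
by rewrite ge_max ih vnorm1 lexx.
Qed.

End NormTheory.

Record pseries (K : fieldType) := PSeries { scoef : nat -> K }.

HB.instance Definition _ (K : fieldType) := [isNew for @scoef K].
HB.instance Definition _ (K : fieldType) := [Choice of pseries K by <:].

Section PSeriesRing.
Context {K : fieldType}.
Implicit Types f g h : pseries K.

Lemma pseriesP f g : (forall i, scoef f i = scoef g i) <-> f = g.
Proof.
split=> [|-> //]; case: f => f; case: g => g /= fg; congr PSeries.
exact/funext.
Qed.

Definition ps0 : pseries K := PSeries (fun=> 0).
Definition ps_opp f := PSeries (fun i => - scoef f i).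
Definition ps_add f g := PSeries (fun i => scoef f i + scoef g i).
Definition ps_const (c : K) := PSeries (fun i => if i is 0%N then c else 0).
Definition ps_mul f g :=
  PSeries (fun i => \sum_(j < i.+1) scoef f j * scoef g (i - j)%N).

Fact ps_addA : associative ps_add.
Proof. by move=> f g h; apply/pseriesP => i /=; rewrite addrA. Qed.
Fact ps_addC : commutative ps_add.
Proof. by move=> f g; apply/pseriesP => i /=; rewrite addrC. Qed.
Fact ps_add0 : left_id ps0 ps_add.
Proof. by move=> f; apply/pseriesP => i /=; rewrite add0r. Qed.
Fact ps_addN : left_inverse ps0 ps_opp ps_add.
Proof. by move=> f; apply/pseriesP => i /=; rewrite addNr. Qed.

HB.instance Definition _ :=
  GRing.isZmodule.Build (pseries K) ps_addA ps_addC ps_add0 ps_addN.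

(* [ps_trunc n f] is f modulo t^n, used to import ring laws from {poly K} *)
Let ps_trunc n f : {poly K} := \poly_(i < n) scoef f i.

Let ps_mulE f g n i : (i < n)%N ->
  scoef (ps_mul f g) i = (ps_trunc n f * ps_trunc n g)`_i.
Proof.
move=> lein /=; rewrite coefM; apply: eq_bigr => j _.
rewrite !coef_poly (leq_trans (ltn_ord j) lein).
by rewrite (leq_ltn_trans (leq_subr _ _) lein).
Qed.

Fact ps_mulA : associative ps_mul.
Proof.
move=> f g h; apply/pseriesP => i; pose tr := ps_trunc i.+1.
have -> : scoef (ps_mul f (ps_mul g h)) i = (tr f * (tr g * tr h))`_i.
  rewrite /= coefM; apply: eq_bigr => j _; rewrite coef_poly ltn_ord.
  by rewrite -[X in _ * X]/(scoef (ps_mul g h) _) (@ps_mulE _ _ i.+1) //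
     ltnS leq_subr.
have -> : scoef (ps_mul (ps_mul f g) h) i = ((tr f * tr g) * tr h)`_i.
  rewrite /= coefM; apply: eq_bigr => j _.
  rewrite [(tr h)`_ _]coef_poly ltnS leq_subr.
  by rewrite -[X in X * _]/(scoef (ps_mul f g) _) (@ps_mulE _ _ i.+1).
by rewrite mulrA.
Qed.

Fact ps_mulC : commutative ps_mul.
Proof.
move=> f g; apply/pseriesP => i.
by rewrite !(@ps_mulE _ _ i.+1) // mulrC.
Qed.

Fact ps_mul1 : left_id (ps_const 1) ps_mul.
Proof.
move=> f; apply/pseriesP => i /=; rewrite big_ord_recl subn0 mul1r.
by rewrite big1 ?addr0 // => j _; rewrite mul0r.
Qed.

Fact ps_mulDl : left_distributive ps_mul ps_add.
Proof.
move=> f g h; apply/pseriesP => i /=; rewrite -big_split /=.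
by apply: eq_bigr => j _; rewrite mulrDl.
Qed.

Fact ps_1neq0 : ps_const 1 != 0 :> pseries K.
Proof.
by apply/eqP => /pseriesP/(_ 0%N) /= /eqP; rewrite oner_eq0.
Qed.

HB.instance Definition _ := GRing.Zmodule_isComNzRing.Build (pseries K)
  ps_mulA ps_mulC ps_mul1 ps_mulDl ps_1neq0.

Lemma scoefM f g i :
  scoef (f * g) i = \sum_(j < i.+1) scoef f j * scoef g (i - j)%N.
Proof. by []. Qed.

Definition ps_deriv f := PSeries (fun i => i.+1%:R * scoef f i.+1).

Lemma ps_derivD f g : ps_deriv (f + g) = ps_deriv f + ps_deriv g.
Proof. by apply/pseriesP => i /=; rewrite mulrDr. Qed.

Lemma ps_derivM f g : ps_deriv (f * g) = ps_deriv f * g + f * ps_deriv g.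
Proof.
apply/pseriesP => i; pose tr := ps_trunc i.+2.
have dtr h j : (j < i.+1)%N -> ((tr h)^`())`_j = scoef (ps_deriv h) j.
  by move=> ji; rewrite coef_deriv coef_poly ltnS ji /= mulr_natl.
have trE h j : (j < i.+1)%N -> (tr h)`_j = scoef h j.
  by move=> ji; rewrite coef_poly ltnS ltnW.
have -> : scoef (ps_deriv (f * g)) i = ((tr f * tr g)^`())`_i.
  by rewrite coef_deriv -(@ps_mulE _ _ i.+2) // -mulr_natl.
rewrite derivM coefD; congr (_ + _); rewrite coefM /=; apply: eq_bigr => j _.
- by rewrite dtr ?ltn_ord // trE // ltnS leq_subr.
- by rewrite dtr ?ltnS ?leq_subr // trE ?ltn_ord.
Qed.

End PSeriesRing.

Section Growth.
Context {R : realType} {p : nat} {K : cdvfType R p}.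
Implicit Types f g : pseries K.

Definition bounded_series f : Prop := has_ubound (range (fun i => vnorm (scoef f i))).

Definition disc_series f : Prop := forall eta : R, 0 < eta -> eta < 1 ->
  (fun i => vnorm (scoef f i) * eta ^+ i) @ \oo --> (0 : R).

Definition log_growth (delta : R) f : Prop :=
  if 0 <= delta
  then has_ubound (range (fun i => vnorm (scoef f i) / i.+1%:R `^ delta))
  else bounded_series f.

Lemma bounded_seriesP f :
  bounded_series f <-> exists2 C : R, 0 <= C & forall i, vnorm (scoef f i) <= C.
Proof.
split=> [[C Cub]|[C _ h]]; last by exists C => _ [i _ <-].
have h i : vnorm (scoef f i) <= C by apply: Cub; exists i.
by exists C => //; apply: le_trans (h 0%N); exact: vnorm_ge0.
Qed.

Lemma disc_seriesP f : disc_series f <->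
  forall eta : R, 0 < eta -> eta < 1 ->
  exists2 C : R, 0 <= C & forall i, vnorm (scoef f i) * eta ^+ i <= C.
Proof.
split=> h eta e0 e1.
  have /cvg_seq_bounded : cvgn (fun i => vnorm (scoef f i) * eta ^+ i).
    by apply/cvg_ex; exists 0; exact: h.
  move=> [M [Mr Mh]]; exists (`|M| + 1) => [|i]; first by rewrite addr_ge0.
  have := Mh (`|M| + 1); rewrite (le_lt_trans (ler_norm _)) ?ltrDl // => /(_ isT).
  move=> /(_ i I); apply: le_trans; exact: ler_norm.
pose r := (1 + eta) / 2.
have r0 : 0 < r by rewrite divr_gt0 ?addr_gt0.
have r1 : r < 1 by rewrite ltr_pdivrMr // mul1r -[2]/(1 + 1) ltrD2l.
have er : eta < r by rewrite ltr_pdivlMr // mulrDr mulr1 ltrD2r.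
have [C C0 hC] := h r r0 r1.
have q0 : 0 <= eta / r by rewrite divr_ge0 ?ltW.
have q1 : `|eta / r| < 1 by rewrite ger0_norm // ltr_pdivrMr // mul1r.
apply: (@squeeze_cvgr _ _ _ _ (fun=> 0) (fun i => C * (eta / r) ^+ i)).
- apply: nearW => i; rewrite mulr_ge0 ?vnorm_ge0 ?(exprn_ge0 _ (ltW e0)) //=.
  have -> : eta ^+ i = r ^+ i * (eta / r) ^+ i.
    by rewrite -exprMn mulrCA divff ?mulr1 // gt_eqF.
  by rewrite mulrA ler_wpM2r ?exprn_ge0.
- exact: cvg_cst.
- exact: (@cvg_geometric R C _ q1).
Qed.

Definition bounded_pred : pred (pseries K) := fun f => `[< bounded_series f >].
Definition disc_pred : pred (pseries K) := fun f => `[< disc_series f >].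

Fact bounded_subring : subring_closed bounded_pred.
Proof.
split=> [|f g|f g].
- apply/asboolP/bounded_seriesP; exists 1 => // -[|i] /=.
    by rewrite vnorm1.
  by rewrite vnorm0.
- move=> /asboolP/bounded_seriesP[C C0 hC] /asboolP/bounded_seriesP[D D0 hD].
  apply/asboolP/bounded_seriesP; exists (Num.max C D) => [|i] /=.
    by rewrite le_max C0.
  apply: (le_trans (vnorm_ultra _ _)).
  by rewrite vnormN ge_max !le_max hC hD orbT.
- move=> /asboolP/bounded_seriesP[C C0 hC] /asboolP/bounded_seriesP[D D0 hD].
  apply/asboolP/bounded_seriesP; exists (C * D) => [|i] /=; first exact: mulr_ge0.
  apply: vnorm_sum_le => [|j _]; first exact: mulr_ge0.
  by rewrite vnormM ler_pM // vnorm_ge0.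
Qed.

Fact disc_subring : subring_closed disc_pred.
Proof.
split=> [|f g|f g].
- apply/asboolP/disc_seriesP => eta e0 e1; exists 1 => // -[|i] /=.
    by rewrite vnorm1 mulr1.
  by rewrite vnorm0 mul0r.
- move=> /asboolP/disc_seriesP hf /asboolP/disc_seriesP hg.
  apply/asboolP/disc_seriesP => eta e0 e1.
  have [C C0 hC] := hf _ e0 e1; have [D D0 hD] := hg _ e0 e1.
  exists (Num.max C D) => [|i] /=; first by rewrite le_max C0.
  have ei : 0 <= eta ^+ i by rewrite exprn_ge0 ?ltW.
  apply: (le_trans (ler_wpM2r ei (vnorm_ultra _ _))).
  by rewrite vnormN maxr_pMl // ge_max !le_max hC hD orbT.
- move=> /asboolP/disc_seriesP hf /asboolP/disc_seriesP hg.
  apply/asboolP/disc_seriesP => eta e0 e1.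
  have [C C0 hC] := hf _ e0 e1; have [D D0 hD] := hg _ e0 e1.
  exists (C * D) => [|i]; first exact: mulr_ge0.
  have ei : 0 < eta ^+ i by rewrite exprn_gt0.
  rewrite -ler_pdivlMr //.
  apply: vnorm_sum_le => [|j _]; first by rewrite divr_ge0 ?mulr_ge0 // ltW.
  rewrite ler_pdivlMr // vnormM.
  have -> : eta ^+ i = eta ^+ j * eta ^+ (i - j).
    by rewrite -exprD subnKC // -ltnS.
  by rewrite mulrACA ler_pM ?mulr_ge0 ?vnorm_ge0 ?exprn_ge0 // ltW.
Qed.

HB.instance Definition _ :=
  GRing.isSubringClosed.Build (pseries K) bounded_pred bounded_subring.
HB.instance Definition _ :=
  GRing.isSubringClosed.Build (pseries K) disc_pred disc_subring.

Lemma bounded_disc f : bounded_series f -> disc_series f.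
Proof.
move=> /bounded_seriesP[C C0 hC]; apply/disc_seriesP => eta e0 e1.
exists C => // i; rewrite -[leRHS]mulr1 ler_pM ?vnorm_ge0 //.
  by rewrite exprn_ge0 ?ltW.
by rewrite exprn_ile1 // ltW.
Qed.

Lemma log_growth_disc delta f : log_growth delta f -> disc_series f.
Proof.
rewrite /log_growth; case: ifPn => [d0 [C hC]|_]; last exact: bounded_disc.
apply/disc_seriesP => eta e0 e1.
pose a := - ln eta; have a0 : 0 < a by rewrite oppr_gt0 ln_lt0 // e0 e1.
pose d := delta + 1; have dp : 0 < d by rewrite ltr_wpDl.
pose b := a / d; have b0 : 0 < b by rewrite divr_gt0.
have i0 i : 0 < i.+1%:R :> R by rewrite ltr0n.
have hb i : i.+1%:R `^ delta * eta ^+ i <= expR (a - d - d * ln b).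
  have -> : eta ^+ i = expR (- a * i%:R).
    by rewrite opprK expRM_natr lnK ?posrE.
  rewrite /powR gt_eqF // -expRD ler_expR.
  have l0 : 0 <= ln i.+1%:R :> R by rewrite ln_ge0 // ler1n.
  have : ln (i.+1%:R * b) <= i.+1%:R * b - 1.
    by rewrite -[leLHS]/(ln _) -{1}[_ * b](subrK 1) addrC le_ln1Dx // ltrBrDl subrr mulr_gt0.
  rewrite lnM ?posrE // -(ler_pM2l dp).
  have -> : d * (i.+1%:R * b - 1) = a * i%:R + a - d.
    by rewrite /b -natr1; field; rewrite gt_eqF.
  have : delta * ln i.+1%:R <= d * ln i.+1%:R by rewrite ler_wpM2r // lerDl.
  lra.
have C0 : 0 <= C.
  apply: (le_trans _ (hC _ (imageT _ 0%N))).
  by rewrite divr_ge0 ?vnorm_ge0 ?powR_ge0.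
exists (C * expR (a - d - d * ln b)) => [|i].
  by rewrite mulr_ge0 // expR_ge0.
have pi0 : 0 < i.+1%:R `^ delta by rewrite powR_gt0.
have -> : vnorm (scoef f i) * eta ^+ i =
  vnorm (scoef f i) / i.+1%:R `^ delta * (i.+1%:R `^ delta * eta ^+ i).
  by rewrite mulrA divfK // gt_eqF.
apply: ler_pM => //.
- by rewrite divr_ge0 ?vnorm_ge0 // ltW.
- by rewrite mulr_ge0 ?exprn_ge0 // ltW.
- exact: hC (imageT _ i).
Qed.

Lemma bounded_const c : bounded_series (ps_const c : pseries K).
Proof.
apply/bounded_seriesP; exists (vnorm c) => [|[|i]] //=; first exact: vnorm_ge0.
by rewrite vnorm0 vnorm_ge0.
Qed.

Lemma bounded_deriv f : bounded_series f -> bounded_series (ps_deriv f).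
Proof.
move=> /bounded_seriesP[C C0 hC]; apply/bounded_seriesP; exists C => // i /=.
by rewrite vnormM -[leRHS]mul1r ler_pM ?vnorm_ge0 ?vnorm_nat.
Qed.

Lemma disc_deriv f : disc_series f -> disc_series (ps_deriv f).
Proof.
move=> /disc_seriesP hf; apply/disc_seriesP => eta e0 e1.
have [C C0 hC] := hf _ e0 e1; exists (C / eta) => [|i /=].
  by rewrite divr_ge0 // ltW.
rewrite ler_pdivlMr // -mulrA -exprSr vnormM -mulrA -[leRHS]mul1r.
by rewrite ler_pM ?vnorm_nat ?vnorm_ge0 // mulr_ge0 ?vnorm_ge0 ?exprn_ge0 ?ltW.
Qed.

End Growth.

(* K[[t]]_0 *)
Record boundedSeries (R : realType) (p : nat) (K : cdvfType R p) :=
  BoundedSeries { bs_val : pseries K; _ : bs_val \in bounded_pred }.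

(* K{t} *)
Record discSeries (R : realType) (p : nat) (K : cdvfType R p) :=
  DiscSeries { ds_val : pseries K; _ : ds_val \in disc_pred }.

Section SeriesRings.
Context {R : realType} {p : nat} {K : cdvfType R p}.

HB.instance Definition _ := [isSub for @bs_val R p K].
HB.instance Definition _ := [Choice of boundedSeries K by <:].
HB.instance Definition _ := [SubChoice_isSubComNzRing of boundedSeries K by <:].
HB.instance Definition _ := [isSub for @ds_val R p K].
HB.instance Definition _ := [Choice of discSeries K by <:].
HB.instance Definition _ := [SubChoice_isSubComNzRing of discSeries K by <:].

Fact bs_const_subproof (c : K) : ps_const c \in bounded_pred.
Proof. exact/asboolP/bounded_const. Qed.
Definition bs_const c : boundedSeries K := BoundedSeries (bs_const_subproof c).

Fact bs_deriv_subproof (f : boundedSeries K) : ps_deriv (val f) \in bounded_pred.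
Proof. by case: f => f hf; apply/asboolP/bounded_deriv; exact/asboolP. Qed.
Definition bs_deriv f : boundedSeries K := BoundedSeries (bs_deriv_subproof f).

Fact ds_deriv_subproof (f : discSeries K) : ps_deriv (val f) \in disc_pred.
Proof. by case: f => f hf; apply/asboolP/disc_deriv; exact/asboolP. Qed.
Definition ds_deriv f : discSeries K := DiscSeries (ds_deriv_subproof f).

Fact bs_ds_subproof (f : boundedSeries K) : val f \in disc_pred.
Proof. by case: f => f hf; apply/asboolP/bounded_disc; exact/asboolP. Qed.
Definition bs_ds f : discSeries K := DiscSeries (bs_ds_subproof f).

Definition ds_scale (a : boundedSeries K) (f : discSeries K) := bs_ds a * f.

Fact ds_scaleA a b f : ds_scale a (ds_scale b f) = ds_scale (a * b) f.
Proof. by apply: val_inj; rewrite /ds_scale /= mulrA. Qed.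
Fact ds_scale1 : left_id 1 ds_scale.
Proof. by move=> f; apply: val_inj; rewrite /ds_scale /= mul1r. Qed.
Fact ds_scaleDr : right_distributive ds_scale +%R.
Proof. by move=> a f g; apply: val_inj; rewrite /ds_scale /= mulrDr. Qed.
Fact ds_scaleDl f : {morph ds_scale^~ f : a b / a + b}.
Proof. by move=> a b; apply: val_inj; rewrite /ds_scale /= mulrDl. Qed.

HB.instance Definition _ := GRing.Zmodule_isLmodule.Build (boundedSeries K)
  (discSeries K) ds_scaleA ds_scale1 ds_scaleDr ds_scaleDl.

Lemma ds_derivD (f g : discSeries K) : ds_deriv (f + g) = ds_deriv f + ds_deriv g.
Proof. by apply: val_inj => /=; rewrite ps_derivD. Qed.

Lemma ds_derivZ (a : boundedSeries K) (f : discSeries K) :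
  ds_deriv (a *: f) = bs_deriv a *: f + a *: ds_deriv f.
Proof. by apply: val_inj => /=; rewrite ps_derivM. Qed.

End SeriesRings.

Section TensorRel.
Context {A : comNzRingType} {M N : lmodType A}.

(* A list of pairs (m, n) stands for the formal sum of the m (x) n.  Opposites
   are given by (- m, n), so no formal negation is needed. *)
Inductive tensor_rel : seq (M * N) -> seq (M * N) -> Prop :=
| TRefl s : tensor_rel s s
| TSym s t : tensor_rel s t -> tensor_rel t s
| TTrans s t u : tensor_rel s t -> tensor_rel t u -> tensor_rel s u
| TCat s s' t t' : tensor_rel s s' -> tensor_rel t t' ->
    tensor_rel (s ++ t) (s' ++ t')
| TComm s t : tensor_rel (s ++ t) (t ++ s)
| TZero : tensor_rel [:: (0, 0)] [::]
| TAddl m m' n : tensor_rel [:: (m + m', n)] [:: (m, n); (m', n)]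
| TAddr m n n' : tensor_rel [:: (m, n + n')] [:: (m, n); (m, n')]
| TBal a m n : tensor_rel [:: (a *: m, n)] [:: (m, a *: n)].

Definition tensor_relb : rel (seq (M * N)) := fun s t => `[< tensor_rel s t >].

Fact tensor_relb_refl : reflexive tensor_relb.
Proof. by move=> s; apply/asboolP; exact: TRefl. Qed.
Fact tensor_relb_sym : symmetric tensor_relb.
Proof. by move=> s t; apply/asboolP/asboolP; exact: TSym. Qed.
Fact tensor_relb_trans : transitive tensor_relb.
Proof.
by move=> t s u /asboolP st /asboolP tu; apply/asboolP; exact: TTrans tu.
Qed.

Canonical tensor_equiv :=
  EquivRel tensor_relb tensor_relb_refl tensor_relb_sym tensor_relb_trans.

End TensorRel.

Definition tensor (A : comNzRingType) (M N : lmodType A) : Type :=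
  {eq_quot (@tensor_equiv A M N)}%qT.

Section Tensor.
Context {A : comNzRingType} {M N : lmodType A}.
Local Notation T := (tensor M N).

HB.instance Definition _ := Choice.on T.

Definition tclass (s : seq (M * N)) : T := \pi_({eq_quot (@tensor_equiv A M N)})%qT s.
Definition trepr (x : T) : seq (M * N) :=
  repr (x : {eq_quot (@tensor_equiv A M N)}%qT).

Lemma treprK x : tclass (trepr x) = x.
Proof. exact: reprK. Qed.

Lemma tclass_eqP (s t : seq (M * N)) : tclass s = tclass t <-> tensor_rel s t.
Proof. by split=> [/eqmodP/asboolP //|st]; apply/eqmodP/asboolP. Qed.

Lemma trepr_rel (s : seq (M * N)) : tensor_rel (trepr (tclass s)) s.
Proof. by apply/tclass_eqP; rewrite treprK. Qed.

Definition tens (m : M) (n : N) : T := tclass [:: (m, n)].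

Definition tensor0 : T := tclass [::].
Definition tensor_add (x y : T) : T := tclass (trepr x ++ trepr y).
Definition tensor_opp (x : T) : T := tclass [seq (- q.1, q.2) | q <- trepr x].
Definition tensor_scale (a : A) (x : T) : T :=
  tclass [seq (a *: q.1, q.2) | q <- trepr x].

Let addE s t : tensor_add (tclass s) (tclass t) = tclass (s ++ t).
Proof. by apply/tclass_eqP; apply: TCat; exact: trepr_rel. Qed.

Let tens0l (n : N) : tensor_rel [:: (0, n)] [:: (0 : M, 0 : N)].
Proof. by have := TBal 0 (0 : M) n; rewrite !scale0r. Qed.

Let scale_rel a (s t : seq (M * N)) : tensor_rel s t ->
  tensor_rel [seq (a *: q.1, q.2) | q <- s] [seq (a *: q.1, q.2) | q <- t].
Proof.
elim=> {s t} /= [s|s t _|s t u _ + _|s s' t t' _ + _|s t||m m' n|m n n'|b m n].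
- exact: TRefl.
- exact: TSym.
- exact: TTrans.
- by rewrite !map_cat; exact: TCat.
- by rewrite !map_cat; exact: TComm.
- by rewrite scaler0; exact: TZero.
- by rewrite scalerDr; exact: TAddl.
- exact: TAddr.
- by rewrite scalerA mulrC -scalerA; exact: TBal.
Qed.

Let scaleE a s :
  tensor_scale a (tclass s) = tclass [seq (a *: q.1, q.2) | q <- s].
Proof. by apply/tclass_eqP; apply/scale_rel/trepr_rel. Qed.

Fact tensor_addA : associative tensor_add.
Proof.
move=> x y z; rewrite -[x]treprK -[y]treprK -[z]treprK.
by rewrite !addE catA.
Qed.

Fact tensor_addC : commutative tensor_add.
Proof. by move=> x y; apply/tclass_eqP; exact: TComm. Qed.

Fact tensor_add0 : left_id tensor0 tensor_add.
Proof. by move=> x; rewrite -[x]treprK addE. Qed.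

Fact tensor_addN : left_inverse tensor0 tensor_opp tensor_add.
Proof.
move=> x; have -> : tensor_opp x = tensor_scale (- 1) x.
  congr (tclass _); apply: eq_map => q; by rewrite scaleN1r.
rewrite -[x]treprK scaleE addE; apply/tclass_eqP.
elim: (trepr x) => [|[m n] s ih] /=; first exact: TRefl.
rewrite scaleN1r.
apply: (@TTrans _ _ _ _ (([:: (m, n)] ++ ([seq (-1 *: q.1, q.2) | q <- s] ++ s))
   ++ [:: (- m, n)])).
  apply: TTrans (TComm [:: (- m, n)] _) _; apply: TCat; last exact: TRefl.
  rewrite -[(m, n) :: s]cat1s catA [X in tensor_rel _ X]catA.
  by apply: TCat; [exact: TComm|exact: TRefl].
apply: TTrans (TCat (TCat (TRefl _) ih) (TRefl _)) _ => /=.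
apply: TTrans (TSym (TAddl m (- m) n)) _; rewrite subrr.
exact: TTrans (tens0l n) TZero.
Qed.

HB.instance Definition _ :=
  GRing.isZmodule.Build T tensor_addA tensor_addC tensor_add0 tensor_addN.

Fact tensor_scaleA a b x :
  tensor_scale a (tensor_scale b x) = tensor_scale (a * b) x.
Proof.
rewrite -[x]treprK !scaleE -map_comp; congr (tclass _); apply: eq_map => q /=.
by rewrite scalerA.
Qed.

Fact tensor_scale1 : left_id 1 tensor_scale.
Proof.
move=> x; rewrite -[x]treprK scaleE; congr (tclass _).
by rewrite -[RHS]map_id; apply: eq_map => -[m n]; rewrite scale1r.
Qed.

Fact tensor_scaleDr : right_distributive tensor_scale +%R.
Proof.
move=> a x y; rewrite -[x]treprK -[y]treprK.
move: (trepr x) (trepr y) => s t.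
rewrite -[tclass s + tclass t]/(tensor_add _ _) -[RHS]/(tensor_add _ _) addE !scaleE addE.
by rewrite map_cat.
Qed.

Fact tensor_scaleDl x : {morph tensor_scale^~ x : a b / a + b}.
Proof.
move=> a b; rewrite -[x]treprK !scaleE -[RHS]/(tensor_add _ _) addE; apply/tclass_eqP.
elim: (trepr x) => [|[m n] s ih] /=; first exact: TRefl.
rewrite -[_ :: _]cat1s scalerDl.
apply: TTrans (TCat (TAddl _ _ _) ih) _ => /=.
apply: (@TCat _ _ _ [:: _] [:: _] (_ :: _) _ (TRefl _)).
rewrite -cat_rcons -cats1 -cat_cons; apply: TCat; last exact: TRefl.
exact: (@TComm _ _ _ [:: _]).
Qed.

HB.instance Definition _ := GRing.Zmodule_isLmodule.Build A T
  tensor_scaleA tensor_scale1 tensor_scaleDr tensor_scaleDl.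

Lemma tensDl m m' n : tens (m + m') n = tens m n + tens m' n.
Proof. by rewrite -[RHS]/(tensor_add _ _) addE; apply/tclass_eqP; exact: TAddl. Qed.

Lemma tensDr m n n' : tens m (n + n') = tens m n + tens m n'.
Proof. by rewrite -[RHS]/(tensor_add _ _) addE; apply/tclass_eqP; exact: TAddr. Qed.

Lemma tensZl a m n : tens (a *: m) n = a *: tens m n.
Proof. by rewrite -[RHS]/(tensor_scale _ _) scaleE. Qed.

Lemma tensZr a m n : tens m (a *: n) = a *: tens m n.
Proof. by rewrite -tensZl; apply/tclass_eqP/TSym; exact: TBal. Qed.

Lemma tensor_sum (s : seq (M * N)) :
  tclass s = \sum_(q <- s) tens q.1 q.2.
Proof.
elim: s => [|[m n] s ih]; first by rewrite big_nil.
by rewrite big_cons -ih -[RHS]/(tensor_add _ _) addE.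
Qed.

Lemma tensorE (x : T) : x = \sum_(q <- trepr x) tens q.1 q.2.
Proof. by rewrite -tensor_sum treprK. Qed.

(* The additive map T -> V induced by a biadditive balanced map M -> N -> V. *)
Section Lift.
Context {V : zmodType} (b : M -> N -> V).

Definition tensor_lift (x : T) : V := \sum_(q <- trepr x) b q.1 q.2.

Hypothesis bDl : forall m m' n, b (m + m') n = b m n + b m' n.
Hypothesis bDr : forall m n n', b m (n + n') = b m n + b m n'.
Hypothesis bZ : forall a m n, b (a *: m) n = b m (a *: n).

Lemma tensor_lift_pi s : tensor_lift (tclass s) = \sum_(q <- s) b q.1 q.2.
Proof.
suff h t t' : tensor_rel t t' -> \sum_(q <- t) b q.1 q.2 = \sum_(q <- t') b q.1 q.2.
  exact/h/trepr_rel.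
elim=> {s t t'} //=.
- by move=> s t u _ -> _.
- by move=> s s' t t' _ + _; rewrite !big_cat /= => -> ->.
- by move=> s t; rewrite !big_cat /= addrC.
- rewrite big_seq1 big_nil /=; apply: (addrI (b 0 0)).
  by rewrite -bDl !addr0.
- by move=> m m' n; rewrite !big_cons !big_nil !addr0 bDl.
- by move=> m n n'; rewrite !big_cons !big_nil !addr0 bDr.
- by move=> a m n; rewrite !big_seq1 bZ.
Qed.

Lemma tensor_liftE m n : tensor_lift (tens m n) = b m n.
Proof. by rewrite tensor_lift_pi big_seq1. Qed.

Lemma tensor_liftD x y : tensor_lift (x + y) = tensor_lift x + tensor_lift y.
Proof. by rewrite tensor_lift_pi big_cat. Qed.

End Lift.
End Tensor.

Definition free_of_rank (A : comNzRingType) (M : lmodType A) (n : nat) : Prop :=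
  exists e : 'I_n -> M, forall m : M,
    exists! c : {ffun 'I_n -> A}, m = \sum_(i < n) c i *: e i.

Record diffModule (R : realType) (p : nat) (K : cdvfType R p) := DiffModule {
  dm_sort :> lmodType (boundedSeries K);
  dm_D : dm_sort -> dm_sort;
  dm_DD : forall m m', dm_D (m + m') = dm_D m + dm_D m';
  dm_leibniz : forall (r : boundedSeries K) (m : dm_sort),
    dm_D (r *: m) = bs_deriv r *: m + r *: dm_D m;
  dm_free : exists n, free_of_rank dm_sort n
}.

Section Horizontal.
Context {R : realType} {p : nat} {K : cdvfType R p} (M : diffModule K).
Local Notation MKt := (tensor M (discSeries K)).

(* D on M (x) K{t}; see [tensor_DE] and [tensor_DD]. *)
Definition tensor_D : MKt -> MKt :=
  tensor_lift (fun m f => tens (dm_D m) f + tens m (ds_deriv f)).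

Let Db (m : M) (f : discSeries K) : MKt := tens (dm_D m) f + tens m (ds_deriv f).

Let DbDl m m' f : Db (m + m') f = Db m f + Db m' f.
Proof. by rewrite /Db dm_DD !tensDl addrACA. Qed.
Let DbDr m f f' : Db m (f + f') = Db m f + Db m f'.
Proof. by rewrite /Db ds_derivD !tensDr addrACA. Qed.
Let DbZ a m f : Db (a *: m) f = Db m (a *: f).
Proof.
rewrite /Db dm_leibniz ds_derivZ tensDl tensDr !tensZl !tensZr.
by rewrite -addrA addrCA.
Qed.

Lemma tensor_DE m f :
  tensor_D (tens m f) = tens (dm_D m) f + tens m (ds_deriv f).
Proof. exact: (tensor_liftE DbDl DbDr DbZ). Qed.

Lemma tensor_DD x y : tensor_D (x + y) = tensor_D x + tensor_D y.
Proof. exact: (tensor_liftD DbDl DbDr DbZ). Qed.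

(* M (x) K[[t]]_delta as a submodule of M (x) K{t}; since M is free, the map
   between the two tensor products is injective. *)
Definition tensor_growth (delta : R) : set MKt :=
  [set x | exists2 s : seq (M * discSeries K),
     (forall q, q \in s -> log_growth delta (val q.2)) &
     x = \sum_(q <- s) tens q.1 q.2].

(* (M (x) K{t})^{nabla = 0} *)
Definition horizontal : set MKt := [set x | tensor_D x = 0].

(* (M (x) K[[t]]_delta)^{nabla = 0} *)
Definition horizontal_growth (delta : R) : set MKt :=
  [set x | tensor_growth delta x /\ tensor_D x = 0].

End Horizontal.

Arguments tensor_growth {R p K} M delta.
Arguments horizontal {R p K} M.
Arguments horizontal_growth {R p K} M delta.

Section Dimension.
Context {R : realType} {p : nat} {K : cdvfType R p}.
Context {V : lmodType (boundedSeries K)}.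

(* K acts on V through the constant series. *)
Definition is_Kbasis (W : set V) (n : nat) (e : 'I_n -> V) : Prop :=
  (forall c : {ffun 'I_n -> K}, W (\sum_(i < n) bs_const (c i) *: e i)) /\
  (forall x, W x ->
     exists! c : {ffun 'I_n -> K}, x = \sum_(i < n) bs_const (c i) *: e i).

Lemma bs_constD (c d : K) : bs_const (c + d) = bs_const c + bs_const d.
Proof. by apply: val_inj; apply/pseriesP => -[|i] //=; rewrite addr0. Qed.

Lemma bs_constM (c d : K) : bs_const (c * d) = bs_const c * bs_const d.
Proof.
apply: val_inj; apply/pseriesP => i.
rewrite /= big_ord_recl /= subn0 big1 ?addr0 => [|j _]; last by rewrite mul0r.
by case: i => //= i; rewrite mulr0.
Qed.

Lemma bs_const0 : bs_const (0 : K) = 0.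
Proof. by apply: val_inj; apply/pseriesP => -[|i]. Qed.

Lemma bs_const1 : bs_const (1 : K) = 1.
Proof. exact: val_inj. Qed.

Lemma bs_const_sum (I : Type) (r : seq I) (F : I -> K) :
  bs_const (\sum_(i <- r) F i) = \sum_(i <- r) bs_const (F i).
Proof. exact: (big_morph _ bs_constD bs_const0). Qed.

Lemma is_Kbasis_le (W : set V) m n (e : 'I_m -> V) (f : 'I_n -> V) :
  is_Kbasis W e -> is_Kbasis W f -> (m <= n)%N.
Proof.
move=> [eW eb] [fW fb].
have We i : W (e i).
  have := eW [ffun j => (j == i)%:R].
  rewrite (bigD1 i) //= ffunE eqxx bs_const1 scale1r big1 ?addr0 // => j ji.
  by rewrite ffunE (negPf ji) bs_const0 scale0r.
have Wf i : W (f i).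
  have := fW [ffun j => (j == i)%:R].
  rewrite (bigD1 i) //= ffunE eqxx bs_const1 scale1r big1 ?addr0 // => j ji.
  by rewrite ffunE (negPf ji) bs_const0 scale0r.
have [P hP] := choice (fun i => let: ex_intro c h := fb _ (We i) in
  ex_intro (fun c : {ffun 'I_n -> K} => e i = \sum_(k < n) bs_const (c k) *: f k)
    c (proj1 h)).
have [Q hQ] := choice (fun i => let: ex_intro c h := eb _ (Wf i) in
  ex_intro (fun c : {ffun 'I_m -> K} => f i = \sum_(k < m) bs_const (c k) *: e k)
    c (proj1 h)).
apply: (@mulmx1_min K _ _ (\matrix_(i, j) P i j) (\matrix_(i, j) Q i j)).
apply/matrixP => i k; rewrite !mxE.
have [c [_ cu]] := eb _ (We i).
have h1 : c = [ffun j => (i == j)%:R].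
  apply: cu; rewrite (bigD1 i) //= ffunE eqxx bs_const1 scale1r big1 ?addr0 //.
  by move=> j ji; rewrite ffunE eq_sym (negPf ji) bs_const0 scale0r.
have h2 : c = [ffun l => \sum_j P i j * Q j l].
  apply: cu; rewrite [LHS]hP; under eq_bigr do rewrite hQ scaler_sumr.
  rewrite exchange_big /=; apply: eq_bigr => l _.
  rewrite ffunE bs_const_sum scaler_suml; apply: eq_bigr => j _.
  by rewrite scalerA bs_constM.
have := congr1 (fun g : {ffun _} => g k) (etrans (esym h2) h1); rewrite !ffunE => <-.
by apply: eq_bigr => j _; rewrite !mxE.
Qed.

Lemma is_Kbasis_uniq (W : set V) m n (e : 'I_m -> V) (f : 'I_n -> V) :
  is_Kbasis W e -> is_Kbasis W f -> m = n.
Proof.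
by move=> he hf; apply/eqP; rewrite eqn_leq !(is_Kbasis_le he hf, is_Kbasis_le hf he).
Qed.

(* The dimension of a finite-dimensional K-subspace W (junk value 0 otherwise). *)
Definition Kdim (W : set V) : nat :=
  xget 0%N [set n | exists e : 'I_n -> V, is_Kbasis W e].

End Dimension.

(* Main.v *)
Require Import Defs.
From HB Require Import structures.
From mathcomp Require Import all_boot all_order all_algebra generic_quotient.
From mathcomp Require Import all_classical all_reals all_analysis.
From mathcomp Require Import ring lra.
Set Implicit Arguments.
Unset Strict Implicit.
Unset Printing Implicit Defensive.
Import Order.TTheory GRing.Theory Num.Theory.
Import numFieldNormedType.Exports.
Local Open Scope classical_set_scope.
Local Open Scope ring_scope.

(** In a basis of [M] the horizontal sections are the solutions [v = (f, g)] of
    [v' = G v] with [G] a bounded 2x2 matrix.  Let [|.|_r], [r < 1], be the Gauss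
    norms, extended to the fraction field of [K{t}], let [D] be the dual
    connection on rows, [D x = x' + x G], and fix a solution [v <> 0] in [K{t}].

    If all the divided powers [D^n / n!] act on the determinant with norm at most
    1, then for [u = g / f] (say [|g|_r <= |f|_r]) the row [(- u, 1)] spans a
    [D]-stable line, both it and the quotient line are solvable, and the
    off-diagonal entry of [D] is bounded; this gives [|D^n / n!|_r <= C (n + 1) r^-n]
    with [C] independent of [r].  As [r] tends to 1, every formal solution has
    log-growth at most 1, so [m' = 2] and the claim holds.

    Otherwise every solution is bounded.  Indeed, if [v] is not, the rows of
    [D^n / n!] have unbounded norm while their products with [v] are small, so
    near the boundary [g / f] is approximated by some [u0] in the fraction field
    of [K[[t]]_0].  The determinant forces some [D^l / l!] to expand the row
    [(- u0, 1)], and then the Newton iteration [u - A / B], where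
    [D^l / l!] maps [(- u, 1)] to [A (1, 0) + B (- u, 1)], converges to [g / f] for
    each [r] near 1, through fractions whose denominators have no zero of absolute
    value [r].  All the [f^(n) / (n! f)] are then approximated by such fractions;
    for [n] the largest dominant index of [f] this forces [f] to have no zero of
    absolute value [r].  So [f] has finitely many zeros and is bounded. *)

(** * Divided powers of a connection *)

Section IterLeibniz.
Variables (U V W : zmodType) (D1 : U -> U) (D2 : V -> V) (D3 : W -> W).
Variable b : U -> V -> W.
Hypothesis D3D : forall x y, D3 (x + y) = D3 x + D3 y.
Hypothesis D3b : forall x y, D3 (b x y) = b (D1 x) y + b x (D2 y).

(** Induction on [n] with Pascal's rule. The pairing [b] is abstract so that the formula serves
    products, multiples of rows and determinants of rows alike. *)
Lemma iter_leibniz n x y : iter n D3 (b x y) =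
  \sum_(j < n.+1) b (iter j D1 x) (iter (n - j) D2 y) *+ 'C(n, j).
Proof.
have D30 : D3 0 = 0 by apply: (addrI (D3 0)); rewrite -D3D !addr0.
have D3n z k : D3 (z *+ k) = D3 z *+ k.
  by elim: k => [|k ih]; rewrite ?mulr0n // !mulrS D3D ih.
elim: n => [|n ih]; first by rewrite big_ord_recl big_ord0 addr0.
rewrite iterS ih (big_morph _ D3D D30).
under eq_bigr => j _ do rewrite D3n D3b mulrnDl.
pose T j := b (iter j D1 x) (iter (n.+1 - j) D2 y).
rewrite big_split /= -[RHS]/(\sum_(j < n.+2) T j *+ 'C(n.+1, j)).
rewrite -[X in X + _]/(\sum_(j < n.+1) T j.+1 *+ 'C(n, j)).
have -> : \sum_(i < n.+1) b (iter i D1 x) (D2 (iter (n - i) D2 y)) *+ 'C(n, i)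
    = \sum_(j < n.+1) T j *+ 'C(n, j).
  by apply: eq_bigr => j _; rewrite -iterS -subSn // -ltnS.
rewrite [RHS]big_ord_recl /= [X in _ = _ + X](_ : _ =
  \sum_(j < n.+1) T j.+1 *+ 'C(n, j.+1) + \sum_(j < n.+1) T j.+1 *+ 'C(n, j)).
  rewrite addrA [RHS]addrC; congr (_ + _).
  rewrite big_ord_recl /= !bin0; congr (_ + _).
  by rewrite [RHS]big_ord_recr /= bin_small // mulr0n addr0.
by rewrite -big_split; apply: eq_bigr => j _; rewrite /= binS mulrnDr.
Qed.

End IterLeibniz.

Section Divided.
Variable F : fieldType.
Hypothesis char0 : forall n, n.+1%:R != 0 :> F.

Lemma natf_fact n : (n`!)%:R != 0 :> F.
Proof. by case: (n`!) (fact_gt0 n) => // m _; exact: char0. Qed.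

(** Divided by n!, the iterates obey a Leibniz rule without binomial coefficients and, for d/dt,
    have Gauss norm at most r^-n. *)
Definition hder (V : lmodType F) (D : V -> V) (n : nat) (x : V) : V :=
  (n`!%:R)^-1 *: iter n D x.

Section Leibniz.
Variables (U V W : lmodType F) (D1 : U -> U) (D2 : V -> V) (D3 : W -> W).
Variable b : U -> V -> W.
Hypothesis D3D : forall x y, D3 (x + y) = D3 x + D3 y.
Hypothesis D3b : forall x y, D3 (b x y) = b (D1 x) y + b x (D2 y).
Hypothesis bZ : forall a c x y, b (a *: x) (c *: y) = (a * c) *: b x y.

Lemma hder_leibniz n x y :
  hder D3 n (b x y) = \sum_(j < n.+1) b (hder D1 j x) (hder D2 (n - j) y).
Proof.
rewrite {1}/hder (iter_leibniz D3D D3b) scaler_sumr; apply: eq_bigr => j _.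
have jn : (j <= n)%N by rewrite -ltnS.
rewrite bZ -scaler_nat scalerA; congr (_ *: _).
rewrite -(bin_fact jn) !natrM !invfM mulrAC mulVf ?mul1r //.
have := natf_fact n; rewrite -(bin_fact jn) natrM mulf_eq0 negb_or.
by case/andP.
Qed.

End Leibniz.
End Divided.

(** * Rank two row systems, the dual connection and its determinant *)

Definition rowD (T : pzRingType) (d : T -> T) (a11 a12 a21 a22 : T)
    (x : T * T) : T * T :=
  (d x.1 + x.1 * a11 + x.2 * a21, d x.2 + x.1 * a12 + x.2 * a22).

(** The connection induced on the second exterior power of the rows; its matrix is the trace of
    G. *)
Definition detD (T : pzRingType) (d : T -> T) (a11 a22 : T) (c : T) : T :=
  d c + c * (a11 + a22).

Section RowSystem.
Variables (F : fieldType) (d : F -> F) (a11 a12 a21 a22 : F).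
Hypothesis char0 : forall n, n.+1%:R != 0 :> F.
Hypothesis dD : forall x y, d (x + y) = d x + d y.
Hypothesis dM : forall x y, d (x * y) = d x * y + x * d y.

Local Notation D := (rowD d a11 a12 a21 a22).

Definition hscal n (x : F) : F := n`!%:R^-1 * iter n d x.
Definition hwronsk n (x : F) : F := n`!%:R^-1 * iter n (detD d a11 a22) x.
Definition hrow1 n (x : F * F) : F := n`!%:R^-1 * (iter n D x).1.
Definition hrow2 n (x : F * F) : F := n`!%:R^-1 * (iter n D x).2.
Definition rscale (c : F) (x : F * F) : F * F := (c * x.1, c * x.2).
Definition rdet (x y : F * F) : F := x.1 * y.2 - x.2 * y.1.

(** The vector space structure on pairs that lets [hder_leibniz] apply; [hrow1] and [hrow2] are the
    coordinates of [hD]. *)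
Let row : lmodType F := (F^o * F^o)%type.
Let hD n (x : row) : row := @hder F row D n x.

Let d0 : d 0 = 0. Proof. by apply: (addrI (d 0)); rewrite -dD !addr0. Qed.
Let dN x : d (- x) = - d x.
Proof. by apply: (addrI (d x)); rewrite -dD !subrr d0. Qed.

Lemma rowDD x y : D (x.1 + y.1, x.2 + y.2) =
  ((D x).1 + (D y).1, (D x).2 + (D y).2).
Proof. by rewrite /rowD /= !dD; congr pair; ring. Qed.

Lemma hscal0 x : hscal 0 x = x. Proof. by rewrite /hscal invr1 mul1r. Qed.
Lemma hrow10 x : hrow1 0 x = x.1. Proof. by rewrite /hrow1 invr1 mul1r. Qed.
Lemma hrow20 x : hrow2 0 x = x.2. Proof. by rewrite /hrow2 invr1 mul1r. Qed.
Lemma hrow2S n x : hrow2 n.+1 x = n.+1%:R^-1 * hrow2 n (D x).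
Proof. by rewrite /hrow2 mulrA factS natrM invfM iterSr. Qed.

Lemma hscalM n x y : hscal n (x * y) = \sum_(j < n.+1) hscal j x * hscal (n - j) y.
Proof.
apply: (@hder_leibniz F char0 F^o F^o F^o d d d (fun x y => x * y)) => //.
by move=> a c z t; rewrite /GRing.scale /= mulrACA.
Qed.

Let hDZ n (c : F) (x : row) :
  hD n (c *: x) = \sum_(j < n.+1) (hscal j c : F) *: hD (n - j) x.
Proof.
apply: (@hder_leibniz F char0 F^o row row d _ _ (fun c x => c *: x)) => //.
- by move=> z t; exact: rowDD.
- by move=> z t; rewrite /rowD /=; congr pair; rewrite /= /GRing.scale /= dM; ring.
by move=> a b z t; rewrite /GRing.scale /=; congr pair; rewrite /= /GRing.scale /= mulrACA.
Qed.

Lemma hrow1Z n c x : hrow1 n (rscale c x) = \sum_(j < n.+1) hscal j c * hrow1 (n - j) x.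
Proof.
by have := congr1 fst (hDZ n c x); rewrite (big_morph fst (id1 := 0) (op1 := +%R)).
Qed.

Lemma hrow2Z n c x : hrow2 n (rscale c x) = \sum_(j < n.+1) hscal j c * hrow2 (n - j) x.
Proof.
by have := congr1 snd (hDZ n c x); rewrite (big_morph snd (id1 := 0) (op1 := +%R)).
Qed.

Let iterDD n x y : iter n D (x.1 + y.1, x.2 + y.2) =
  ((iter n D x).1 + (iter n D y).1, (iter n D x).2 + (iter n D y).2).
Proof. by elim: n => //= n ->; rewrite rowDD. Qed.

Lemma hrow1D n x y : hrow1 n (x.1 + y.1, x.2 + y.2) = hrow1 n x + hrow1 n y.
Proof. by rewrite /hrow1 -mulrDr iterDD. Qed.
Lemma hrow2D n x y : hrow2 n (x.1 + y.1, x.2 + y.2) = hrow2 n x + hrow2 n y.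
Proof. by rewrite /hrow2 -mulrDr iterDD. Qed.

(** The determinant of two rows is a pairing compatible with [rowD] and [detD], so the general
    Leibniz rule applies to it. *)
Lemma hwronsk_rdet n x y : hwronsk n (rdet x y) =
  \sum_(j < n.+1) (hrow1 j x * hrow2 (n - j) y - hrow2 j x * hrow1 (n - j) y).
Proof.
apply: (@hder_leibniz F char0 row row F^o _ _ _ rdet) => //.
- by move=> z t; rewrite /detD dD; ring.
- by move=> z t; rewrite /detD /rdet /rowD /= dD dN !dM; ring.
- by move=> a b z t; rewrite /rdet /= /GRing.scale /=; ring.
Qed.

(** For a solution v = (f, g) one has (x . v)' = (D x) . v; iterate and divide by n!. *)
Lemma hscal_pair f g n x : d f = a11 * f + a12 * g -> d g = a21 * f + a22 * g ->
  hscal n (x.1 * f + x.2 * g) = hrow1 n x * f + hrow2 n x * g.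
Proof.
move=> df dg.
have h m : iter m d (x.1 * f + x.2 * g) = (iter m D x).1 * f + (iter m D x).2 * g.
  by elim: m => //= m ->; rewrite dD !dM df dg; ring.
by rewrite /hscal /hrow1 /hrow2 h; ring.
Qed.

End RowSystem.

Arguments hder : simpl never.
Arguments hscal : simpl never.
Arguments hrow1 : simpl never.
Arguments hrow2 : simpl never.
Arguments hwronsk : simpl never.

Lemma expr_small (R : realType) (q e : R) : 0 <= q -> q < 1 -> 0 < e ->
  exists k, q ^+ k <= e.
Proof.
move=> q0 q1 e0; have qn : `|q| < 1 by rewrite ger0_norm.
have /cvgrPdist_lt/(_ e e0)[k _ /(_ k (leqnn k))] := cvg_expr qn.
by rewrite sub0r normrN ger0_norm ?exprn_ge0 // => /ltW; exists k.
Qed.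

(** * Ultrametric estimates for a fixed norm [N], with [rho] in the role of 1/r *)

Section NormedSystem.
Variables (R : realType) (F : fieldType) (N : F -> R) (d : F -> F) (rho : R).
Hypothesis char0 : forall n, n.+1%:R != 0 :> F.
Hypothesis dD : forall x y, d (x + y) = d x + d y.
Hypothesis dM : forall x y, d (x * y) = d x * y + x * d y.
Hypothesis N_ge0 : forall x, 0 <= N x.
Hypothesis N_eq0 : forall x, (N x == 0) = (x == 0).
Hypothesis NM : forall x y, N (x * y) = N x * N y.
Hypothesis ND : forall x y, N (x + y) <= Num.max (N x) (N y).
Hypothesis rho1 : 1 <= rho.
Hypothesis Nhd : forall n x, N (hscal d n x) <= rho ^+ n * N x.

Let N0 : N 0 = 0. Proof. by apply/eqP; rewrite N_eq0. Qed.
Let N1 : N 1 = 1.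
Proof.
have n0 : N 1 != 0 by rewrite N_eq0 oner_eq0.
by apply: (mulfI n0); rewrite -NM !mulr1.
Qed.
Let NN x : N (- x) = N x.
Proof.
suff h : N (- 1) = 1 by rewrite -mulN1r NM h mul1r.
have : N (- 1) ^+ 2 = 1 by rewrite expr2 -NM mulrNN mulr1 N1.
move/eqP; rewrite sqrf_eq1 => /orP[/eqP //|/eqP h].
by have := N_ge0 (- 1); rewrite h oppr_ge0 ler10.
Qed.
Let NV x : N x^-1 = (N x)^-1.
Proof.
have [->|x0] := eqVneq x 0; first by rewrite invr0 N0 invr0.
have nx : N x != 0 by rewrite N_eq0.
by apply: (mulfI nx); rewrite -NM !divff // N1.
Qed.
Let NDle x y C : N x <= C -> N y <= C -> N (x + y) <= C.
Proof. by move=> hx hy; apply: le_trans (ND _ _) _; rewrite ge_max hx. Qed.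
Let NBle x y C : N x <= C -> N y <= C -> N (x - y) <= C.
Proof. by move=> hx hy; apply: NDle; rewrite ?NN. Qed.
Let Nsum (I : Type) (r : seq I) (P : pred I) (G : I -> F) (C : R) :
  0 <= C -> (forall i, P i -> N (G i) <= C) -> N (\sum_(i <- r | P i) G i) <= C.
Proof.
move=> C0 h; elim/big_ind: _ => //; first by rewrite N0.
by move=> x y; exact: NDle.
Qed.
Let rho0 : 0 < rho. Proof. exact: lt_le_trans rho1. Qed.
Let rX n : 0 < rho ^+ n. Proof. exact: exprn_gt0. Qed.
Let rX1 n : 1 <= rho ^+ n. Proof. exact: exprn_ege1. Qed.
Let rXle m n : (m <= n)%N -> rho ^+ m <= rho ^+ n.
Proof. by move=> mn; apply: ler_weXn2l. Qed.

Variables (a11 a12 a21 a22 f g : F).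
Hypothesis df : d f = a11 * f + a12 * g.
Hypothesis dg : d g = a21 * f + a22 * g.
Hypothesis f0 : f != 0.

Local Notation D := (rowD d a11 a12 a21 a22).
Local Notation h1 := (hrow1 d a11 a12 a21 a22).
Local Notation h2 := (hrow2 d a11 a12 a21 a22).
Local Notation hL := (hwronsk d a11 a22).
Local Notation hd := (hscal d).
Local Notation e1 := (1 : F, 0 : F).
Local Notation e2 := (0 : F, 1 : F).
Local Notation ebar u := (- u : F, 1 : F).

Let hd00 n : hd n 0 = 0.
Proof.
apply/eqP; rewrite -N_eq0 eq_le N_ge0 andbT; apply: le_trans (Nhd _ _) _.
by rewrite N0 mulr0.
Qed.

Let Nf : 0 < N f. Proof. by rewrite lt_def N_ge0 N_eq0 f0. Qed.

Section Solvable.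
Variable C : R.
Hypothesis gf : N g <= N f.
Hypothesis C1 : 1 <= C.
Hypothesis a12C : N a12 <= C.
Hypothesis hLle : forall n, N (hL n 1) <= rho ^+ n.
Hypothesis Nnat : forall n, N (n.+1%:R)^-1 <= n.+1%:R.

Let u := g / f.
Let Nu : N u <= 1. Proof. by rewrite NM NV ler_pdivrMr // mul1r. Qed.
Let uf : u * f = g. Proof. by rewrite divfK. Qed.
(** Since (x1, x2) = (x1 + u x2) (1, 0) + x2 (- u, 1), [alpha] is the coordinate of D^n / n! (1, 0)
    modulo the line of (- u, 1), and [gam] is the factor by which D^n / n! acts on that line. *)
Let alpha n := h1 n e1 + u * h2 n e1.
Let gam n := h2 n (ebar u).

Let alphaE n : alpha n * f = hd n f.
Proof.
have := hscal_pair dD dM n e1 df dg; rewrite /= mul1r mul0r addr0 => ->.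
by rewrite /alpha mulrDl (mulrAC u) uf (mulrC g).
Qed.

Let Nalpha n : N (alpha n) <= rho ^+ n.
Proof. by rewrite -(ler_pM2r Nf) -NM alphaE. Qed.

(** The row (- u, 1) annihilates the solution, hence so do its images under the divided powers,
    which therefore lie on the same line. *)
Let ebarE n : h1 n (ebar u) = - u * gam n.
Proof.
have := hscal_pair dD dM n (ebar u) df dg.
rewrite /= mul1r mulNr uf addNr hd00 => /esym /eqP.
rewrite addr_eq0 => /eqP h; apply: (mulIf f0); rewrite h.
by rewrite (mulNr u) mulNr (mulrAC u) uf (mulrC g).
Qed.

Let gamE n : hL n 1 = \sum_(j < n.+1) alpha j * gam (n - j).
Proof.
have -> : 1 = rdet e1 (ebar u) by rewrite /rdet /=; ring.
rewrite (@hwronsk_rdet _ _ _ a12 a21 _ char0 dD dM); apply: eq_bigr => j _.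
by rewrite ebarE /alpha /gam; ring.
Qed.

(** In the expansion of the determinant the term j = 0 is [gam n] itself, as [alpha 0] is 1; the
    other terms are bounded by induction and by [Nalpha]. *)
Let Ngam n : N (gam n) <= rho ^+ n.
Proof.
elim/ltn_ind: n => n ih.
have -> : gam n = hL n 1 - \sum_(j < n) alpha j.+1 * gam (n - j.+1).
  rewrite gamE big_ord_recl /= subn0.
  have -> : alpha 0 = 1 by rewrite /alpha hrow10 hrow20 /= mulr0 addr0.
  by rewrite mul1r addrK.
apply: NBle => //; apply: Nsum => [|j _]; first exact: ltW.
rewrite NM -[in leRHS](@subnKC j.+1 n) // exprD ler_pM //.
by apply: ih; rewrite ltn_subrL /= (leq_ltn_trans _ (ltn_ord j)).
Qed.

(* [w] is horizontal modulo [ebar u], so that only one division by an integer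
   enters the bound on [h2 n e1]. *)
Let w := rscale f^-1 e1.

Let dV : d f^-1 = - (f^-1 * d f * f^-1).
Proof.
have d1 : d 1 = 0.
  by apply: (addrI (d 1)); rewrite addr0 -{3}(mulr1 1) dM mulr1 mul1r.
have : d (f * f^-1) = 0 by rewrite divff.
rewrite dM => /eqP; rewrite addrC addr_eq0 => /eqP h.
by apply: (mulfI f0); rewrite h; field.
Qed.

(** The row [w] pairs to 1 with the solution, so [D w] annihilates it and is a multiple of (- u,
    1). *)
Let Dw : D w = rscale (a12 / f) (ebar u).
Proof.
rewrite /rowD /w /rscale /= !mulr0 !mul0r !addr0 !mulr1 dV df /u.
have d0 : d 0 = 0 by apply: (addrI (d 0)); rewrite -dD !addr0.
by rewrite d0; congr pair; field.
Qed.

Let Nw n : N (h2 n.+1 w) <= n.+1%:R * (rho ^+ n * (C / N f)).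
Proof.
rewrite hrow2S Dw hrow2Z // NM ler_pM //.
apply: Nsum => [|j _].
  by rewrite mulr_ge0 ?divr_ge0 ?(ltW (rX _)) // (le_trans _ C1).
rewrite NM.
have jn : (j <= n)%N by rewrite -ltnS.
have -> : rho ^+ n = rho ^+ j * rho ^+ (n - j) by rewrite -exprD subnKC.
rewrite (mulrAC (rho ^+ j)) ler_pM //; last exact: Ngam.
apply: le_trans (Nhd _ _) _; rewrite ler_pM2l // NM NV ler_pM2r //.
by rewrite invr_gt0.
Qed.

Let Nq n : N (h2 n e1) <= n%:R * rho ^+ n * C.
Proof.
have C0 : 0 <= C by exact: le_trans C1.
have -> : e1 = rscale f w by rewrite /w /rscale /= mulr0 mulr1 divff // mulr0.
rewrite hrow2Z //; apply: Nsum => [|j _]; first by rewrite !mulr_ge0 // ltW.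
rewrite NM.
have jn : (j <= n)%N by rewrite -ltnS.
(* For n - j = 0 the term vanishes, because the second coordinate of [w] is 0. *)
case: (n - j)%N (subnKC jn) => [|k] nE.
  by rewrite hrow20 /= mulr0 N0 mulr0 !mulr_ge0 // ltW.
apply: le_trans (ler_pM _ _ (Nhd _ _) (Nw _)) _ => //.
have -> : rho ^+ j * N f * (k.+1%:R * (rho ^+ k * (C / N f))) =
   k.+1%:R * rho ^+ (j + k) * C.
  by rewrite exprD; field; rewrite gt_eqF.
rewrite ler_wpM2r // ler_pM ?(ltW (rX _)) //.
  by rewrite ler_nat -nE leq_addl.
by apply: rXle; apply: ltnW; move: (ltnSn (j + k)); rewrite -addnS nE.
Qed.

(** In the basis (1, 0), (- u, 1) the divided powers are triangular with diagonal [alpha], [gam],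
    and [Nq] bounds the remaining entry. Returning to (0, 1) = (- u, 1) + u (1, 0) costs nothing, as
    u has norm at most 1. *)
Lemma solvable_bound n : [/\ N (h1 n e1) <= n.+1%:R * rho ^+ n * C,
  N (h2 n e1) <= n.+1%:R * rho ^+ n * C, N (h1 n e2) <= n.+1%:R * rho ^+ n * C &
  N (h2 n e2) <= n.+1%:R * rho ^+ n * C].
Proof.
have C0 : 0 <= C by exact: le_trans C1.
have one m : (m <= n)%N -> rho ^+ m <= n.+1%:R * rho ^+ n * C.
  move=> mn; rewrite -[leLHS]mulr1 ler_pM ?(ltW (rX _)) //.
  by rewrite -[leLHS]mul1r ler_pM ?(ltW (rX _)) ?rXle // ler1n.
have q m : N (h2 m e1) <= m.+1%:R * rho ^+ m * C.
  apply: le_trans (Nq m) _; rewrite ler_wpM2r // ler_wpM2r ?(ltW (rX _)) //.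
  by rewrite ler_nat.
have p m : N (h1 m e1) <= m.+1%:R * rho ^+ m * C.
  have -> : h1 m e1 = alpha m - u * h2 m e1 by rewrite /alpha addrK.
  apply: NBle; last first.
    by rewrite NM -[leRHS]mul1r ler_pM.
  apply: le_trans (Nalpha m) _; rewrite -[leLHS]mulr1 ler_pM ?(ltW (rX _)) //.
  by rewrite -[leLHS]mul1r ler_pM ?(ltW (rX _)) // ler1n.
have e2E : e2 = ((ebar u).1 + (rscale u e1).1, (ebar u).2 + (rscale u e1).2).
  by rewrite /= mulr1 addNr mulr0 addr0.
have X0 : 0 <= n.+1%:R * rho ^+ n * C by rewrite !mulr_ge0 // ltW.
have tl (j : nat) x : (j <= n)%N -> N x <= (n - j).+1%:R * rho ^+ (n - j) * C ->
    N (hd j u * x) <= n.+1%:R * rho ^+ n * C.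
  move=> jn hx; rewrite NM; apply: le_trans (ler_pM _ _ (Nhd _ _) hx) _ => //.
  have -> : rho ^+ j * N u * ((n - j).+1%:R * rho ^+ (n - j) * C) =
     N u * ((n - j).+1%:R * rho ^+ n * C).
    by rewrite -[in RHS](subnKC jn) exprD addKn; ring.
  rewrite -[leRHS]mul1r ler_pM //; first by rewrite !mulr_ge0 // ltW.
  by rewrite ler_wpM2r // ler_wpM2r ?(ltW (rX _)) // ler_nat ltnS leq_subr.
split=> //; rewrite e2E ?hrow1D ?hrow2D ?ebarE ?hrow1Z ?hrow2Z //; apply: NDle.
- rewrite NM NN; apply: le_trans (one n _) => //.
  by rewrite -[leRHS]mul1r ler_pM.
- by apply: Nsum => // j _; apply: tl => //; by rewrite -ltnS.
- by apply: le_trans (Ngam _) (one n _).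
- by apply: Nsum => // j _; apply: tl => //; by rewrite -ltnS.
Qed.

End Solvable.

(** * Approximate solution lines and the Newton iteration *)

Section Newton.
Variables (C eps : R).
Hypothesis eps0 : 0 <= eps.

(** The same coordinates, now for any [u]: D^k / k! maps (- u, 1) to A (1, 0) + B (- u, 1), where A
    is controlled by the error g - u f. *)
Let alpha u j := h1 j e1 + u * h2 j e1.
Let A u k := h1 k (ebar u) + u * h2 k (ebar u).
Let B u k := h2 k (ebar u).

Let alphaE u j : alpha u j * f = hd j f - h2 j e1 * (g - u * f).
Proof.
have := hscal_pair dD dM j e1 df dg; rewrite /= mul1r mul0r addr0 => ->.
by rewrite /alpha; ring.
Qed.

Let AE u k : A u k * f = hd k (g - u * f) - B u k * (g - u * f).
Proof.
have := hscal_pair dD dM k (ebar u) df dg; rewrite /= mul1r.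
have -> : - u * f + g = g - u * f by rewrite addrC mulNr.
by move=> ->; rewrite /A /B; ring.
Qed.

(** Expand the determinant of (1, 0) and (- u, 1). The products of [alpha] and [B] are at most
    [kap], because [alpha u j] has norm at most rho^j; those of [h2] and [A] are at most 1, because
    the error g - u f is small. It is used in the contrapositive: a large determinant forces some
    [B] to be large. *)
Lemma det_le u n0 kap : N (g - u * f) <= eps * N f -> 1 <= C -> 1 <= kap ->
  (forall j, (j <= n0)%N -> N (h2 j e1) <= C) ->
  (forall j, (j <= n0)%N -> N (h2 j (ebar u)) <= C) ->
  C * C * eps * rho ^+ n0 <= 1 ->
  (forall j, (j <= n0)%N -> N (h2 j (ebar u)) * rho ^+ (n0 - j) <= kap) ->
  N (hL n0 1) <= kap.
Proof.
move=> hs C1 k1 hq hB small hk.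
have C0 : 0 <= C by exact: le_trans C1.
have Ce0 : 0 <= C * eps by exact: mulr_ge0.
have CeR : C * (C * eps * rho ^+ n0) <= 1.
  by apply: le_trans small; rewrite !mulrA.
have Ce1 : C * eps <= 1.
  apply: le_trans small.
  have -> : C * C * eps * rho ^+ n0 = (C * rho ^+ n0) * (C * eps) by ring.
  by rewrite ler_peMl // mulr_ege1.
have -> : 1 = rdet e1 (ebar u) by rewrite /rdet /=; ring.
rewrite (@hwronsk_rdet _ _ _ a12 a21 _ char0 dD dM).
apply: Nsum => [|j _]; first exact: le_trans k1.
have jn : (j <= n0)%N by rewrite -ltnS.
have kn : (n0 - j <= n0)%N by exact: leq_subr.
have -> : h1 j e1 * h2 (n0 - j) (ebar u) - h2 j e1 * h1 (n0 - j) (ebar u) =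
    alpha u j * B u (n0 - j) - h2 j e1 * A u (n0 - j).
  by rewrite /alpha /A /B; ring.
apply: NBle.
  apply: le_trans (hk _ kn); rewrite NM mulrC subKn //.
  rewrite ler_wpM2l // -(ler_pM2r Nf) -NM alphaE; apply: NBle => //.
  rewrite NM; apply: le_trans (ler_pM _ _ (hq _ jn) hs) _ => //.
  by rewrite mulrA ler_wpM2r // (le_trans Ce1).
apply: le_trans k1; apply: le_trans CeR; rewrite NM ler_pM ?hq //.
rewrite -(ler_pM2r Nf) -NM AE.
have r1 : rho ^+ (n0 - j) <= C * rho ^+ n0.
  by rewrite -[leLHS]mul1r ler_pM ?(ltW (rX _)) ?rXle.
apply: NBle.
  apply: le_trans (Nhd _ _) _; apply: le_trans (ler_pM _ _ r1 hs) _ => //.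
    exact: ltW.
  by rewrite le_eqVlt; apply/orP; left; apply/eqP; ring.
rewrite NM; apply: le_trans (ler_pM _ _ (hB _ kn) hs) _ => //.
by rewrite mulrA ler_wpM2r // ler_peMr.
Qed.

(** [S] stands for the fractions whose denominators have no zero of absolute value r; [SV] keeps the
    divisions of the iteration inside [S]. *)
Variable S : F -> Prop.
Hypothesis S1 : S 1.
Hypothesis SN : forall x, S x -> S (- x).
Hypothesis SD : forall x y, S x -> S y -> S (x + y).
Hypothesis SM : forall x y, S x -> S y -> S (x * y).
Hypothesis Sd : forall x, S x -> S (d x).
Hypothesis Sn : forall n, S (n.+1%:R^-1).
Hypothesis Sa : [/\ S a11, S a12, S a21 & S a22].
Hypothesis SV : forall x y, S x -> S y -> S y^-1 -> N (x - y) < N y -> S x^-1.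

Let Sh n x : S x.1 -> S x.2 -> S (h1 n x) /\ S (h2 n x).
Proof.
have [S11 S12 S21 S22] := Sa; move=> S_1 S_2.
have [T1 T2] : S (iter n D x).1 /\ S (iter n D x).2.
  elim: n => //= n [h k].
  by split; rewrite /=; apply: (SD (SD (Sd _) (SM _ _)) (SM _ _)).
have Sf : S (n`!%:R^-1).
  by case: n`! (fact_gt0 n) => // m _; exact: Sn.
by split; apply: SM.
Qed.

(** A step u - A / B replaces the error g - u f by its n-th divided derivative over B, which
    contracts it by [theta] < 1. Once u is close enough to g / f, [alpha u m] approximates the m-th
    divided derivative of f over f. *)
Lemma newton_approx n u0 : S u0 -> N (g - u0 * f) <= eps * N f ->
  (forall j, (j <= n)%N -> N (h2 j e1) * rho ^+ (n - j) <= C) ->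
  C * eps < N (h2 n (ebar u0)) -> rho ^+ n < N (h2 n (ebar u0)) ->
  S (h2 n (ebar u0))^-1 ->
  forall m eps', 0 < eps' -> exists2 X, S X & N (hd m f - X * f) <= eps' * N f.
Proof.
move=> Su0 hs hC hB hr SB m eps' e'0.
have C0 : 0 <= C by apply: le_trans (hC 0 _) => //; rewrite mulr_ge0 // ltW.
have S0 : S 0 by rewrite -(subrr 1); apply: SD => //; exact: SN.
have NB0 : 0 < N (h2 n (ebar u0)) by exact: lt_trans hr.
pose theta := rho ^+ n / N (h2 n (ebar u0)).
have th0 : 0 <= theta by rewrite divr_ge0 // ltW.
have th1 : theta < 1 by rewrite /theta ltr_pdivrMr // mul1r.
(* The iterates stay within [eps] of [u0], so B stays so close to its value at [u0] that its norm
   does not drop and its inverse remains in [S]. *)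
have it k : exists u, [/\ S u, N (u - u0) <= eps &
    N (g - u * f) <= theta ^+ k * eps * N f].
  elim: k => [|k [u [Su uu0 us]]].
    by exists u0; rewrite subrr N0 expr0 mul1r.
  have hBB : N (B u n - B u0 n) <= C * eps.
    have e : ebar u = ((ebar u0).1 + (rscale (u0 - u) e1).1,
                       (ebar u0).2 + (rscale (u0 - u) e1).2).
      by rewrite /= !mulr0 mulr1 addr0 addrA addNr add0r.
    rewrite /B e hrow2D // addrC addKr hrow2Z //.
    apply: Nsum => [|j _]; first by rewrite mulr_ge0.
    have jn : (j <= n)%N by rewrite -ltnS.
    rewrite NM; apply: le_trans (ler_pM _ _ (Nhd _ _) (lexx _)) _ => //.
    have := hC _ (leq_subr j n); rewrite subKn // => hCj.
    rewrite mulrAC ler_pM ?mulr_ge0 ?(ltW (rX _)) //; first by rewrite mulrC.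
    by rewrite -opprB NN.
  have NBB : N (B u0 n) <= N (B u n).
    rewrite leNgt; apply/negP => lt.
    have := ND (B u n) (- (B u n - B u0 n)).
    rewrite NN opprB addrC subrK; apply/negP.
    by rewrite -ltNge gt_max lt (le_lt_trans hBB).
  have NB : 0 < N (B u n) by exact: lt_le_trans NBB.
  have B0 : B u n != 0 by rewrite -N_eq0 gt_eqF.
  have [T1 T2] : S (A u n) /\ S (B u n).
    have [t1 t2] := @Sh n (ebar u) (SN Su) S1.
    by split=> //; apply: SD => //; exact: SM.
  exists (u - A u n / B u n); split.
  - apply: SD => //; apply: SN; apply: SM => //.
    by apply: (SV T2 _ SB); [exact: (@Sh n (ebar u0) (SN Su0) S1).2|exact: le_lt_trans hB].
  - have -> : u - A u n / B u n - u0 = (u - u0) - A u n / B u n by ring.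
    apply: NBle => //; rewrite NM NV ler_pdivrMr // -(ler_pM2r Nf) -NM AE.
    have es : N (g - u * f) <= eps * N f.
      apply: le_trans us _; rewrite ler_wpM2r // ler_piMl //.
      by apply: exprn_ile1 => //; exact: ltW.
    have -> : eps * N (B u n) * N f = N (B u n) * (eps * N f) by ring.
    apply: NBle; last by rewrite NM ler_wpM2l.
    apply: le_trans (Nhd _ _) _; rewrite ler_pM ?(ltW (rX _)) //.
    exact: le_trans (ltW hr) NBB.
  (* By [AE], A f + B (g - u f) is the n-th divided derivative of g - u f; dividing by B gives the
     new error. *)
  - have -> : g - (u - A u n / B u n) * f = hd n (g - u * f) / B u n.
      have := AE u n => /(congr1 (fun z => z / B u n)).
      rewrite mulrBl [B u n * _]mulrC mulfK // => h.
      by rewrite mulrBl opprB addrCA addrC; move: h; rewrite mulrAC => ->; ring.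
    rewrite NM NV ler_pdivrMr //; apply: le_trans (Nhd _ _) _.
    apply: le_trans (ler_pM _ _ (lexx _) us) _ => //; first exact: ltW.
    have -> : rho ^+ n = theta * N (B u0 n) by rewrite divfK // gt_eqF.
    have -> : theta * N (B u0 n) * (theta ^+ k * eps * N f) =
      theta ^+ k.+1 * eps * N f * N (B u0 n) by rewrite exprS; ring.
    by rewrite ler_wpM2l // !mulr_ge0 // exprn_ge0.
have [Sp Sq] := @Sh m e1 S1 S0.
have q0 : 0 <= N (h2 m e1) * eps by exact: mulr_ge0.
(* The summand 1 keeps the denominator positive when [N (h2 m e1) * eps] is 0. *)
have [|k hk] := @expr_small R theta (eps' / (N (h2 m e1) * eps + 1)) th0 th1.
  by rewrite divr_gt0 // ltr_wpDl.
have [u [Su _ us]] := it k.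
exists (alpha u m); first by apply: SD => //; exact: SM.
rewrite alphaE opprB addrC subrK NM.
apply: le_trans (ler_wpM2l (N_ge0 _) us) _.
rewrite !mulrA ler_wpM2r //.
rewrite ler_pdivlMr ?ltr_wpDl // in hk; apply: le_trans hk.
rewrite mulrAC mulrC mulrDr mulr1 mulrA lerDl; exact: exprn_ge0.
Qed.

End Newton.
End NormedSystem.

(** * Gauss norms on K{t} *)

Lemma natrS_neq0 (R : realType) (p : nat) (K : cdvfType R p) n : n.+1%:R != 0 :> K.
Proof. by have /pcharf0P -> := @pchar_cdvf R p K. Qed.

Section GaussNorm.
Context {R : realType} {p : nat} {K : cdvfType R p}.
Implicit Types (f g h : discSeries K) (r : R).

Definition dcoef f i : K := scoef (val f) i.

Definition gauss r f : R := sup (range (fun i => vnorm (dcoef f i) * r ^+ i)).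

(** The smallest and, next, the largest dominant index at radius r. By the theory of Newton polygons
    their difference counts the zeros of absolute value r. *)
Definition is_lo r f i := vnorm (dcoef f i) * r ^+ i = gauss r f /\
  forall j, (j < i)%N -> vnorm (dcoef f j) * r ^+ j < gauss r f.

Definition is_hi r f i := vnorm (dcoef f i) * r ^+ i = gauss r f /\
  forall j, (i < j)%N -> vnorm (dcoef f j) * r ^+ j < gauss r f.

Lemma vnorm_sum_lt (I : Type) (s : seq I) (P : pred I) (F : I -> K) (C : R) :
  0 < C -> (forall i, P i -> vnorm (F i) < C) -> vnorm (\sum_(i <- s | P i) F i) < C.
Proof.
move=> C0 h; elim/big_ind: _ => //; first by rewrite vnorm0.
move=> x y hx hy; apply: (le_lt_trans (vnorm_ultra _ _)).
by rewrite gt_max hx hy.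
Qed.

Lemma vnorm_addl (x y : K) : vnorm y < vnorm x -> vnorm (x + y) = vnorm x.
Proof.
move=> yx; apply/eqP; rewrite eq_le; apply/andP; split.
  by apply: le_trans (vnorm_ultra _ _) _; rewrite ge_max lexx ltW.
rewrite leNgt; apply/negP => lt.
have := vnorm_ultra (x + y) (- y); rewrite addrK vnormN.
by apply/negP; rewrite -ltNge gt_max lt yx.
Qed.

Lemma dcoefM f g i : dcoef (f * g) i = \sum_(j < i.+1) dcoef f j * dcoef g (i - j).
Proof. by []. Qed.
Lemma dcoefD f g i : dcoef (f + g) i = dcoef f i + dcoef g i.
Proof. by []. Qed.
Lemma dcoefN f i : dcoef (- f) i = - dcoef f i.
Proof. by []. Qed.
Lemma dcoef0 i : dcoef 0 i = 0.
Proof. by []. Qed.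

Lemma dcoefP f g : (forall i, dcoef f i = dcoef g i) -> f = g.
Proof. by move=> h; apply: val_inj; apply/pseriesP. Qed.

Lemma dcoef_nat n i : dcoef n%:R i = if i is 0%N then n%:R else 0.
Proof.
elim: n => [|n ih]; first by case: i.
by rewrite -natr1 dcoefD ih; case: i {ih} => [|i] /=; rewrite -?natr1 ?addr0.
Qed.

Lemma disc_val f : disc_series (val f).
Proof. by case: f => f hf; exact/asboolP. Qed.

Lemma disc_terms f r : 0 < r -> r < 1 ->
  (fun i => vnorm (dcoef f i) * r ^+ i) @ \oo --> (0 : R).
Proof. by move=> r0 r1; exact: (disc_val f r0 r1). Qed.

Section FixedRadius.
Variable r : R.
Hypotheses (r0 : 0 < r) (r1 : r < 1).

Let rX i : 0 < r ^+ i. Proof. exact: exprn_gt0. Qed.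
Let t_ge0 f i : 0 <= vnorm (dcoef f i) * r ^+ i.
Proof. by rewrite mulr_ge0 ?vnorm_ge0 // ltW. Qed.

Lemma gauss_ub f i : vnorm (dcoef f i) * r ^+ i <= gauss r f.
Proof.
apply: ub_le_sup; last by exists i.
have /disc_seriesP/(_ r r0 r1)[C _ hC] := disc_val f.
exists C => _ [j _ <-]; exact: hC.
Qed.

Lemma gauss_le f C : (forall i, vnorm (dcoef f i) * r ^+ i <= C) -> gauss r f <= C.
Proof.
move=> h; apply: ge_sup; first by exists (vnorm (dcoef f 0) * r ^+ 0), 0%N.
move=> _ [j _ <-]; exact: h.
Qed.

Lemma gauss_ge0 f : 0 <= gauss r f.
Proof. exact: le_trans (t_ge0 f 0) (gauss_ub f 0). Qed.

Lemma gauss0 : gauss r 0 = 0.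
Proof.
apply/eqP; rewrite eq_le gauss_ge0 andbT; apply: gauss_le => i.
by rewrite dcoef0 vnorm0 mul0r.
Qed.

Lemma gauss_gt0 f : f != 0 -> 0 < gauss r f.
Proof.
move=> f0; rewrite lt_def gauss_ge0 andbT; apply: contra_neq f0 => fr.
apply: dcoefP => i; rewrite dcoef0; apply/vnorm_eq0.
apply: (mulIf (lt0r_neq0 (rX i))); apply/eqP.
by rewrite mul0r eq_le t_ge0 -fr gauss_ub.
Qed.

Lemma gauss_eq0 f : (gauss r f == 0) = (f == 0).
Proof.
by have [->|/gauss_gt0 h] := eqVneq f 0; rewrite ?gauss0 ?eqxx // gt_eqF.
Qed.

(** The terms tend to 0, so from some n on they lie below a fixed nonzero term, and the supremum is
    a maximum over the first n indices. *)
Let gauss_att f : f != 0 -> exists n, (exists i, vnorm (dcoef f i) * r ^+ i = gauss r f) /\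
  forall i, (n <= i)%N -> vnorm (dcoef f i) * r ^+ i < gauss r f.
Proof.
move=> f0; have [j cj] : exists j, 0 < vnorm (dcoef f j) * r ^+ j.
  apply: contrapT => /forallNP h; move: (gauss_gt0 f0); apply/negP; rewrite -leNgt.
  by apply: gauss_le => i; rewrite leNgt; apply/negP.
have /cvgrPdist_lt/(_ _ cj)[n _ hn] := disc_terms f r0 r1.
have {}hn i : (n <= i)%N ->
    vnorm (dcoef f i) * r ^+ i < vnorm (dcoef f j) * r ^+ j.
  by move=> /hn /=; rewrite sub0r normrN ger0_norm.
exists n; split=> [|i /hn]; last by move/lt_le_trans; apply; exact: gauss_ub.
have jn : (j < n)%N by rewrite ltnNge; apply/negP => /hn; rewrite ltxx.
have [m _ mmax] := @arg_maxP _ R 'I_n (Ordinal jn) xpredT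
   (fun i => vnorm (dcoef f i) * r ^+ i) isT.
exists m; apply/eqP; rewrite eq_le gauss_ub /=; apply: gauss_le => i.
have [ni|ni] := ltnP i n; first exact: (mmax (Ordinal ni)).
by apply: le_trans (ltW (hn _ ni)) _; exact: (mmax (Ordinal jn)).
Qed.

Lemma lo_exists f : f != 0 -> exists i, is_lo r f i.
Proof.
move=> /gauss_att[n [ex _]].
have ex' : exists i, vnorm (dcoef f i) * r ^+ i == gauss r f.
  by have [i h] := ex; exists i; apply/eqP.
have [i /eqP h hmin] := ex_minnP ex'; exists i; split=> // j ji.
rewrite lt_neqAle gauss_ub andbT; apply: contraL ji => /hmin.
by rewrite -leqNgt.
Qed.

Lemma hi_exists f : f != 0 -> exists i, is_hi r f i.
Proof.
move=> /gauss_att[n [ex hn]].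
have ex' : exists i, vnorm (dcoef f i) * r ^+ i == gauss r f.
  by have [i h] := ex; exists i; apply/eqP.
have ub i : vnorm (dcoef f i) * r ^+ i == gauss r f -> (i <= n)%N.
  move=> /eqP h; rewrite leqNgt; apply/negP => /ltnW /hn; by rewrite h ltxx.
have [i /eqP h hmax] := ex_maxnP ex' ub; exists i; split=> // j ji.
rewrite lt_neqAle gauss_ub andbT; apply: contraL ji => /hmax.
by rewrite -leqNgt.
Qed.

Lemma lo_uniq f i j : is_lo r f i -> is_lo r f j -> i = j.
Proof.
move=> [ei hi] [ej hj]; case: (ltngtP i j) => // [/hj|/hi].
  by rewrite ei ltxx.
by rewrite ej ltxx.
Qed.

Lemma hi_uniq f i j : is_hi r f i -> is_hi r f j -> i = j.
Proof.
move=> [ei hi] [ej hj]; case: (ltngtP i j) => // [/hi|/hj].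
  by rewrite ej ltxx.
by rewrite ei ltxx.
Qed.

Lemma lo_le_hi f i j : is_lo r f i -> is_hi r f j -> (i <= j)%N.
Proof.
move=> [ei _] [_ hj]; rewrite leqNgt; apply/negP => /hj.
by rewrite ei ltxx.
Qed.

Let term_le f g k l : vnorm (dcoef f k * dcoef g l) * r ^+ (k + l) <=
  gauss r f * gauss r g.
Proof. by rewrite vnormM exprD mulrACA ler_pM ?t_ge0 ?gauss_ub. Qed.

Let term_ltl f g k l : g != 0 -> vnorm (dcoef f k) * r ^+ k < gauss r f ->
  vnorm (dcoef f k * dcoef g l) * r ^+ (k + l) < gauss r f * gauss r g.
Proof.
move=> g0 h; rewrite vnormM exprD mulrACA.
apply: le_lt_trans (ler_pM _ _ (lexx _) (gauss_ub g l)) _ => //.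
by rewrite ltr_pM2r // gauss_gt0.
Qed.

Let term_ltr f g k l : f != 0 -> vnorm (dcoef g l) * r ^+ l < gauss r g ->
  vnorm (dcoef f k * dcoef g l) * r ^+ (k + l) < gauss r f * gauss r g.
Proof.
by move=> f0 h; rewrite mulrC [X in _ < X]mulrC [X in vnorm X]mulrC addnC mulrC; exact: term_ltl.
Qed.

Let coef_lt f g m : f != 0 -> g != 0 ->
  (forall k, (k <= m)%N -> vnorm (dcoef f k) * r ^+ k < gauss r f \/
     vnorm (dcoef g (m - k)) * r ^+ (m - k) < gauss r g) ->
  vnorm (dcoef (f * g) m) * r ^+ m < gauss r f * gauss r g.
Proof.
move=> f0 g0 h; rewrite -ltr_pdivlMr // dcoefM; apply: vnorm_sum_lt => [|k _].
  by rewrite divr_gt0 // mulr_gt0 // gauss_gt0.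
have km : (k <= m)%N by rewrite -ltnS.
rewrite ltr_pdivlMr //.
have -> : r ^+ m = r ^+ (k + (m - k)) by rewrite subnKC.
by case: (h k km) => hk; [exact: term_ltl|exact: term_ltr].
Qed.

(** Exactly one product in the convolution attains the product of the norms, so nothing can cancel
    it. *)
Let coef_eq f g i j : f != 0 -> g != 0 ->
  vnorm (dcoef f i) * r ^+ i = gauss r f -> vnorm (dcoef g j) * r ^+ j = gauss r g ->
  (forall k, (k <= i + j)%N -> k <> i -> vnorm (dcoef f k) * r ^+ k < gauss r f \/
     vnorm (dcoef g (i + j - k)) * r ^+ (i + j - k) < gauss r g) ->
  vnorm (dcoef (f * g) (i + j)) * r ^+ (i + j) = gauss r f * gauss r g.
Proof.
move=> f0 g0 ei ej h; rewrite dcoefM.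
have ii : (i < (i + j).+1)%N by rewrite ltnS leq_addr.
rewrite (bigD1 (Ordinal ii)) //= addKn.
have e : vnorm (dcoef f i * dcoef g j) * r ^+ (i + j) = gauss r f * gauss r g.
  by rewrite vnormM exprD mulrACA ei ej.
rewrite vnorm_addl //.
apply: vnorm_sum_lt => [|k ki].
  by rewrite -(ltr_pM2r (rX (i + j))) mul0r e mulr_gt0 ?gauss_gt0.
have km : (k <= i + j)%N by rewrite -ltnS.
rewrite -(ltr_pM2r (rX (i + j))) e.
have -> : r ^+ (i + j) = r ^+ (k + (i + j - k)) by rewrite subnKC.
have [|hk|hk] := h k km; first by move=> e'; move: ki => /eqP; apply; exact: val_inj.
  exact: term_ltl.
exact: term_ltr.
Qed.

Let gaussM_le f g : gauss r (f * g) <= gauss r f * gauss r g.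
Proof.
apply: gauss_le => m; rewrite -ler_pdivlMr // dcoefM; apply: vnorm_sum_le => [|k _].
  by rewrite divr_ge0 ?mulr_ge0 ?gauss_ge0 // ltW.
have km : (k <= m)%N by rewrite -ltnS.
have -> : r ^+ m = r ^+ (k + (m - k)) by rewrite subnKC.
by rewrite ler_pdivlMr.
Qed.

Let lo_coef f g i j : f != 0 -> g != 0 -> is_lo r f i -> is_lo r g j ->
  vnorm (dcoef (f * g) (i + j)) * r ^+ (i + j) = gauss r f * gauss r g.
Proof.
move=> f0 g0 [ei hi] [ej hj]; apply: coef_eq => // k km ki.
case: (ltngtP k i) => // ik; first by left; exact: hi.
by right; apply: hj; rewrite ltn_subLR // ltn_add2r.
Qed.

Lemma gaussM f g : gauss r (f * g) = gauss r f * gauss r g.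
Proof.
have [->|f0] := eqVneq f 0; first by rewrite !mul0r gauss0 mul0r.
have [->|g0] := eqVneq g 0; first by rewrite !mulr0 gauss0 mulr0.
apply/eqP; rewrite eq_le gaussM_le /=.
have [i hi] := lo_exists f0; have [j hj] := lo_exists g0.
by rewrite -(lo_coef f0 g0 hi hj) gauss_ub.
Qed.

Lemma lo_mul f g i j : f != 0 -> g != 0 -> is_lo r f i -> is_lo r g j ->
  is_lo r (f * g) (i + j).
Proof.
move=> f0 g0 hi hj; split; first by rewrite (lo_coef f0 g0 hi hj) gaussM.
move=> m mij; rewrite gaussM; apply: coef_lt => // k km.
have [ki|ik] := ltnP k i; first by left; exact: hi.2.
right; apply: hj.2; rewrite ltn_subLR //; apply: leq_trans mij _.
by rewrite leq_add2r.
Qed.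

Lemma hi_mul f g i j : f != 0 -> g != 0 -> is_hi r f i -> is_hi r g j ->
  is_hi r (f * g) (i + j).
Proof.
move=> f0 g0 [ei hi] [ej hj]; split.
  rewrite gaussM; apply: coef_eq => // k km ki.
  case: (ltngtP k i) => // ik; last by left; exact: hi.
  by right; apply: hj; rewrite ltn_subRL ltn_add2r.
move=> m mij; rewrite gaussM; apply: coef_lt => // k km.
have [ki|ik] := ltnP i k; first by left; exact: hi.
right; apply: hj; rewrite ltn_subRL; apply: leq_ltn_trans mij.
by rewrite leq_add2r.
Qed.

Lemma gaussD f g : gauss r (f + g) <= Num.max (gauss r f) (gauss r g).
Proof.
apply: gauss_le => i; rewrite dcoefD.
apply: le_trans (ler_wpM2r (ltW (rX i)) (vnorm_ultra _ _)) _.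
by rewrite maxr_pMl ?(ltW (rX i)) // ge_max !le_max !gauss_ub orbT.
Qed.

Lemma gaussN f : gauss r (- f) = gauss r f.
Proof.
by congr sup; apply/seteqP; split=> _ [i _ <-]; exists i; rewrite // dcoefN vnormN.
Qed.

Lemma gauss_addl f g : gauss r g < gauss r f -> gauss r (f + g) = gauss r f.
Proof.
move=> yx; apply/eqP; rewrite eq_le; apply/andP; split.
  by apply: le_trans (gaussD _ _) _; rewrite ge_max lexx ltW.
rewrite leNgt; apply/negP => lt.
have := gaussD (f + g) (- g); rewrite addrK gaussN.
by apply/negP; rewrite -ltNge gt_max lt yx.
Qed.

(** A single dominant index: over an algebraic closure of K, f has no zero of absolute value r. *)
Definition monolike f := exists i, is_lo r f i /\ is_hi r f i.

Lemma monolike_near f h : gauss r (f - h) < gauss r h -> monolike h -> monolike f.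
Proof.
move=> fh [i [[ei lo] [_ hi]]].
have e : f = h + (f - h) by rewrite addrC subrK.
have nf : gauss r f = gauss r h by rewrite e gauss_addl.
have small j : vnorm (dcoef (f - h) j) * r ^+ j < gauss r h.
  exact: le_lt_trans (gauss_ub _ _) fh.
have lt j : vnorm (dcoef h j) * r ^+ j < gauss r h ->
    vnorm (dcoef f j) * r ^+ j < gauss r f.
  move=> hj; rewrite nf e dcoefD.
  apply: le_lt_trans (ler_wpM2r (ltW (rX j)) (vnorm_ultra _ _)) _.
  by rewrite maxr_pMl ?(ltW (rX j)) // gt_max hj small.
have eqi : vnorm (dcoef f i) * r ^+ i = gauss r f.
  by rewrite nf e dcoefD vnorm_addl // -(ltr_pM2r (rX i)) ei.
by exists i; split; split=> // j ji; apply: lt; [exact: lo|exact: hi].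
Qed.

Lemma monolikeM f g : f != 0 -> g != 0 -> monolike f -> monolike g -> monolike (f * g).
Proof.
move=> f0 g0 [i [lf hf]] [j [lg hg]]; exists (i + j)%N.
by split; [exact: lo_mul|exact: hi_mul].
Qed.

(** Smallest and largest dominant indices are both additive, so a gap between them in one factor
    would show in the product. *)
Lemma monolike_mul f g : f != 0 -> g != 0 -> monolike (f * g) -> monolike f.
Proof.
move=> f0 g0 [m [lo hi]].
have [i1 lf] := lo_exists f0; have [i2 hf] := hi_exists f0.
have [j1 lg] := lo_exists g0; have [j2 hg] := hi_exists g0.
have e1 := lo_uniq lo (lo_mul f0 g0 lf lg).
have e2 := hi_uniq hi (hi_mul f0 g0 hf hg).
have fi := lo_le_hi lf hf; have gj := lo_le_hi lg hg.
have e : i1 = i2.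
  apply/eqP; rewrite eqn_leq fi /= -(leq_add2r j1) -e1 e2.
  by rewrite leq_add2l.
by exists i1; split=> //; rewrite e.
Qed.

End FixedRadius.
End GaussNorm.

(** * The fraction field of K{t} *)

Section DiscDomain.
Context {R : realType} {p : nat} {K : cdvfType R p}.
Implicit Types f g : discSeries K.

(** Inverses are picked by classical choice; their purpose is the domain structure needed to form
    fractions. *)
Definition ds_unit : pred (discSeries K) := fun f => `[< exists g, g * f = 1 >].
Definition ds_inv f : discSeries K := xget f [set g | g * f = 1].

Fact ds_mulVx : {in ds_unit, left_inverse 1 ds_inv *%R}.
Proof. by move=> f /asboolP[g gf]; rewrite /ds_inv; case: xgetP => // /(_ g). Qed.
Fact ds_unitPl f g : g * f = 1 -> ds_unit f.
Proof. by move=> gf; apply/asboolP; exists g. Qed.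
Fact ds_inv_out : {in [predC ds_unit], ds_inv =1 id}.
Proof.
move=> f /negP fu; rewrite /ds_inv; case: xgetP => // g _ gf.
by case: fu; exact: (ds_unitPl gf).
Qed.

HB.instance Definition _ :=
  GRing.ComNzRing_hasMulInverse.Build (discSeries K) ds_mulVx ds_unitPl ds_inv_out.

(** The Gauss norm at one radius, here 1/2, is multiplicative and vanishes only at 0. *)
Fact ds_integral : GRing.integral_domain_axiom (discSeries K).
Proof.
have h0 : (0 : R) < 2^-1 by rewrite invr_gt0.
have h1 : (2^-1 : R) < 1 by rewrite invf_lt1 ?ltr1n.
move=> f g fg; rewrite -!(gauss_eq0 h0 h1) -mulf_eq0 -gaussM //.
by rewrite fg gauss0.
Qed.

HB.instance Definition _ :=
  GRing.ComUnitRing_isIntegral.Build (discSeries K) ds_integral.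

End DiscDomain.

Section QuotientRule.
Variable F : fieldType.
Implicit Types n m a b : F.

Definition qrule n n' m m' : F := (n' * m - n * m') / m ^+ 2.

(** Independence of the chosen fraction: the last two hypotheses are n b = a m and its
    derivative. *)
Lemma qrule_eq n n' m m' a a' b b' : m != 0 -> b != 0 -> n * b = a * m ->
  n' * b + n * b' = a' * m + a * m' -> qrule n n' m m' = qrule a a' b b'.
Proof.
move=> m0 b0 e de; apply/eqP; rewrite eqr_div ?expf_neq0 //; apply/eqP.
have -> : (n' * m - n * m') * b ^+ 2 =
  m * b * (n' * b + n * b') - (n * b) * (b * m' + m * b') by ring.
by rewrite de e; ring.
Qed.

Lemma qruleD n n' m m' a a' b b' : m != 0 -> b != 0 ->
  qrule (n * b + a * m) (n' * b + n * b' + (a' * m + a * m')) (m * b) (m' * b + m * b')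
  = qrule n n' m m' + qrule a a' b b'.
Proof. by move=> m0 b0; rewrite /qrule; field; rewrite m0 b0. Qed.

Lemma qruleM n n' m m' a a' b b' : m != 0 -> b != 0 ->
  qrule (n * a) (n' * a + n * a') (m * b) (m' * b + m * b')
  = qrule n n' m m' * (a / b) + n / m * qrule a a' b b'.
Proof. by move=> m0 b0; rewrite /qrule; field; rewrite m0 b0. Qed.

End QuotientRule.

Section FractionField.
Context {R : realType} {p : nat} {K : cdvfType R p}.
Implicit Types (a b : discSeries K).
Local Notation FF := {fraction (discSeries K)}.
Local Notation iota := (@tofrac (discSeries K)).
Implicit Types x y : FF.

Definition fnum (x : FF) : discSeries K := (frac (repr x)).1.
Definition fden (x : FF) : discSeries K := (frac (repr x)).2.

Lemma fden_neq0 x : fden x != 0.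
Proof. exact: denom_ratioP. Qed.

Lemma tofrac_neq0 b : b != 0 -> iota b != 0.
Proof. by rewrite tofrac_eq0. Qed.

Lemma fracE x : x = iota (fnum x) / iota (fden x).
Proof.
have d0 := tofrac_neq0 (fden_neq0 x).
apply: (mulIf d0); rewrite divfK //.
rewrite /fnum /fden; move: (repr x) (reprK x) => y <-.
unlock FracField.tofrac.
rewrite -[LHS]FracField.pi_mul; apply/eqmodP => /=.
rewrite FracField.equivfE /FracField.mulf !numden_Ratio ?mulf_neq0 ?oner_neq0 ?denom_ratioP //.
by rewrite !mulr1 mulrC.
Qed.

Lemma frac_eq a b c e : b != 0 -> e != 0 ->
  iota a / iota b = iota c / iota e -> a * e = c * b.
Proof.
move=> b0 e0 /eqP; rewrite eqr_div ?tofrac_neq0 // -!tofracM.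
by move/eqP/eqP; rewrite tofrac_eq => /eqP.
Qed.

(** This and [fder] are read off the chosen representative; [fnorm_frac] and [fder_frac] show that
    any other fraction gives the same value. *)
Definition fnorm (r : R) (x : FF) : R := gauss r (fnum x) / gauss r (fden x).

Definition fder (x : FF) : FF :=
  qrule (iota (fnum x)) (iota (ds_deriv (fnum x)))
        (iota (fden x)) (iota (ds_deriv (fden x))).

Lemma ds_derivM (f g : discSeries K) : ds_deriv (f * g) = ds_deriv f * g + f * ds_deriv g.
Proof. by apply: val_inj => /=; rewrite ps_derivM. Qed.

Lemma fder_frac a b : b != 0 -> fder (iota a / iota b) =
  qrule (iota a) (iota (ds_deriv a)) (iota b) (iota (ds_deriv b)).
Proof.
move=> b0; set x := _ / _; have n0 := fden_neq0 x.
have e : fnum x * b = a * fden x by apply: frac_eq => //; rewrite -fracE.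
have de := congr1 (@ds_deriv _ _ _) e; rewrite !ds_derivM in de.
by apply: qrule_eq; rewrite ?tofrac_eq0 // -!tofracM -?tofracD ?e ?de.
Qed.

Lemma fder_tofrac a : fder (iota a) = iota (ds_deriv a).
Proof.
have := @fder_frac a 1 (oner_neq0 _).
have -> : ds_deriv (1 : discSeries K) = 0.
  have := ds_derivM (1 : discSeries K) 1; rewrite !mulr1 mul1r => /eqP.
  by rewrite -subr_eq0 opprD addNKr oppr_eq0 => /eqP.
by rewrite /qrule tofrac1 tofrac0 expr1n !divr1 mulr1 mulr0 subr0.
Qed.

Lemma fderD x y : fder (x + y) = fder x + fder y.
Proof.
have [a0 b0] := (fden_neq0 x, fden_neq0 y).
have e : x + y = iota (fnum x * fden y + fnum y * fden x) / iota (fden x * fden y).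
  rewrite {1}[x]fracE {1}[y]fracE addf_div ?tofrac_neq0 //.
  by rewrite tofracD !tofracM.
rewrite e fder_frac ?mulf_neq0 // /fder !(ds_derivM, ds_derivD, tofracD, tofracM).
by apply: qruleD; rewrite tofrac_eq0.
Qed.

Lemma fderM x y : fder (x * y) = fder x * y + x * fder y.
Proof.
have [a0 b0] := (fden_neq0 x, fden_neq0 y).
have e : x * y = iota (fnum x * fnum y) / iota (fden x * fden y).
  rewrite {1}[x]fracE {1}[y]fracE mulf_div.
  by rewrite !tofracM.
rewrite e fder_frac ?mulf_neq0 // [X in _ * X + _]fracE [X in _ + X * _]fracE.
rewrite /fder !(ds_derivM, tofracD, tofracM).
by apply: qruleM; rewrite tofrac_eq0.
Qed.

Lemma frac_char0 n : n.+1%:R != 0 :> FF.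
Proof.
rewrite -(rmorph_nat iota) tofrac_eq0; apply/eqP => /(congr1 (fun f => dcoef f 0)).
by rewrite dcoef_nat dcoef0 => /eqP; apply/negP; exact: natrS_neq0.
Qed.

Section FixedRadius.
Variable r : R.
Hypotheses (r0 : 0 < r) (r1 : r < 1).

Lemma fnorm_frac a b : b != 0 -> fnorm r (iota a / iota b) = gauss r a / gauss r b.
Proof.
move=> b0; set x := _ / _; have n0 := fden_neq0 x.
have e : fnum x * b = a * fden x by apply: frac_eq => //; rewrite -fracE.
have := congr1 (gauss r) e; rewrite !gaussM // => h.
by apply/eqP; rewrite eqr_div ?gauss_eq0 // h.
Qed.

Lemma gauss1 : gauss r (1 : discSeries K) = 1.
Proof.
have n0 : gauss r (1 : discSeries K) != 0 by rewrite gauss_eq0 // oner_eq0.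
by apply: (mulfI n0); rewrite -gaussM // !mulr1.
Qed.

Lemma fnorm_tofrac a : fnorm r (iota a) = gauss r a.
Proof.
by have := @fnorm_frac a 1 (oner_neq0 _); rewrite tofrac1 gauss1 !divr1.
Qed.

Lemma fnorm_ge0 x : 0 <= fnorm r x.
Proof. by rewrite divr_ge0 ?gauss_ge0. Qed.

Lemma fnorm_eq0 x : (fnorm r x == 0) = (x == 0).
Proof.
rewrite mulf_eq0 invr_eq0 !gauss_eq0 // (negPf (fden_neq0 x)) orbF.
by rewrite [x in RHS]fracE mulf_eq0 invr_eq0 !tofrac_eq0 (negPf (fden_neq0 x)) orbF.
Qed.

Lemma fnormM x y : fnorm r (x * y) = fnorm r x * fnorm r y.
Proof.
rewrite {1}[x]fracE {1}[y]fracE mulf_div -!tofracM fnorm_frac ?mulf_neq0 ?fden_neq0 //.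
by rewrite !gaussM // /fnorm mulf_div.
Qed.

Lemma fnormD x y : fnorm r (x + y) <= Num.max (fnorm r x) (fnorm r y).
Proof.
have [a0 b0] := (fden_neq0 x, fden_neq0 y).
rewrite {1}[x]fracE {1}[y]fracE addf_div ?tofrac_neq0 // -!tofracM -tofracD.
rewrite fnorm_frac ?mulf_neq0 // gaussM // ler_pdivrMr ?mulr_gt0 ?gauss_gt0 //.
apply: le_trans (gaussD r0 r1 _ _) _; rewrite !gaussM //.
rewrite maxr_pMl ?mulr_ge0 ?gauss_ge0 //.
have -> : fnorm r x * (gauss r (fden x) * gauss r (fden y)) =
   gauss r (fnum x) * gauss r (fden y).
  by rewrite mulrA divfK // gauss_eq0.
have -> : fnorm r y * (gauss r (fden x) * gauss r (fden y)) =
   gauss r (fnum y) * gauss r (fden x).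
  by rewrite [gauss r (fden x) * _]mulrC mulrA divfK // gauss_eq0.
by [].
Qed.

End FixedRadius.
End FractionField.

Lemma common_denominator (F : fieldType) (c h D a f : F) : c != 0 -> h != 0 ->
  c^-1 * D - a / h * f = - (c * (a * f) - D * h) / (c * h).
Proof. by move=> c0 h0; field; rewrite h0. Qed.

(** * Hasse derivatives, and fractions without poles of absolute value r *)

Section HasseBound.
Context {R : realType} {p : nat} {K : cdvfType R p}.
Implicit Types (a b : discSeries K).
Local Notation FF := {fraction (discSeries K)}.
Local Notation iota := (@tofrac (discSeries K)).
Implicit Types x y : FF.

Lemma vnorm_fact_gt0 n : 0 < vnorm (n`!%:R : K).
Proof.
rewrite lt_def vnorm_ge0 andbT; apply/eqP => /vnorm_eq0 /eqP; apply/negP.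
by case: (n`!) (fact_gt0 n) => // m _; exact: natrS_neq0.
Qed.

Lemma dcoef_iter n a i :
  dcoef (iter n (@ds_deriv _ _ _) a) i = ((i + n) ^_ n)%:R * dcoef a (i + n).
Proof.
elim: n i => [|n ih] i; first by rewrite addn0 mul1r.
rewrite iterS -[LHS]/(i.+1%:R * dcoef (iter n (@ds_deriv _ _ _) a) i.+1) ih.
by rewrite addSnnS mulrA -natrM ffactnSr -addSnnS addnK mulnC.
Qed.

(** The quotient by n! is a binomial coefficient, an integer, hence of norm at most 1. *)
Lemma vnorm_ffact i n : vnorm (((i + n) ^_ n)%:R : K) <= vnorm (n`!%:R : K).
Proof.
by rewrite -bin_ffact natrM vnormM -[leRHS]mul1r ler_pM ?vnorm_ge0 ?vnorm_nat.
Qed.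

Lemma iter_fder n a : iter n fder (iota a) = iota (iter n (@ds_deriv _ _ _) a).
Proof. by elim: n => //= n ->; rewrite fder_tofrac. Qed.

Section FixedRadius.
Variable r : R.
Hypotheses (r0 : 0 < r) (r1 : r < 1).

Lemma gauss_nat n : gauss r (n%:R : discSeries K) = vnorm (n%:R : K).
Proof.
apply/eqP; rewrite eq_le; apply/andP; split.
  apply: gauss_le => -[|i]; rewrite dcoef_nat ?mulr1 //.
  by rewrite vnorm0 mul0r vnorm_ge0.
by have := gauss_ub r0 r1 (n%:R : discSeries K) 0; rewrite dcoef_nat mulr1.
Qed.

Lemma fnorm_nat n : fnorm r (n%:R : FF) = vnorm (n%:R : K).
Proof. by rewrite -(rmorph_nat iota) fnorm_tofrac // gauss_nat. Qed.

Lemma fnorm0 : fnorm r (0 : FF) = 0.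
Proof. by apply/eqP; rewrite fnorm_eq0. Qed.

Lemma fnormV x : fnorm r x^-1 = (fnorm r x)^-1.
Proof.
have [->|x0] := eqVneq x 0.
  by rewrite invr0 fnorm0 invr0.
have nx : fnorm r x != 0 by rewrite fnorm_eq0.
apply: (mulfI nx); rewrite -fnormM // !divff //.
by rewrite -tofrac1 fnorm_tofrac // gauss1.
Qed.

Lemma gauss_iter n a :
  gauss r (iter n (@ds_deriv _ _ _) a) <= vnorm (n`!%:R : K) * (r^-1 ^+ n * gauss r a).
Proof.
apply: gauss_le => i; rewrite dcoef_iter vnormM -mulrA ler_pM ?vnorm_ffact ?vnorm_ge0 //.
  by rewrite mulr_ge0 ?vnorm_ge0 ?exprn_ge0 ?ltW.
rewrite exprVn [leRHS]mulrC ler_pdivlMr ?exprn_gt0 // -mulrA -exprD.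
exact: gauss_ub.
Qed.

Let hdE n x : hscal fder n x = n`!%:R^-1 * iter n fder x. Proof. by []. Qed.

Lemma fnorm_hd_tofrac n a :
  fnorm r (hscal fder n (iota a)) <= r^-1 ^+ n * fnorm r (iota a).
Proof.
rewrite hdE iter_fder fnormM // fnormV fnorm_nat !fnorm_tofrac //.
by rewrite mulrC ler_pdivrMr ?vnorm_fact_gt0 // mulrC gauss_iter.
Qed.

(** Write x = a / b and apply the Leibniz rule to a = x b: the term j = n is the wanted derivative
    times b, and the others are bounded by induction. *)
Lemma fnorm_hd n x : fnorm r (hscal fder n x) <= r^-1 ^+ n * fnorm r x.
Proof.
have ri : 0 < r^-1 by rewrite invr_gt0.
elim/ltn_ind: n => n ih.
set a := iota (fnum x); set b := iota (fden x).
have b0 : b != 0 by rewrite tofrac_eq0 fden_neq0.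
have bp : 0 < fnorm r b by rewrite lt_def fnorm_ge0 // fnorm_eq0 // b0.
have e : a = x * b by rewrite [x]fracE -/a -/b divfK.
have Nsum (I : Type) (s : seq I) (G : I -> FF) (M : R) : 0 <= M ->
    (forall i, fnorm r (G i) <= M) -> fnorm r (\sum_(i <- s) G i) <= M.
  move=> M0 h; elim/big_ind: _ => //.
    by rewrite fnorm0.
  by move=> u v hu hv; apply: le_trans (fnormD r0 r1 _ _) _; rewrite ge_max hu.
have NN u : fnorm r (- u) = fnorm r u.
  rewrite -mulN1r fnormM // -tofrac1 -tofracN fnorm_tofrac // gaussN //.
  by rewrite gauss1 // mul1r.
have := hscalM frac_char0 fderD fderM n x b; rewrite -e big_ord_recr /= subnn hscal0.
move=> /esym /eqP; rewrite addrC eq_sym -subr_eq => /eqP h.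
rewrite -(ler_pM2r bp) -fnormM // -h.
have X0 : 0 <= r^-1 ^+ n * fnorm r x * fnorm r b.
  by apply: mulr_ge0; rewrite ?fnorm_ge0 // mulr_ge0 ?fnorm_ge0 ?exprn_ge0 ?(ltW ri).
apply: le_trans (fnormD r0 r1 _ _) _; rewrite ge_max NN; apply/andP; split.
  by rewrite -mulrA -fnormM // -e fnorm_hd_tofrac.
apply: Nsum => // j; rewrite fnormM //.
apply: le_trans (ler_pM _ _ (ih j (ltn_ord j)) (fnorm_hd_tofrac _ _)) _; rewrite ?fnorm_ge0 //.
have -> : r^-1 ^+ n = r^-1 ^+ j * r^-1 ^+ (n - j).
  by rewrite -exprD subnKC // ltnW.
by rewrite mulrACA mulrA.
Qed.

Definition regular_at x := exists a h, [/\ h != 0, monolike r h & x = iota a / iota h].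

Lemma monolike_nat n : monolike r (n.+1%:R : discSeries K).
Proof.
have g0 : 0 < gauss r (n.+1%:R : discSeries K).
  rewrite gauss_nat lt_def vnorm_ge0 andbT; apply/eqP => /vnorm_eq0 /eqP.
  by apply/negP; exact: natrS_neq0.
have e : vnorm (dcoef (n.+1%:R : discSeries K) 0) * r ^+ 0 = gauss r (n.+1%:R : discSeries K).
  by rewrite dcoef_nat mulr1 gauss_nat.
exists 0%N; split; split=> // -[|j] // _.
by rewrite dcoef_nat vnorm0 mul0r.
Qed.

Lemma regular_tofrac a : regular_at (iota a).
Proof.
exists a, 1; split; rewrite ?oner_neq0 ?tofrac1 ?divr1 //; exact: (monolike_nat 0).
Qed.

Lemma regular_inv_nat n : regular_at (n.+1%:R^-1).
Proof.
exists 1, n.+1%:R; split.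
- by rewrite -tofrac_eq0 rmorph_nat frac_char0.
- exact: monolike_nat.
- by rewrite tofrac1 rmorph_nat mul1r.
Qed.

Lemma regularN x : regular_at x -> regular_at (- x).
Proof. by move=> [a [h [h0 mh ->]]]; exists (- a), h; rewrite tofracN mulNr. Qed.

Lemma regularD x y : regular_at x -> regular_at y -> regular_at (x + y).
Proof.
move=> [a [h [h0 mh ->]]] [b [k [k0 mk ->]]]; exists (a * k + b * h), (h * k).
split; [by rewrite mulf_neq0|exact: monolikeM|].
by rewrite addf_div ?tofrac_neq0 // tofracD !tofracM.
Qed.

Lemma regularM x y : regular_at x -> regular_at y -> regular_at (x * y).
Proof.
move=> [a [h [h0 mh ->]]] [b [k [k0 mk ->]]]; exists (a * b), (h * k).
split; [by rewrite mulf_neq0|exact: monolikeM|].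
by rewrite mulf_div !tofracM.
Qed.

Lemma regular_fder x : regular_at x -> regular_at (fder x).
Proof.
move=> [a [h [h0 mh ->]]].
exists (ds_deriv a * h - a * ds_deriv h), (h * h).
split; [by rewrite mulf_neq0|exact: monolikeM|].
by rewrite fder_frac // /qrule expr2 tofracB !tofracM.
Qed.

(** As y and its inverse are both regular, the numerator of y divides a series without zeros of
    absolute value r. The numerator of x inherits this because x is close to y. *)
Lemma regular_inv x y : regular_at x -> regular_at y -> regular_at y^-1 -> fnorm r (x - y) < fnorm r y ->
  regular_at x^-1.
Proof.
move=> [a [h [h0 mh ->]]] [b [k [k0 mk ->]]] [c [l [l0 ml e]]] lt.
have yp := le_lt_trans (fnorm_ge0 r0 r1 _) lt.
have b0 : b != 0.
  by apply: contraTneq yp => ->; rewrite tofrac0 mul0r fnorm0 ltxx.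
have mb : monolike r b.
  rewrite invf_div in e.
  have kl := frac_eq b0 l0 e.
  have c0 : c != 0.
    by apply: contraTneq (mulf_neq0 k0 l0) => c0; rewrite kl c0 mul0r negbK.
  apply: (@monolike_mul _ _ _ r r0 r1 b c) => //.
  by rewrite mulrC -kl; exact: monolikeM.
have hk0 : 0 < gauss r (h * k) by rewrite gauss_gt0 // mulf_neq0.
have near : gauss r (a * k - b * h) < gauss r (b * h).
  have e' : iota a / iota h - iota b / iota k = iota (a * k - b * h) / iota (h * k).
    by rewrite -mulNr addf_div ?tofrac_neq0 // tofracB !tofracM mulNr.
  move: lt; rewrite e' !fnorm_frac ?mulf_neq0 // ltr_pdivrMr //.
  have -> // : gauss r b / gauss r k * gauss r (h * k) = gauss r (b * h).
  by rewrite !gaussM //; field; rewrite gauss_eq0.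
have mak : monolike r (a * k).
  by apply: monolike_near near _ => //; exact: monolikeM.
have a0 : a != 0.
  apply: contraTneq near => ->; rewrite mul0r sub0r gaussN //.
  by rewrite -leNgt lexx.
exists h, a; split=> //; last by rewrite invf_div.
exact: monolike_mul mak.
Qed.

(* With N the largest dominant index of f, the N-th Hasse derivative of f is
   dominated by its constant term; so f divides a monomial up to a small error. *)
Lemma monolike_of_quotients f : f != 0 ->
  (forall m e, 0 < e -> exists2 x, regular_at x &
     fnorm r (hscal fder m (iota f) - x * iota f) <= e * fnorm r (iota f)) ->
  monolike r f.
Proof.
move=> f0 H; have [n [en hn]] := hi_exists r0 r1 f0.
have ri : 0 < r^-1 ^+ n by rewrite exprn_gt0 // invr_gt0.
(* The tolerance is half of r^-n, the ratio of the norms of the n-th Hasse derivative and of f. *)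
have [|x [a [h [h0 mh ->]]]] := H n (r^-1 ^+ n / 2); first by rewrite divr_gt0.
set D := iter n (@ds_deriv _ _ _) f; set c : discSeries K := n`!%:R.
have vp := vnorm_fact_gt0 n.
have rn : 0 < r ^+ n by rewrite exprn_gt0.
have c0 : c != 0.
  by rewrite -(gauss_eq0 r0 r1) gauss_nat gt_eqF.
have D0 i : dcoef D i = ((i + n) ^_ n)%:R * dcoef f (i + n) by exact: dcoef_iter.
have gf : 0 < gauss r f by rewrite gauss_gt0.
have v0 : vnorm (dcoef D 0) * r ^+ 0 = vnorm (n`!%:R : K) * (r^-1 ^+ n * gauss r f).
  rewrite D0 add0n ffactnn vnormM expr0 mulr1; congr (_ * _).
  by rewrite -en exprVn [RHS]mulrC mulfK // gt_eqF.
(* Index i of [D] comes from index i + n of f, beyond the largest dominant one. *)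
have lt i : (0 < i)%N -> vnorm (dcoef D i) * r ^+ i < vnorm (n`!%:R : K) * (r^-1 ^+ n * gauss r f).
  move=> i0; rewrite D0 vnormM -mulrA.
  apply: le_lt_trans (ler_wpM2r _ (vnorm_ffact _ _)) _.
    by rewrite mulr_ge0 ?vnorm_ge0 ?exprn_ge0 // ltW.
  rewrite ltr_pM2l // exprVn [ltRHS]mulrC ltr_pdivlMr // -mulrA -exprD.
  by apply: hn; rewrite -{1}(add0n n) ltn_add2r.
have gD : gauss r D = vnorm (n`!%:R : K) * (r^-1 ^+ n * gauss r f).
  by apply/eqP; rewrite eq_le gauss_iter //= -v0 gauss_ub.
have mD : monolike r D.
  by exists 0%N; rewrite /is_lo /is_hi gD; split; split.
have Dn0 : D != 0 by rewrite -(gauss_eq0 r0 r1) gD gt_eqF // !mulr_gt0.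
rewrite hdE iter_fder -/D => le.
(* The product D h is [monolike], hence so is its close neighbour c a f, which f divides. *)
have near : gauss r (c * (a * f) - D * h) < gauss r (D * h).
  have e : n`!%:R^-1 * iota D - iota a / iota h * iota f =
      iota (- (c * (a * f) - D * h)) / iota (c * h).
    rewrite -(rmorph_nat iota) -/c tofracN tofracB !tofracM.
    by apply: common_denominator; rewrite tofrac_eq0.
  move: le; rewrite e fnorm_frac ?mulf_neq0 // gaussN // fnorm_tofrac //.
  have ch : 0 < gauss r (c * h) by rewrite gauss_gt0 // mulf_neq0.
  rewrite (ler_pdivrMr _ _ ch) => le'.
  apply: (le_lt_trans le').
  rewrite (gaussM r0 r1 D) (gaussM r0 r1 c).
  rewrite gD gauss_nat.
  have -> : r^-1 ^+ n / 2 * gauss r f * (vnorm (n`!%:R : K) * gauss r h) =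
    vnorm (n`!%:R : K) * (r^-1 ^+ n * gauss r f) * gauss r h / 2 by ring.
  rewrite ltr_pdivrMr // ltr_pMr ?ltr1n // !mulr_gt0 ?gauss_gt0 //.
have := monolike_near r0 r1 near (monolikeM r0 r1 Dn0 h0 mD mh).
have a0 : a != 0.
  apply: contraTneq near => ->; rewrite mul0r mulr0 sub0r gaussN //.
  by rewrite -leNgt lexx.
rewrite mulrA mulrC; apply: monolike_mul => //; exact: mulf_neq0.
Qed.

End FixedRadius.
End HasseBound.

(** * Behaviour near the boundary of the disc *)

Section Eventually.
Context {R : realType}.
Implicit Types P Q : R -> Prop.

Definition near1 P := exists t, [/\ 0 < t, t < 1 & forall r, t < r -> r < 1 -> P r].

Lemma near1W P Q : near1 P -> (forall r, 0 < r -> r < 1 -> P r -> Q r) -> near1 Q.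
Proof.
move=> [t [t0 t1 h]] PQ; exists t; split=> // r tr r1.
by apply: PQ => //; [exact: lt_trans tr|exact: h].
Qed.

Lemma near1A P : (forall r, 0 < r -> r < 1 -> P r) -> near1 P.
Proof.
move=> h; exists 2^-1; split=> [||r r0 r1]; first by rewrite invr_gt0.
  by rewrite invf_lt1 // ltr1n.
by apply: h => //; apply: lt_trans r0; rewrite invr_gt0.
Qed.

Lemma near1_and P Q : near1 P -> near1 Q -> near1 (fun r => P r /\ Q r).
Proof.
move=> [t [t0 t1 h]] [s [s0 s1 k]]; exists (Num.max t s); split.
- by rewrite lt_max t0.
- by rewrite gt_max t1.
- by move=> r; rewrite gt_max => /andP[tr sr] r1; split; [exact: h|exact: k].
Qed.

Lemma near1_le n (P : nat -> R -> Prop) : (forall i, (i <= n)%N -> near1 (P i)) ->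
  near1 (fun r => forall i, (i <= n)%N -> P i r).
Proof.
elim: n => [|n ih] h.
  by apply: near1W (h 0%N isT) _ => r _ _ hr i; rewrite leqn0 => /eqP ->.
apply: near1W (near1_and (ih _) (h n.+1 (leqnn _))) _.
  by move=> i hi; apply: h; exact: leqW.
move=> r _ _ [h1 h2] i; rewrite leq_eqVlt => /orP[/eqP -> //|].
by rewrite ltnS; exact: h1.
Qed.

Lemma near1_freq P s : near1 P -> s < 1 -> exists r, [/\ 0 < r, s < r, r < 1 & P r].
Proof.
move=> [t [t0 t1 h]] s1; pose m := Num.max t s.
have m1 : m < 1 by rewrite gt_max t1.
have [a b] : m < (m + 1) / 2 /\ (m + 1) / 2 < 1 by lra.
have tm : t <= m by rewrite le_max lexx.
have sm : s <= m by rewrite le_max lexx orbT.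
exists ((m + 1) / 2); split=> //; try exact: le_lt_trans a.
  exact: lt_trans t0 (le_lt_trans tm a).
by apply: h => //; exact: le_lt_trans a.
Qed.

Lemma near1_gt s : s < 1 -> near1 (fun r => s < r).
Proof.
move=> s1; exists (Num.max s 2^-1); split.
- by rewrite lt_max invr_gt0 ltr0n orbT.
- by rewrite gt_max s1 invf_lt1 // ltr1n.
- by move=> r; rewrite gt_max => /andP[].
Qed.

(** Bernoulli's inequality provides an explicit threshold. *)
Lemma near1_expr n t : t < 1 -> near1 (fun r => t <= r ^+ n).
Proof.
move=> t1.
have bern (r : R) : 0 <= r -> r <= 1 -> 1 - n%:R * (1 - r) <= r ^+ n.
  move=> r0 r1; elim: n => [|n ih]; first by rewrite mul0r subr0.
  rewrite exprS; apply: le_trans (ler_wpM2l r0 ih).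
  have : 0 <= n%:R * (1 - r) ^+ 2 by rewrite mulr_ge0 // sqr_ge0.
  by rewrite -natr1; lra.
have n0 : 0 < n.+1%:R :> R by rewrite ltr0n.
apply: near1W (@near1_gt (1 - (1 - t) / n.+1%:R) _) _.
  by rewrite ltrBlDr ltrDl divr_gt0 // subr_gt0.
move=> r r0 r1; rewrite ltrBlDr -ltrBlDl ltr_pdivlMr // -natr1 => h.
apply: le_trans (bern r (ltW r0) (ltW r1)).
have : 0 <= 1 - r by rewrite subr_ge0 ltW.
by move: h; lra.
Qed.

End Eventually.

Section Boundary.
Context {R : realType} {p : nat} {K : cdvfType R p}.
Implicit Types (a b f : discSeries K).
Local Notation FF := {fraction (discSeries K)}.
Local Notation iota := (@tofrac (discSeries K)).
Implicit Types x y : FF.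

Definition bdd f := bounded_series (val f).

Lemma bddP f : bdd f <-> val f \in bounded_pred.
Proof. by split=> [h|/asboolP //]; exact/asboolP. Qed.

Lemma bdd1 : bdd 1. Proof. by apply/bddP; rewrite rpred1. Qed.
Lemma bdd0 : bdd 0. Proof. by apply/bddP; rewrite rpred0. Qed.
Lemma bddD a b : bdd a -> bdd b -> bdd (a + b).
Proof. by move=> /bddP ha /bddP hb; apply/bddP; rewrite rpredD. Qed.
Lemma bddN a : bdd a -> bdd (- a).
Proof. by move=> /bddP ha; apply/bddP; rewrite rpredN. Qed.
Lemma bddM a b : bdd a -> bdd b -> bdd (a * b).
Proof. by move=> /bddP ha /bddP hb; apply/bddP; rewrite rpredM. Qed.
Lemma bdd_deriv a : bdd a -> bdd (ds_deriv a).
Proof. exact: bounded_deriv. Qed.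

Lemma bdd_nat n : bdd n%:R.
Proof. by elim: n => [|n ih]; [exact: bdd0|rewrite -natr1; apply: bddD ih bdd1]. Qed.

Lemma bdd_gauss f : bdd f -> exists2 C, 1 <= C &
  forall r, 0 < r -> r < 1 -> gauss r f <= C.
Proof.
move=> /bounded_seriesP[C C0 hC]; exists (Num.max 1 C); first by rewrite le_max lexx.
move=> r r0 r1; apply: gauss_le => i; rewrite le_max; apply/orP; right.
rewrite -[leRHS]mulr1 ler_pM ?vnorm_ge0 ?exprn_ge0 ?(ltW r0) ?hC //.
by rewrite exprn_ile1 // ltW.
Qed.

(* The only use of the discreteness of the valuation. *)
Lemma bdd_attained f : bdd f -> f != 0 -> exists i, [/\ 0 < vnorm (dcoef f i),
  forall j, vnorm (dcoef f j) <= vnorm (dcoef f i) &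
  forall j, (j < i)%N -> vnorm (dcoef f j) < vnorm (dcoef f i)].
Proof.
move=> /bounded_seriesP[C C0 hC] f0.
have [j0 fj0] : exists j, dcoef f j != 0.
  apply: contrapT => /forallNP h; move/eqP: f0; apply; apply: dcoefP => i.
  by rewrite dcoef0; apply/eqP/negPn/negP/h.
have [pi [pi0 pi1 hpi]] := @vnorm_discrete R p K.
set q := vnorm pi in pi0 pi1 hpi.
have C1 : 0 < C + 1 by rewrite ltr_wpDl.
have [k hk] : exists k, q ^+ k <= (C + 1)^-1.
  by apply: expr_small => //; [exact: ltW|rewrite invr_gt0].
have qk : 0 < q ^+ k by rewrite exprn_gt0.
have val j : dcoef f j != 0 -> exists m, vnorm (dcoef f j) * q ^+ k == q ^+ m.
  move=> fj; have [n hn] := hpi _ fj.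
  have e : vnorm (dcoef f j) * q ^+ k = q ^ (n + k).
    by rewrite hn expfzDr ?gt_eqF.
  have lt1 : vnorm (dcoef f j) * q ^+ k < 1.
    apply: le_lt_trans (ler_pM _ _ (hC j) hk) _; rewrite ?vnorm_ge0 ?ltW //.
    by rewrite ltr_pdivrMr // mul1r ltrDl.
  move: e lt1; case: (n + k) => m e; first by exists m; rewrite e.
  rewrite e NegzE -exprnN ltNge.
  by rewrite invf_ge1 ?exprn_gt0 // exprn_ile1 // ltW.
have exm : exists m, `[< exists j, vnorm (dcoef f j) * q ^+ k == q ^+ m >].
  by have [m hm] := val j0 fj0; exists m; apply/asboolP; exists j0.
have [m /asboolP exj mmin] := ex_minnP exm.
have [i /eqP hi imin] := ex_minnP exj.
have fi0 : 0 < vnorm (dcoef f i).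
  by rewrite -(ltr_pM2r qk) mul0r hi exprn_gt0.
have le j : vnorm (dcoef f j) <= vnorm (dcoef f i).
  have [->|fj] := eqVneq (dcoef f j) 0; first by rewrite vnorm0 ltW.
  have [n hn] := val j fj.
  rewrite -(ler_pM2r qk) hi (eqP hn) ler_wiXn2l ?ltW //.
  by apply: mmin; apply/asboolP; exists j.
exists i; split=> // j ji; rewrite lt_neqAle le andbT.
apply: contraTneq ji => e; rewrite -leqNgt; apply: imin.
by rewrite e hi.
Qed.

(** Let i be the first index at which |f_i| is maximal. Near r = 1 it beats the finitely many
    earlier indices, whose coefficients are strictly smaller; it beats the later ones because r^j <
    r^i. *)
Lemma bdd_monolike f : bdd f -> f != 0 -> exists i, 0 < vnorm (dcoef f i) /\
  near1 (fun r => monolike r f /\ gauss r f = vnorm (dcoef f i) * r ^+ i).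
Proof.
move=> bf f0; have [i [fi0 hle hlt]] := bdd_attained bf f0.
exists i; split=> //.
have E j : (j <= i)%N -> near1 (fun r => (j < i)%N ->
    vnorm (dcoef f j) < vnorm (dcoef f i) * r ^+ i).
  move=> _; have [ji|ij] := ltnP j i; last exact: near1A.
  pose m := (vnorm (dcoef f j) / vnorm (dcoef f i) + 1) / 2.
  have q1 : vnorm (dcoef f j) / vnorm (dcoef f i) < 1.
    by rewrite ltr_pdivrMr // mul1r hlt.
  have [m1 m2] : vnorm (dcoef f j) / vnorm (dcoef f i) < m /\ m < 1 by rewrite /m; lra.
  apply: near1W (near1_expr i m2) _ => r r0 r1 mr _.
  by rewrite mulrC -ltr_pdivrMr //; exact: lt_le_trans mr.
apply: near1W (near1_le E) _ => r r0 r1 {}E.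
have lo j : (j < i)%N -> vnorm (dcoef f j) * r ^+ j < vnorm (dcoef f i) * r ^+ i.
  move=> ji; apply: le_lt_trans (E j (ltnW ji) ji).
  by rewrite ler_piMr ?vnorm_ge0 // exprn_ile1 // ltW.
have hi j : (i < j)%N -> vnorm (dcoef f j) * r ^+ j < vnorm (dcoef f i) * r ^+ i.
  move=> ij; apply: le_lt_trans (ler_wpM2r _ (hle j)) _; first by rewrite exprn_ge0 // ltW.
  by rewrite ltr_pM2l // ltr_iXn2l.
have e : gauss r f = vnorm (dcoef f i) * r ^+ i.
  apply/eqP; rewrite eq_le gauss_ub // andbT; apply: gauss_le => j.
  by case: (ltngtP j i) => [/lo/ltW|/hi/ltW|->].
by split=> //; exists i; rewrite /is_lo /is_hi e; split; split.
Qed.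

Lemma monolike_bounded f : near1 (fun r => monolike r f) -> bdd f.
Proof.
move=> [t [t0 t1 hm]].
pose r0 := (t + 1) / 2.
have [tr0 r01] : t < r0 /\ r0 < 1 by rewrite /r0; lra.
have r0p : 0 < r0 by exact: lt_trans tr0.
have [i [[ei hlo] [_ hhi]]] := hm r0 tr0 r01.
have fi0 : 0 < vnorm (dcoef f i).
  have := hhi i.+1 (ltnSn _); rewrite -ei => /(le_lt_trans _) h.
  rewrite -(ltr_pM2r (exprn_gt0 i r0p)) mul0r; apply: h.
  by rewrite mulr_ge0 ?vnorm_ge0 ?exprn_ge0 // ltW.
have lo j s : (j < i)%N -> r0 <= s -> vnorm (dcoef f j) * s ^+ j <= vnorm (dcoef f i) * s ^+ i.
  move=> ji rs; have := ltW (hlo j ji); rewrite -ei.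
  have s0 : 0 < s by exact: lt_le_trans rs.
  have e (x : R) : x ^+ i = x ^+ (i - j) * x ^+ j by rewrite -exprD subnK // ltnW.
  rewrite !e !mulrA ler_pM2r ?exprn_gt0 // => h.
  rewrite ler_pM2r ?exprn_gt0 //; apply: le_trans h _.
  by rewrite ler_pM2l // lerXn2r // nnegrE ltW.
suff hi j : (i < j)%N -> vnorm (dcoef f j) <= vnorm (dcoef f i).
  apply/bounded_seriesP; exists (vnorm (dcoef f i)) => [|j]; first exact: ltW.
  case: (ltngtP j i) => [ji|/hi //|-> //].
  have l1 : 1 <= (1 : R) by [].
  by have := lo j 1 ji (ltW r01); rewrite !expr1n !mulr1.
move=> ij; rewrite leNgt; apply/negP => lt.
(* [tau j] is the radius at which the terms of index i and j have equal size. *)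
pose tau j := (vnorm (dcoef f i) / vnorm (dcoef f j)) `^ ((j - i)%:R^-1).
have tauX k : (i < k)%N -> 0 < vnorm (dcoef f k) ->
    0 < tau k /\ tau k ^+ (k - i) = vnorm (dcoef f i) / vnorm (dcoef f k).
  move=> ik fk; have q0 : 0 < vnorm (dcoef f i) / vnorm (dcoef f k) by exact: divr_gt0.
  split; first exact: powR_gt0.
  rewrite -powR_mulrn ?powR_ge0 // -powRrM mulVf ?powRr1 ?ltW //.
  by rewrite pnatr_eq0 -lt0n subn_gt0.
have cmp k s : (i < k)%N -> 0 < vnorm (dcoef f k) -> 0 < s ->
    (vnorm (dcoef f k) * s ^+ k <= vnorm (dcoef f i) * s ^+ i) = (s <= tau k).
  move=> ik fk s0; have [tk0 tkX] := tauX k ik fk.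
  have -> : s ^+ k = s ^+ (k - i) * s ^+ i by rewrite -exprD subnK // ltnW.
  rewrite mulrA ler_pM2r ?exprn_gt0 // mulrC -ler_pdivlMr // -tkX.
  by rewrite ler_pXn2r ?subn_gt0 // nnegrE ltW.
have eqt k : (i < k)%N -> 0 < vnorm (dcoef f k) ->
    vnorm (dcoef f k) * tau k ^+ k = vnorm (dcoef f i) * tau k ^+ i.
  move=> ik fk; have [tk0 tkX] := tauX k ik fk.
  have -> : tau k ^+ k = tau k ^+ (k - i) * tau k ^+ i by rewrite -exprD subnK // ltnW.
  by rewrite tkX mulrA mulrCA divff ?mulr1 // gt_eqF.
have fj : 0 < vnorm (dcoef f j) by exact: lt_trans lt.
have [S0 SX] := tauX j ij fj; have eS := eqt j ij fj; set S := tau j in S0 SX eS.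
have S1 : S < 1.
  rewrite -(@ltr_pXn2r _ (j - i)) ?nnegrE ?subn_gt0 ?(ltW S0) // expr1n SX.
  by rewrite ltr_pdivrMr // mul1r.
have c0 : 0 < vnorm (dcoef f i) * S ^+ i by rewrite mulr_gt0 // exprn_gt0.
have /cvgrPdist_lt/(_ _ c0)[n _ hn] := disc_terms f S0 S1.
have {}hn k : (n <= k)%N ->
    vnorm (dcoef f k) * S ^+ k < vnorm (dcoef f i) * S ^+ i.
  move=> /hn /=; rewrite sub0r normrN ger0_norm //.
  by rewrite mulr_ge0 ?vnorm_ge0 ?exprn_ge0 // ltW.
have jn : (j < n)%N.
  by rewrite ltnNge; apply/negP => /hn; rewrite eS ltxx.
(* Only indices below n can have caught up with i at radius S; among those, k has the smallest
   crossing radius. *)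
pose P (k : 'I_n) := (i < k)%N && (vnorm (dcoef f i) * S ^+ i <= vnorm (dcoef f k) * S ^+ k).
have Pj : P (Ordinal jn) by rewrite /P /= ij eS lexx.
have [k /andP[ik hk] kmin] := @arg_minP _ R 'I_n (Ordinal jn) P (fun k => tau k) Pj.
have fk : 0 < vnorm (dcoef f k).
  by rewrite -(ltr_pM2r (exprn_gt0 k S0)) mul0r; exact: lt_le_trans hk.
have kS : tau k <= S by exact: (kmin (Ordinal jn) Pj).
have [s0 _] := tauX k ik fk.
have rs : r0 <= tau k by rewrite -cmp // ei ltW // hhi.
have s1 : tau k < 1 by exact: le_lt_trans S1.
have all_le l : vnorm (dcoef f l) * tau k ^+ l <= vnorm (dcoef f i) * tau k ^+ i.
  case: (ltngtP l i) => [li|il|-> //]; first exact: lo.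
  have [fl|fl] := ltP 0 (vnorm (dcoef f l)); last first.
    have -> : vnorm (dcoef f l) = 0 by apply/eqP; rewrite eq_le fl vnorm_ge0.
    by rewrite mul0r mulr_ge0 ?vnorm_ge0 ?exprn_ge0 // ltW.
  rewrite cmp //.
  have [ln|nl] := ltnP l n; last first.
    by apply: le_trans kS _; rewrite -cmp // ltW // hn.
  have [Pl|] := boolP (P (Ordinal ln)); first exact: (kmin (Ordinal ln) Pl).
  by rewrite /P /= il /= -ltNge => /ltW; rewrite cmp //; exact: le_trans kS.
have g : gauss (tau k) f = vnorm (dcoef f i) * tau k ^+ i.
  by apply/eqP; rewrite eq_le gauss_ub // andbT; exact: gauss_le.
(* At radius [tau k] both i and k attain the Gauss norm, so the single dominant index l would
   satisfy k <= l <= i. *)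
have [l [[_ llo] [_ lhi]]] := hm (tau k) (lt_le_trans tr0 rs) s1.
have li : (l <= i)%N by rewrite leqNgt; apply/negP => /llo; rewrite g ltxx.
have kl : (k <= l)%N by rewrite leqNgt; apply/negP => /lhi; rewrite g eqt // ltxx.
by move: (leq_trans kl li); rewrite leqNgt ik.
Qed.

End Boundary.

(** * Fractions of bounded series and their norms near the boundary *)

Section RationalBounded.
Context {R : realType} {p : nat} {K : cdvfType R p}.
Implicit Types (a b f : discSeries K).
Local Notation FF := {fraction (discSeries K)}.
Local Notation iota := (@tofrac (discSeries K)).
Implicit Types x y : FF.

Lemma fnormN r x : 0 < r -> r < 1 -> fnorm r (- x) = fnorm r x.
Proof.
move=> r0 r1; rewrite -mulN1r fnormM // -tofrac1 -tofracN fnorm_tofrac // gaussN //.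
by rewrite gauss1 // mul1r.
Qed.

Lemma fnorm_sum r (I : Type) (s : seq I) (G : I -> FF) (M : R) :
  0 < r -> r < 1 -> 0 <= M ->
  (forall i, fnorm r (G i) <= M) -> fnorm r (\sum_(i <- s) G i) <= M.
Proof.
move=> r0 r1 M0 h; elim/big_ind: _ => //; first by rewrite fnorm0.
by move=> u v hu hv; apply: le_trans (fnormD r0 r1 _ _) _; rewrite ge_max hu.
Qed.

(** The fraction field of K[[t]]_0 inside that of K{t}. *)
Definition bratio x := exists a b, [/\ bdd a, bdd b, b != 0 & x = iota a / iota b].

Lemma bratio_tofrac a : bdd a -> bratio (iota a).
Proof.
move=> ha; exists a, 1; split; rewrite ?oner_neq0 ?tofrac1 ?divr1 //; exact: bdd1.
Qed.

Lemma bratioN x : bratio x -> bratio (- x).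
Proof.
move=> [a [h [ba bh h0 ->]]]; exists (- a), h; rewrite tofracN mulNr.
by split=> //; exact: bddN.
Qed.

Lemma bratioD x y : bratio x -> bratio y -> bratio (x + y).
Proof.
move=> [a [h [ba bh h0 ->]]] [b [k [bb bk k0 ->]]]; exists (a * k + b * h), (h * k).
split; [by apply: bddD; exact: bddM|exact: bddM|by rewrite mulf_neq0|].
by rewrite addf_div ?tofrac_neq0 // tofracD !tofracM.
Qed.

Lemma bratioM x y : bratio x -> bratio y -> bratio (x * y).
Proof.
move=> [a [h [ba bh h0 ->]]] [b [k [bb bk k0 ->]]]; exists (a * b), (h * k).
split; [exact: bddM|exact: bddM|by rewrite mulf_neq0|].
by rewrite mulf_div !tofracM.
Qed.

Lemma bratio_inv_nat n : bratio (n.+1%:R^-1).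
Proof.
exists 1, n.+1%:R; split; [exact: bdd1|exact: bdd_nat| |].
- by rewrite -tofrac_eq0 rmorph_nat frac_char0.
- by rewrite tofrac1 rmorph_nat mul1r.
Qed.

Lemma bratio_fder x : bratio x -> bratio (fder x).
Proof.
move=> [a [h [ba bh h0 ->]]].
exists (ds_deriv a * h - a * ds_deriv h), (h * h).
split; [|exact: bddM|by rewrite mulf_neq0|].
  by apply: bddD; [|apply: bddN]; apply: bddM => //; exact: bdd_deriv.
by rewrite fder_frac // /qrule expr2 tofracB !tofracM.
Qed.

(** Near the boundary numerator and denominator each keep one dominant index, so the norm is c r^(i
    - j), written here without negative exponents. *)
Lemma bratio_asymptotics x : bratio x -> x != 0 -> exists c i j, 0 < c /\
  near1 (fun r => [/\ regular_at r x, regular_at r x^-1 & fnorm r x * r ^+ j = c * r ^+ i]).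
Proof.
move=> [a [b [ba bb b0 xE]]] x0.
have a0 : a != 0 by apply: contraNneq x0 => a0; rewrite xE a0 tofrac0 mul0r.
have [i [ci ei]] := bdd_monolike ba a0; have [j [cj ej]] := bdd_monolike bb b0.
exists (vnorm (dcoef a i) / vnorm (dcoef b j)), i, j; split; first exact: divr_gt0.
apply: near1W (near1_and ei ej) _ => r r0 r1 [[ma ga] [mb gb]]; split.
- by exists a, b.
- by exists b, a; split=> //; rewrite xE invf_div.
rewrite xE fnorm_frac // ga gb.
have rj : r ^+ j != 0 by rewrite expf_neq0 // gt_eqF.
by field; rewrite rj gt_eqF.
Qed.

Lemma near1_invX l (s : R) : 1 < s -> near1 (fun r => r^-1 ^+ l <= s).
Proof.
move=> s1; have s0 : 0 < s by exact: lt_trans s1.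
apply: near1W (near1_expr l (_ : s^-1 < 1)) _; first by rewrite invf_lt1.
move=> r r0 r1 h; rewrite exprVn -[leRHS]invrK lef_pV2 ?posrE ?exprn_gt0 //.
by rewrite invr_gt0.
Qed.

(** For nonzero x the norm tends to the constant c of [bratio_asymptotics]; the two cases are c > 1
    and c <= 1. *)
Lemma bratio_dichotomy x : bratio x ->
  (exists2 k, 1 < k & near1 (fun r => k <= fnorm r x)) \/
  (forall k, 1 < k -> near1 (fun r => fnorm r x <= k)).
Proof.
move=> rx; have [->|x0] := eqVneq x 0.
  by right=> k k1; apply: near1A => r r0 r1; rewrite fnorm0 // ltW // (lt_trans _ k1).
have [c [i [j [c0 ec]]]] := bratio_asymptotics rx x0.
have [c1|c1] := ltP 1 c; [left|right].
  pose k := (1 + c) / 2; have [k1 kc] : 1 < k /\ k < c by rewrite /k; lra.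
  exists k => //.
  apply: near1W (near1_and ec (near1_expr i (_ : k / c < 1))) _.
    by rewrite ltr_pdivrMr // mul1r.
  move=> r r0 r1 [[_ _ e]]; rewrite ler_pdivrMr // mulrC -e => h.
  apply: le_trans h _; rewrite ler_piMr ?fnorm_ge0 //.
  by rewrite exprn_ile1 // ltW.
move=> k k1; apply: near1W (near1_and ec (near1_invX j k1)) _ => r r0 r1 [[_ _ e] h].
have rj : 0 < r ^+ j by rewrite exprn_gt0.
apply: le_trans h; rewrite exprVn -[leRHS]mul1r ler_pdivlMr // e.
by rewrite -[leRHS]mul1r ler_pM ?exprn_ge0 ?(ltW c0) ?(ltW r0) // exprn_ile1 // ltW.
Qed.

Lemma bratio_bounded x : bratio x -> exists2 C, 1 <= C & near1 (fun r => fnorm r x <= C).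
Proof.
move=> rx; have [->|x0] := eqVneq x 0.
  by exists 1 => //; apply: near1A => r r0 r1; rewrite fnorm0.
have [c [i [j [c0 ec]]]] := bratio_asymptotics rx x0.
exists (Num.max 1 (c * 2)); first by rewrite le_max lexx.
have k1 : (1 : R) < 2 by rewrite ltr1n.
apply: near1W (near1_and ec (near1_invX j k1)) _ => r r0 r1 [[_ _ e] h].
have rj : 0 < r ^+ j by rewrite exprn_gt0.
rewrite le_max; apply/orP; right.
have -> : fnorm r x = c * r ^+ i * r^-1 ^+ j by rewrite -e exprVn mulfK // gt_eqF.
rewrite ler_pM ?exprn_ge0 ?invr_ge0 ?(ltW r0) ?mulr_ge0 ?(ltW c0) //.
  by rewrite exprn_ge0 // ltW.
by rewrite ler_piMr ?(ltW c0) // exprn_ile1 // ltW.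
Qed.

End RationalBounded.

(** * Boundedness of solutions when the determinant is not solvable *)

Section System.
Context {R : realType} {p : nat} {K : cdvfType R p}.
Local Notation FF := {fraction (discSeries K)}.
Local Notation iota := (@tofrac (discSeries K)).
Variables (a11 a12 a21 a22 f g : discSeries K).
Hypotheses (b11 : bdd a11) (b12 : bdd a12) (b21 : bdd a21) (b22 : bdd a22).
Hypothesis df : ds_deriv f = a11 * f + a12 * g.
Hypothesis dg : ds_deriv g = a21 * f + a22 * g.

Local Notation H1 := (hrow1 fder (iota a11) (iota a12) (iota a21) (iota a22)).
Local Notation H2 := (hrow2 fder (iota a11) (iota a12) (iota a21) (iota a22)).
Local Notation HL := (hwronsk fder (iota a11) (iota a22)).
Local Notation HD := (hscal fder).
Local Notation e1 := (1 : FF, 0 : FF).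
Local Notation e2 := (0 : FF, 1 : FF).
Local Notation ebar u := (- u : FF, 1 : FF).

Let dfF : fder (iota f) = iota a11 * iota f + iota a12 * iota g.
Proof. by rewrite fder_tofrac df tofracD !tofracM. Qed.
Let dgF : fder (iota g) = iota a21 * iota f + iota a22 * iota g.
Proof. by rewrite fder_tofrac dg tofracD !tofracM. Qed.

Lemma bratio_rows n x : bratio x.1 -> bratio x.2 -> bratio (H1 n x) /\ bratio (H2 n x).
Proof.
move=> x1 x2.
have [T1 T2] : bratio (iter n (rowD fder (iota a11) (iota a12) (iota a21) (iota a22)) x).1
   /\ bratio (iter n (rowD fder (iota a11) (iota a12) (iota a21) (iota a22)) x).2.
  elim: n => //= n [h k].
  by split; rewrite /=; apply: (bratioD (bratioD (bratio_fder _) (bratioM _ _)) (bratioM _ _)) => //;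
    exact: bratio_tofrac.
have Sf : bratio (n`!%:R^-1 : FF).
  by case: n`! (fact_gt0 n) => // m _; exact: bratio_inv_nat.
by split; apply: bratioM.
Qed.

Let bratio1 : bratio (1 : FF).
Proof. by rewrite -tofrac1; apply: bratio_tofrac; exact: bdd1. Qed.
Let bratio0 : bratio (0 : FF).
Proof. by rewrite -tofrac0; apply: bratio_tofrac; exact: bdd0. Qed.

Let row_bound n : exists2 C, 1 <= C & near1 (fun r => forall j, (j <= n)%N ->
  fnorm r (H2 j e1) <= C /\ fnorm r (H2 j e2) <= C).
Proof.
elim: n => [|n [C C1 ih]].
  exists 1 => //; apply: near1A => r r0 r1 j; rewrite leqn0 => /eqP ->.
  by rewrite !hrow20 /= fnorm0 // -tofrac1 fnorm_tofrac // gauss1.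
have [D D1 hD] := bratio_bounded (bratio_rows n.+1 (x := e1) bratio1 bratio0).2.
have [E E1 hE] := bratio_bounded (bratio_rows n.+1 (x := e2) bratio0 bratio1).2.
exists (Num.max C (Num.max D E)); first by rewrite le_max C1.
apply: near1W (near1_and ih (near1_and hD hE)) _ => r r0 r1 [{}ih [{}hD {}hE]] j.
rewrite leq_eqVlt ltnS => /orP[/eqP -> |/ih[h k]].
  split; [apply: le_trans hD _|apply: le_trans hE _]; rewrite !le_max lexx ?orbT //.
by split; [apply: le_trans h _|apply: le_trans k _]; rewrite le_max lexx.
Qed.

(** The approximation hypothesis puts u = - a / b close to g / f for all r near 1. Then [det_le]
    yields a divided power expanding (- u, 1), the Newton iteration makes f [monolike] near the
    boundary, and g is bounded because its norm is at most twice that of f. *)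
Theorem unsolvable_bounded n0 kap : 1 < kap ->
  near1 (fun r => kap <= fnorm r (HL n0 1)) ->
  (forall eps : R, 0 < eps -> exists a b, [/\ bdd a, bdd b, b != 0 &
     near1 (fun r => gauss r a <= 2 * gauss r b /\
       gauss r (a * f + b * g) <= eps * gauss r b * Num.max (gauss r f) (gauss r g))]) ->
  bdd f /\ bdd g.
Proof.
move=> kap1 hkap happrox.
have [C C1 hC] := row_bound n0.
have C0 : 0 < C by exact: lt_le_trans C1.
(* For r > 1/2, [T] bounds r^-k for k <= n0, and [Cb] bounds the second coordinates of the images of
   (- u, 1), u having norm at most 2. Then [eps] is chosen so that Cb^2 (2 eps) T = 1. *)
pose T : R := 2 ^+ n0.
have T1 : 1 <= T by rewrite exprn_ege1 // ler1n.
have T0 : 0 < T by exact: lt_le_trans T1.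
pose Cb := C * (2 * T).
have CCb : C <= Cb by rewrite /Cb ler_peMr ?(ltW C0) // mulr_ege1 // ler1n.
have CTb : C * T <= Cb by rewrite /Cb ler_pM2l // ler_peMl ?(ltW T0) // ler1n.
have Cb1 : 1 <= Cb by exact: le_trans CCb.
have Cb0 : 0 < Cb by exact: lt_le_trans Cb1.
pose eps := (2 * (Cb * Cb * T))^-1.
have CbT : 1 <= Cb * Cb * T by apply: mulr_ege1 => //; exact: mulr_ege1.
have eps0 : 0 < eps by rewrite invr_gt0 !mulr_gt0.
have eps1 : eps < 1.
  rewrite invf_lt1 ?mulr_gt0 //; apply: lt_le_trans (_ : 2 <= _); rewrite ?ltr1n //.
  by rewrite ler_peMr.
have epsE : Cb * Cb * (2 * eps) * T = 1.
  by rewrite /eps; field; rewrite !gt_eqF.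
have [a [b [ba bb b0 hab]]] := happrox eps eps0.
pose u : FF := - (iota a / iota b).
have ru : bratio u by apply: bratioN; exists a, b.
have rB k : bratio (H2 k (ebar u)) by apply: (bratio_rows k (x := ebar u) _ bratio1).2; exact: bratioN.
have h2lt : (2^-1 : R) < 1 by rewrite invf_lt1 ?ltr1n.
have basic : near1 (fun r => [/\ forall j, (j <= n0)%N -> fnorm r (H2 j e1) <= C,
    forall k, (k <= n0)%N -> fnorm r (H2 k (ebar u)) <= Cb,
    (forall k, (k <= n0)%N -> r^-1 ^+ k <= T),
    fnorm r (iota g - u * iota f) <= 2 * eps * fnorm r (iota f) &
    gauss r g <= 2 * gauss r f]).
  apply: near1W (near1_and hC (near1_and hab (near1_gt h2lt))) _ => r r0 r1 [{}hC [[hab1 hab2] r2]].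
  have ri1 : 1 <= r^-1 by rewrite invf_ge1 // ltW.
  have ri2 : r^-1 <= 2 by rewrite invf_ple ?posrE // ltW.
  have riT k : (k <= n0)%N -> r^-1 ^+ k <= T.
    move=> kn; apply: le_trans (ler_weXn2l ri1 kn) _.
    by rewrite lerXn2r ?nnegrE ?invr_ge0 ?(ltW r0).
  have gb0 : 0 < gauss r b by rewrite gauss_gt0.
  have Nu : fnorm r u <= 2.
    by rewrite /u fnormN // fnorm_frac // ler_pdivrMr.
  have e : iota g - u * iota f = iota (a * f + b * g) / iota b.
    rewrite /u tofracD !tofracM mulrDl mulNr opprK addrC mulrAC; congr (_ + _).
    by rewrite mulrAC divff ?mul1r // tofrac_neq0.
  have s1 : fnorm r (iota g - u * iota f) <= eps * Num.max (gauss r f) (gauss r g).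
    by rewrite e fnorm_frac // ler_pdivrMr // mulrAC.
  (* Otherwise g - u f and u f would both have norm smaller than their sum g. *)
  have gf : gauss r g <= 2 * gauss r f.
    rewrite leNgt; apply/negP => lt.
    have fg : gauss r f <= gauss r g.
      by apply: le_trans (ltW lt); rewrite ler_peMl ?gauss_ge0 // ler1n.
    have g0 : 0 < gauss r g.
      by apply: le_lt_trans lt; rewrite mulr_ge0 ?gauss_ge0.
    have N1 := fnormD r0 r1 (iota g - u * iota f) (u * iota f).
    rewrite subrK (fnorm_tofrac r0 r1 g) (fnormM r0 r1 u) (fnorm_tofrac r0 r1 f) in N1.
    suff : gauss r g < gauss r g by rewrite ltxx.
    apply: le_lt_trans N1 _; rewrite gt_max; apply/andP; split.
      apply: le_lt_trans s1 _; rewrite (max_r fg).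
      by rewrite gtr_pMl.
    by apply: le_lt_trans lt; rewrite ler_wpM2r ?gauss_ge0.
  split=> //.
  - by move=> j jn; exact: (hC j jn).1.
  - move=> k kn.
    have ee : ebar u = (e2.1 + (rscale (- u) e1).1, e2.2 + (rscale (- u) e1).2).
      by rewrite /= mulr1 mulr0 add0r addr0.
    rewrite ee (hrow2D _ _ _ _ fderD) (hrow2Z _ _ _ _ frac_char0 fderD fderM).
    apply: le_trans (fnormD r0 r1 _ _) _; rewrite ge_max.
    rewrite (le_trans (hC k kn).2 CCb) /=.
    apply: fnorm_sum => //; first exact: ltW.
    move=> j; have jk : (j <= k)%N by rewrite -ltnS.
    rewrite fnormM // mulrC ler_pM ?fnorm_ge0 //.
      by apply: (hC _ _).1; exact: leq_trans (leq_subr _ _) kn.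
    apply: le_trans (fnorm_hd r0 r1 _ _) _; rewrite mulrC fnormN // ler_pM ?fnorm_ge0 //.
      by rewrite exprn_ge0 // invr_ge0 ltW.
    by apply: riT; exact: leq_trans jk kn.
  - apply: le_trans s1 _.
    by rewrite (fnorm_tofrac r0 r1 f) (mulrC 2 eps) -mulrA ler_pM2l // ge_max gf andbT ler_peMl ?gauss_ge0 // ler1n.
have [f0|f0] := eqVneq f 0.
  have [r [r0 _ r1 [_ _ _ _ gr]]] := near1_freq basic h2lt.
  have g0 : g = 0.
    apply/eqP; rewrite -(gauss_eq0 r0 r1) eq_le gauss_ge0 // andbT.
    by move: gr; rewrite f0 gauss0 // mulr0.
  by rewrite f0 g0; split; exact: bdd0.
have if0 : iota f != 0 by rewrite tofrac_eq0.
have [l ln [k k1 hk]] : exists2 l, (l <= n0)%N &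
    exists2 k, 1 < k & near1 (fun r => k <= fnorm r (H2 l (ebar u))).
  apply: contrapT => hn.
  (* If no divided power expands, the dichotomy bounds all these second coordinates, like r^-n0, by
     s near the boundary; [det_le] then bounds the determinant by s^2 = (1 + kap) / 2 < kap. *)
  pose s := Num.sqrt ((1 + kap) / 2).
  have hs0 : 0 <= (1 + kap) / 2 by lra.
  have ss : s * s = (1 + kap) / 2 by rewrite -expr2 sqr_sqrtr.
  have s1 : 1 < s.
    by rewrite -sqrtr1 ltr_sqrt; lra.
  have hB k : (k <= n0)%N -> near1 (fun r => fnorm r (H2 k (ebar u)) <= s).
    move=> kn; case: (bratio_dichotomy (rB k)) => [hh|]; last exact.
    by exfalso; apply: hn; exists k.
  have hall := near1_and (near1_le hB) (near1_and (near1_invX n0 s1) (near1_and basic hkap)).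
  have [r [r0 _ r1 [{}hB [hr [[hq hb hT hs _] {}hkap]]]]] := near1_freq hall h2lt.
  have ri1 : 1 <= r^-1 by rewrite invf_ge1 // ltW.
  have small : Cb * Cb * (2 * eps) * r^-1 ^+ n0 <= 1.
    apply: le_trans (_ : Cb * Cb * (2 * eps) * T <= _); last by rewrite epsE.
    by rewrite ler_wpM2l ?hT // !mulr_ge0 // ltW.
  have e0 : 0 <= 2 * eps by rewrite mulr_ge0 // ltW.
  have s2 : 1 <= s * s by rewrite mulr_ege1 // ltW.
  have hq' j : (j <= n0)%N -> fnorm r (H2 j e1) <= Cb.
    by move=> jn; exact: le_trans (hq j jn) CCb.
  have hB' j : (j <= n0)%N -> fnorm r (H2 j (ebar u)) * r^-1 ^+ (n0 - j) <= s * s.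
    move=> jn; apply: ler_pM; [exact: fnorm_ge0| |exact: hB|].
      by rewrite exprn_ge0 // invr_ge0 ltW.
    by apply: le_trans hr; rewrite ler_weXn2l // leq_subr.
  have := @det_le R FF (fnorm r) fder r^-1 frac_char0 fderD fderM
    (fnorm_ge0 r0 r1) (fnorm_eq0 r0 r1) (fnormM r0 r1) (fnormD r0 r1) ri1
    (fnorm_hd r0 r1) _ _ _ _ _ _ dfF dgF if0 Cb (2 * eps) e0 u n0 (s * s)
    hs Cb1 s2 hq' hb small hB'.
  by move=> /(le_trans hkap); rewrite ss; lra.
have B0 : H2 l (ebar u) != 0.
  have [r [r0 _ r1 hr]] := near1_freq hk h2lt.
  rewrite -(fnorm_eq0 r0 r1) gt_eqF //; apply: lt_le_trans hr; exact: lt_trans k1.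
have [cB [iB [jB [_ hB]]]] := bratio_asymptotics (rB l) B0.
have bf : bdd f.
  apply: monolike_bounded.
  (* Near the boundary r^-l <= k' < k <= |B|, which is the contraction required by the iteration. *)
  pose k' := (1 + k) / 2.
  have [k'1 k'k] : 1 < k' /\ k' < k by rewrite /k'; lra.
  have bru : near1 (fun r => regular_at r u).
    have [->|u0] := eqVneq u 0.
      by apply: near1A => r r0 r1; rewrite -tofrac0; exact: regular_tofrac.
    have [? [? [? [_ h]]]] := bratio_asymptotics ru u0.
    by apply: near1W h _ => r _ _ [].
  apply: near1W (near1_and hk (near1_and (near1_invX l k'1) (near1_and bru (near1_and basic hB)))) _.
  move=> r r0 r1 [{}hk [hr [{}bru [[hq hb hT hs _] [rb rbV _]]]]].
  have ri1 : 1 <= r^-1 by rewrite invf_ge1 // ltW.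
  apply: monolike_of_quotients => // m e e0.
  have lt1 : r^-1 ^+ l < fnorm r (H2 l (ebar u)).
    by apply: le_lt_trans hr _; exact: lt_le_trans hk.
  apply: (@newton_approx R FF (fnorm r) fder r^-1 frac_char0 fderD fderM
    (fnorm_ge0 r0 r1) (fnorm_eq0 r0 r1) (fnormM r0 r1) (fnormD r0 r1) ri1
    (fnorm_hd r0 r1) _ _ _ _ _ _ dfF dgF if0 Cb (2 * eps) _ (regular_at r) _ _ _ _ _ _ _ _
    l u bru hs _ _ lt1 rbV m e e0).
  - by rewrite mulr_ge0 // ltW.
  - by rewrite -tofrac1; exact: regular_tofrac.
  - by move=> x; exact: regularN.
  - by move=> x y; exact: regularD.
  - by move=> x y; exact: regularM.
  - by move=> x; exact: regular_fder.
  - by move=> n; exact: regular_inv_nat.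
  - by split; exact: regular_tofrac.
  - by move=> x y; exact: regular_inv.
  - move=> j jl; apply: le_trans CTb; rewrite ler_pM ?fnorm_ge0 ?hq ?hT //.
    + by rewrite exprn_ge0 // invr_ge0 ltW.
    + exact: leq_trans jl ln.
    + exact: leq_trans (leq_subr _ _) ln.
  - apply: le_lt_trans lt1; apply: le_trans (exprn_ege1 l ri1).
    have e1E : (Cb * T) * (Cb * (2 * eps)) = 1 by rewrite -[RHS]epsE; ring.
    apply: le_trans (_ : _ <= (Cb * T) * (Cb * (2 * eps))) _; last by rewrite e1E.
    apply: ler_peMl; last exact: mulr_ege1.
    by rewrite !mulr_ge0 // ltW.
split=> //.
have [Cf Cf1 hCf] := bdd_gauss bf.
apply/bounded_seriesP; exists (2 * Cf) => [|i]; first by rewrite mulr_ge0 // (le_trans _ Cf1).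
rewrite leNgt; apply/negP => lt.
have v0 : 0 < vnorm (dcoef g i).
  by apply: le_lt_trans lt; rewrite mulr_ge0 // (le_trans _ Cf1).
have q1 : 2 * Cf / vnorm (dcoef g i) < 1 by rewrite ltr_pdivrMr // mul1r.
(* At a radius with r^i >= q, the i-th term of g alone would exceed twice the norm of f. *)
pose q := (2 * Cf / vnorm (dcoef g i) + 1) / 2.
have [qa qb] : 2 * Cf / vnorm (dcoef g i) < q /\ q < 1 by rewrite /q; lra.
have [r [r0 _ r1 [[_ _ _ _ gr] hr]]] := near1_freq (near1_and basic (near1_expr i qb)) h2lt.
have := gauss_ub r0 r1 g i; apply/negP; rewrite -ltNge.
apply: le_lt_trans gr _; apply: le_lt_trans (_ : 2 * Cf < _).
  by rewrite ler_pM2l // hCf.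
by rewrite [ltRHS]mulrC -ltr_pdivrMr //; exact: lt_le_trans hr.
Qed.

End System.

(** * Solutions of the system *)

Section NatNorm.
Context {R : realType} {p : nat} {K : cdvfType R p}.

(** By Bezout u m = v p + 1, where v p has norm less than 1. *)
Lemma vnorm_coprime m : coprime p m -> vnorm (m%:R : K) = 1.
Proof.
move=> cpm; have pp := @vnorm_prime R p K.
have m0 : (0 < m)%N.
  by case: m cpm => //; rewrite /coprime gcdn0 => /eqP p1; rewrite p1 in pp.
case: (@egcdnP m p m0) => u v e _.
move: e; rewrite gcdnC (eqP cpm) => e.
have lt : vnorm ((v * p)%N%:R : K) < 1.
  rewrite natrM vnormM (@vnorm_p R p K).
  apply: le_lt_trans (_ : p%:R^-1 < 1).
    by rewrite ler_piMl ?vnorm_nat // invr_ge0.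
  by rewrite invf_lt1 ?ltr0n ?prime_gt0 // ltr1n prime_gt1.
have h : vnorm (u%:R : K) * vnorm (m%:R : K) = 1.
  by rewrite -vnormM -natrM e natrD addrC vnorm_addl ?vnorm1.
apply/eqP; rewrite eq_le vnorm_nat -h /=.
by rewrite ler_piMl ?vnorm_nat ?vnorm_ge0.
Qed.

(** The norm of n is p^-k, with p^k the exact power dividing n. This bound on 1 / n is the source of
    the linear growth. *)
Lemma vnorm_nat_ge n : (0 < n)%N -> 1 <= n%:R * vnorm (n%:R : K).
Proof.
move=> n0; have pp := @vnorm_prime R p K.
have [m cpm ->] := pfactor_coprime pp n0; set k := logn p n.
have m0 : (0 < m)%N.
  by case: m cpm => //; rewrite /coprime gcdn0 => /eqP p1; rewrite p1 in pp.
rewrite [X in vnorm X]natrM vnormM vnorm_coprime // mul1r natrM natrX.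
have vX : vnorm ((p ^ k)%N%:R : K) = p%:R^-1 ^+ k.
  rewrite natrX; elim: k => [|k ih]; first by rewrite vnorm1.
  by rewrite exprS vnormM ih (@vnorm_p R p K) exprS.
rewrite -natrX vX natrX -mulrA exprVn divff ?mulr1 ?ler1n //.
by rewrite expf_neq0 // pnatr_eq0 -lt0n prime_gt0.
Qed.

End NatNorm.

(** * Growth of the rows, and approximation by bounded fractions *)

Section Rows.
Context {R : realType} {p : nat} {K : cdvfType R p}.
Local Notation FF := {fraction (discSeries K)}.
Local Notation iota := (@tofrac (discSeries K)).
Local Notation dd := (@ds_deriv R p K).
Implicit Types (a f g : discSeries K).

Lemma tofrac_rows a11 a12 a21 a22 n x :
  iter n (rowD fder (iota a11) (iota a12) (iota a21) (iota a22)) (iota x.1, iota x.2)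
  = (iota (iter n (rowD dd a11 a12 a21 a22) x).1, iota (iter n (rowD dd a11 a12 a21 a22) x).2).
Proof.
elim: n => //= n ->.
by rewrite /rowD /= !fder_tofrac !tofracD !tofracM.
Qed.

Lemma tofrac_detD a11 a22 n c :
  iter n (detD fder (iota a11) (iota a22)) (iota c) = iota (iter n (detD dd a11 a22) c).
Proof.
elim: n => //= n ->.
by rewrite /detD /= !fder_tofrac !tofracD !tofracM tofracD.
Qed.

Lemma rowD_swap a11 a12 a21 a22 n (x : discSeries K * discSeries K) :
  iter n (rowD dd a22 a21 a12 a11) (x.2, x.1) =
  ((iter n (rowD dd a11 a12 a21 a22) x).2, (iter n (rowD dd a11 a12 a21 a22) x).1).
Proof.
elim: n => //= n ->; rewrite /rowD /=; congr pair; exact: addrAC.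
Qed.

Lemma detD_swap a11 a22 n c :
  iter n (detD dd a22 a11) c = iter n (detD dd a11 a22) c.
Proof. by elim: n => //= n ->; rewrite /detD addrC [a22 + _]addrC addrC. Qed.

Lemma bdd_rows a11 a12 a21 a22 n x : bdd a11 -> bdd a12 -> bdd a21 -> bdd a22 ->
  bdd x.1 -> bdd x.2 -> bdd (iter n (rowD dd a11 a12 a21 a22) x).1 /\
  bdd (iter n (rowD dd a11 a12 a21 a22) x).2.
Proof.
move=> *; elim: n => //= n [h k].
by split; apply: bddD; try (apply: bddD; [exact: bdd_deriv|]); exact: bddM.
Qed.

(* The Wronskian is solvable on the generic disc of radius 1. *)
Definition det_solvable a11 a22 := forall n i,
  vnorm (dcoef (iter n (detD dd a11 a22) 1) i) <= vnorm (n`!%:R : K).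

(** Divided by n!, the four values at 0 are the n-th Taylor coefficients of the fundamental matrix,
    so the bound expresses log-growth at most 1. *)
Definition rows_growth a11 a12 a21 a22 (C : R) := forall n,
  let P := iter n (rowD dd a11 a12 a21 a22) in
  let B := vnorm (n`!%:R : K) * (n.+1%:R * C) in
  [/\ vnorm (dcoef (P (1, 0)).1 0) <= B, vnorm (dcoef (P (1, 0)).2 0) <= B,
      vnorm (dcoef (P (0, 1)).1 0) <= B & vnorm (dcoef (P (0, 1)).2 0) <= B].

(** Apply [solvable_bound] at radii tending to 1 where g has norm at most that of f. Its constant is
    independent of r, and for fixed n the factor r^-n tends to 1. *)
Lemma solvable_growth_dominant a11 a12 a21 a22 f g : bdd a12 ->
  dd f = a11 * f + a12 * g -> dd g = a21 * f + a22 * g -> f != 0 ->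
  det_solvable a11 a22 ->
  (forall t, 0 < t -> t < 1 -> exists r, [/\ t < r, r < 1 & gauss r g <= gauss r f]) ->
  exists C, rows_growth a11 a12 a21 a22 C.
Proof.
move=> b12 df dg f0 hdet hfreq.
have [C C1 hC] := bdd_gauss b12; exists C => n /=.
have dfF : fder (iota f) = iota a11 * iota f + iota a12 * iota g.
  by rewrite fder_tofrac df tofracD !tofracM.
have dgF : fder (iota g) = iota a21 * iota f + iota a22 * iota g.
  by rewrite fder_tofrac dg tofracD !tofracM.
have if0 : iota f != 0 by rewrite tofrac_eq0.
have vn := vnorm_fact_gt0 (K := K).
have at_r r : 0 < r -> r < 1 -> gauss r g <= gauss r f ->
  let P := iter n (rowD dd a11 a12 a21 a22) in
  let B := vnorm (n`!%:R : K) * (n.+1%:R * r^-1 ^+ n * C) in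
  [/\ vnorm (dcoef (P (1, 0)).1 0) <= B, vnorm (dcoef (P (1, 0)).2 0) <= B,
      vnorm (dcoef (P (0, 1)).1 0) <= B & vnorm (dcoef (P (0, 1)).2 0) <= B].
  move=> r0 r1 gf P B.
  have ri1 : 1 <= r^-1 by rewrite invf_ge1 // ltW.
  have gf' : fnorm r (iota g) <= fnorm r (iota f) by rewrite !fnorm_tofrac.
  have aC : fnorm r (iota a12) <= C by rewrite fnorm_tofrac // hC.
  have hL m : fnorm r (hwronsk fder (iota a11) (iota a22) m 1) <= r^-1 ^+ m.
    apply: le_trans (exprn_ege1 m ri1).
    rewrite /hwronsk -tofrac1 tofrac_detD fnormM // fnormV // fnorm_nat // fnorm_tofrac //.
    rewrite mulrC ler_pdivrMr // mul1r; apply: gauss_le => i.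
    apply: le_trans (hdet m i); rewrite ler_piMr ?vnorm_ge0 //.
    by rewrite exprn_ile1 // ltW.
  have nat m : fnorm r (m.+1%:R^-1 : FF) <= m.+1%:R.
    rewrite fnormV // fnorm_nat // -[leLHS]mul1r ler_pdivrMr ?vnorm_nat_ge //.
    by rewrite lt_def vnorm_ge0 andbT; apply/eqP => /vnorm_eq0 /eqP; apply/negP; exact: natrS_neq0.
  have [q1 q2 q3 q4] := @solvable_bound R FF (fnorm r) fder r^-1 frac_char0 fderD fderM
    (fnorm_ge0 r0 r1) (fnorm_eq0 r0 r1) (fnormM r0 r1) (fnormD r0 r1) ri1
    (fnorm_hd r0 r1) _ _ _ _ _ _ dfF dgF if0 C gf' C1 aC hL nat n.
  have E (c : discSeries K) M : fnorm r (n`!%:R^-1 * iota c) <= M ->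
      vnorm (dcoef c 0) <= vnorm (n`!%:R : K) * M.
    rewrite fnormM // fnormV // fnorm_nat // fnorm_tofrac // mulrC ler_pdivrMr // mulrC.
    by apply: le_trans; have := gauss_ub r0 r1 c 0; rewrite expr0 mulr1.
  have r10 := tofrac_rows a11 a12 a21 a22 n (1, 0).
  have r01 := tofrac_rows a11 a12 a21 a22 n (0, 1).
  rewrite /= tofrac1 tofrac0 in r10 r01.
  move: q1 q2 q3 q4; rewrite /hrow1 /hrow2 r10 r01 /= => q1 q2 q3 q4.
  by split; apply: E.
have lim x : (forall r, 0 < r -> r < 1 -> gauss r g <= gauss r f ->
    x <= vnorm (n`!%:R : K) * (n.+1%:R * r^-1 ^+ n * C)) ->
    x <= vnorm (n`!%:R : K) * (n.+1%:R * C).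
  move=> hx; set B := vnorm _ * _.
  have B0 : 0 < B by rewrite !mulr_gt0 // (lt_le_trans _ C1).
  rewrite leNgt; apply/negP => lt; pose k := (x / B + 1) / 2.
  have xB : 1 < x / B by rewrite ltr_pdivlMr // mul1r.
  have [k1 kx] : 1 < k /\ k < x / B by rewrite /k; lra.
  have [t [t0 t1 ht]] := near1_invX n k1.
  have [r [tr r1 gf]] := hfreq t t0 t1.
  have := hx r (lt_trans t0 tr) r1 gf; apply/negP; rewrite -ltNge.
  have -> : vnorm (n`!%:R : K) * (n.+1%:R * r^-1 ^+ n * C) = r^-1 ^+ n * B.
    by rewrite /B; ring.
  by rewrite -ltr_pdivlMr //; apply: le_lt_trans kx; exact: ht.
by split; apply: lim => r r0 r1 gf; have [] := at_r r r0 r1 gf.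
Qed.

Theorem solvable_growth a11 a12 a21 a22 f g : bdd a12 -> bdd a21 ->
  dd f = a11 * f + a12 * g -> dd g = a21 * f + a22 * g -> f != 0 \/ g != 0 ->
  det_solvable a11 a22 -> exists C, rows_growth a11 a12 a21 a22 C.
Proof.
move=> b12 b21 df dg fg hdet.
have h0 : (0 : R) < 2^-1 by rewrite invr_gt0.
have h1 : (2^-1 : R) < 1 by rewrite invf_lt1 ?ltr1n.
(* Either |g| <= |f| at radii arbitrarily close to 1, or |f| < |g| at all radii near 1; in the
   second case the coordinates are exchanged. *)
have [hfreq|/existsNP[t /not_implyP[t0 /not_implyP[t1 /forallNP ht]]]] :=
    pselect (forall t : R, 0 < t -> t < 1 ->
      exists r, [/\ t < r, r < 1 & gauss r g <= gauss r f]).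
  apply: (solvable_growth_dominant b12 df dg _ hdet hfreq).
  have [r [hr r1 gf]] := hfreq _ h0 h1.
  have r0 := lt_trans h0 hr.
  apply: contraPneq fg => f0 /=; move: gf; rewrite f0 gauss0 // => gf.
  have -> : g = 0 by apply/eqP; rewrite -(gauss_eq0 r0 r1) eq_le gf gauss_ge0.
  by case; rewrite eqxx.
have lt r : t < r -> r < 1 -> gauss r f < gauss r g.
  by move=> tr r1; rewrite ltNge; apply/negP => gf; apply: (ht r).
have g0 : g != 0.
  have [r [r0 tr r1 _]] := near1_freq (@near1A _ (fun=> True) (fun _ _ _ => I)) t1.
  apply: contraTneq (lt r tr r1) => ->; rewrite gauss0 // -leNgt.
  exact: gauss_ge0.
have hdet' : det_solvable a22 a11 by move=> n i; rewrite detD_swap.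
have [||s s0 s1|C hC] := @solvable_growth_dominant a22 a21 a12 a11 g f b21 _ _ g0 hdet'.
- by rewrite dg addrC.
- by rewrite df addrC.
- have ms : Num.max s t < 1 by rewrite gt_max s1.
  have [r [r0]] := near1_freq (@near1A _ (fun=> True) (fun _ _ _ => I)) ms.
  rewrite gt_max => /andP[sr tr] r1 _; exists r; split=> //.
  by rewrite ltW // lt.
exists C => n /=; have [q1 q2 q3 q4] := hC n.
have s10 := rowD_swap a11 a12 a21 a22 n (1, 0).
have s01 := rowD_swap a11 a12 a21 a22 n (0, 1).
by rewrite /= in s10 s01; move: q1 q2 q3 q4; rewrite s10 s01.
Qed.

Lemma dominant_pair (a b : discSeries K) : bdd a -> bdd b -> b != 0 ->
  (forall j, exists i, vnorm (dcoef a j) <= vnorm (dcoef b i)) ->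
  near1 (fun r => forall j, vnorm (dcoef a j) <= 2 * gauss r b /\
    vnorm (dcoef b j) <= 2 * gauss r b).
Proof.
move=> ba bb b0 hab; have [i [bi0 bmax _]] := bdd_attained bb b0.
have k1 : (2^-1 : R) < 1 by rewrite invf_lt1 // ltr1n.
apply: near1W (near1_expr i k1) _ => r r0 r1 h j.
have hb : vnorm (dcoef b i) <= 2 * gauss r b.
  have := gauss_ub r0 r1 b i; rewrite -(ler_pM2l (_ : (0 : R) < 2)) //.
  apply: le_trans; rewrite mulrCA ler_peMr ?vnorm_ge0 //.
  by rewrite mulrC -ler_pdivrMr // div1r.
split; last exact: le_trans (bmax j) hb.
by have [l /le_trans] := hab j; apply; exact: le_trans (bmax l) hb.
Qed.

(** Relative to |b|, the row (a, b) nearly annihilates (f, g), so - a / b approximates g / f, with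
    one pair for all r near 1. *)
Definition approx_at f g (eps : R) := exists a b, [/\ bdd a, bdd b, b != 0 &
  near1 (fun r => gauss r a <= 2 * gauss r b /\
    gauss r (a * f + b * g) <= eps * gauss r b * Num.max (gauss r f) (gauss r g))].

Definition approximable f g := forall eps, 0 < eps -> approx_at f g eps.

Lemma row_solution a11 a12 a21 a22 f g n x :
  dd f = a11 * f + a12 * g -> dd g = a21 * f + a22 * g ->
  iter n dd (x.1 * f + x.2 * g) = (iter n (rowD dd a11 a12 a21 a22) x).1 * f +
    (iter n (rowD dd a11 a12 a21 a22) x).2 * g.
Proof.
move=> df dg; elim: n => //= n ->; rewrite ds_derivD !ds_derivM df dg; ring.
Qed.

(** Take a row (a, b) of D^m with a f + b g the m-th derivative of w, where w is f or g. At 0 this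
    reads m! w_m = a_0 f_0 + b_0 g_0, so the row has size at least |m! w_m| / V, while the m-th
    derivative of w has Gauss norm at most |m!| r^-m |w|. Unboundedness makes |w_m| as large as
    desired. *)
Lemma approximable_of_unbounded a11 a12 a21 a22 f g :
  bdd a11 -> bdd a12 -> bdd a21 -> bdd a22 ->
  dd f = a11 * f + a12 * g -> dd g = a21 * f + a22 * g ->
  ~ (bdd f /\ bdd g) -> approximable f g \/ approximable g f.
Proof.
move=> b11 b12 b21 b22 df dg unb.
pose V := Num.max 1 (Num.max (vnorm (dcoef f 0)) (vnorm (dcoef g 0))).
have V1 : 1 <= V by rewrite le_max lexx.
have V0 : 0 < V by exact: lt_le_trans V1.
have Vf : vnorm (dcoef f 0) <= V by rewrite !le_max lexx !orbT.
have Vg : vnorm (dcoef g 0) <= V by rewrite !le_max lexx !orbT.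
have big (C : R) : 0 < C -> exists a b (w : discSeries K) m, [/\ bdd a, bdd b,
    iter m dd w = a * f + b * g, C < vnorm (dcoef w m) & w = f \/ w = g].
  move=> C0; have bz := @bdd0 R p K; have bo := @bdd1 R p K.
  have ub (w : discSeries K) : ~ bdd w -> exists m, C < vnorm (dcoef w m).
    move=> nw; apply: contrapT => /forallNP h; apply: nw; apply/bounded_seriesP.
    by exists C => [|i]; [exact: ltW|rewrite leNgt; apply/negP/h].
  have [bf|/ub[m hm]] := pselect (bdd f).
    have [bg|/ub[m hm]] := pselect (bdd g); first by case: unb.
    exists (iter m (rowD dd a11 a12 a21 a22) (0, 1)).1,
      (iter m (rowD dd a11 a12 a21 a22) (0, 1)).2, g, m.
    have [] := bdd_rows m b11 b12 b21 b22 (x := (0, 1)) bz bo; split=> //; last by right.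
    by have := row_solution m (0, 1) df dg; rewrite /= mul0r mul1r add0r.
  exists (iter m (rowD dd a11 a12 a21 a22) (1, 0)).1,
    (iter m (rowD dd a11 a12 a21 a22) (1, 0)).2, f, m.
  have [] := bdd_rows m b11 b12 b21 b22 (x := (1, 0)) bo bz; split=> //; last by left.
  by have := row_solution m (1, 0) df dg; rewrite /= mul0r mul1r addr0.
(* The 4 in the threshold absorbs a factor 2 for r^-m and a factor 2 for replacing the largest
   coefficient of b by its Gauss norm. *)
have step (f' g' a b w : discSeries K) m (eps : R) : 0 < eps -> bdd a -> bdd b ->
    b != 0 -> vnorm (dcoef f' 0) <= V -> vnorm (dcoef g' 0) <= V ->
    iter m dd w = a * f' + b * g' -> 4 * V / eps < vnorm (dcoef w m) ->
    w = f' \/ w = g' -> (forall j, exists i, vnorm (dcoef a j) <= vnorm (dcoef b i)) ->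
    approx_at f' g' eps.
  move=> eps0 ba bb b0 Vf' Vg' ew hw fg hab; exists a, b; split=> //.
  have k1 : (1 : R) < 2 by rewrite ltr1n.
  apply: near1W (near1_and (dominant_pair ba bb b0 hab) (near1_invX m k1)) _.
  move=> r r0 r1 [dom r2]; have b2 : 0 <= 2 * gauss r b by rewrite mulr_ge0 ?gauss_ge0.
  split.
    apply: gauss_le => j; apply: le_trans (dom j).1.
    by rewrite ler_piMr ?vnorm_ge0 // exprn_ile1 // ltW.
  have vm := vnorm_fact_gt0 (K := K) m.
  have wm : vnorm (m`!%:R : K) * vnorm (dcoef w m) <= 2 * gauss r b * V.
    have := dcoef_iter m w 0; rewrite add0n ffactnn => /(congr1 vnorm).
    rewrite vnormM => <-; rewrite ew dcoefD !dcoefM !big_ord_recl !big_ord0 /= !addr0.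
    apply: le_trans (vnorm_ultra _ _) _; rewrite ge_max !vnormM.
    by rewrite !ler_pM ?vnorm_ge0 ?(dom 0%N).1 ?(dom 0%N).2.
  have mb : vnorm (m`!%:R : K) * 2 <= eps * gauss r b.
    move: hw; rewrite ltr_pdivrMr // => /ltW; rewrite -(ler_pM2l vm) mulrA mulrA => hw.
    have := le_trans hw (ler_wpM2r (ltW eps0) wm).
    have -> : vnorm (m`!%:R : K) * 4 * V = (2 * V) * (vnorm (m`!%:R : K) * 2) by ring.
    have -> : 2 * gauss r b * V * eps = (2 * V) * (eps * gauss r b) by ring.
    by rewrite ler_pM2l // mulr_gt0.
  rewrite -ew; apply: le_trans (gauss_iter r0 r1 _ _) _; rewrite mulrA.
  rewrite ler_pM ?gauss_ge0 ?mulr_ge0 ?vnorm_ge0 ?exprn_ge0 ?invr_ge0 ?(ltW r0) //.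
    by apply: le_trans mb; rewrite ler_wpM2l ?vnorm_ge0.
  by case: fg => ->; rewrite le_max lexx ?orbT.
(* Whichever of a and b has the larger coefficients serves as the denominator. *)
have QQ eps : 0 < eps -> approx_at f g eps \/ approx_at g f eps.
  move=> eps0; have [|a [b [w [m [ba bb ew hw fg]]]]] := big (4 * V / eps).
    by rewrite divr_gt0 // mulr_gt0.
  have w0 : 0 < vnorm (dcoef (iter m dd w) 0).
    rewrite dcoef_iter add0n ffactnn vnormM mulr_gt0 ?vnorm_fact_gt0 //.
    by apply: lt_trans hw; rewrite divr_gt0 // mulr_gt0.
  have ew' : iter m dd w = b * g + a * f by rewrite addrC.
  have fg' : w = g \/ w = f by case: fg; [right|left].
  have zero (c e : discSeries K) : c = 0 -> forall j, exists i,
      vnorm (dcoef c j) <= vnorm (dcoef e i).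
    by move=> -> j; exists 0%N; rewrite dcoef0 vnorm0 vnorm_ge0.
  have [b0|b0] := eqVneq b 0.
    right; have a0 : a != 0.
      apply: contraTneq w0 => a0; rewrite ew a0 b0 !mul0r addr0 dcoef0 vnorm0.
      by rewrite ltxx.
    by apply: step ew' hw fg' _ => //; exact: zero.
  have [a0|a0] := eqVneq a 0.
    by left; apply: step ew hw fg _ => //; exact: zero.
  have [ia [_ amax _]] := bdd_attained ba a0.
  have [ib [_ bmax _]] := bdd_attained bb b0.
  have [ab|ab] := leP (vnorm (dcoef a ia)) (vnorm (dcoef b ib)).
    by left; apply: step ew hw fg _ => // j; exists ib; exact: le_trans (amax j) ab.
  right; apply: step ew' hw fg' _ => // j; exists ia.
  exact: le_trans (bmax j) (ltW ab).
have mono f' g' e1 e2 : e1 <= e2 -> approx_at f' g' e1 -> approx_at f' g' e2.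
  move=> e12 [a [b [ba bb b0 h]]]; exists a, b; split=> //.
  apply: near1W h _ => r r0 r1 [h1 h2]; split=> //; apply: le_trans h2 _.
  rewrite ler_wpM2r ?le_max ?gauss_ge0 // ler_wpM2r ?gauss_ge0 //.
(* The order of f and g might vary with the tolerance. If one order fails for [e1], the other holds
   for all tolerances below [e1], hence for all. *)
have [|/existsNP[e1 /not_implyP[e10 nQ]]] := pselect (approximable f g); first by left.
right=> e e0; have [|h|] := QQ (Num.min e1 e); first by rewrite lt_min e10.
  by case: nQ; apply: mono h; rewrite ge_min lexx.
by apply: mono; rewrite ge_min lexx orbT.
Qed.

(** A violation at some n and i keeps the n-th divided power on the determinant above some k > 1
    near the boundary. An unbounded solution would be approximable, and so bounded. *)
Theorem unsolvable_solutions_bounded a11 a12 a21 a22 f g :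
  bdd a11 -> bdd a12 -> bdd a21 -> bdd a22 ->
  dd f = a11 * f + a12 * g -> dd g = a21 * f + a22 * g ->
  ~ det_solvable a11 a22 -> bdd f /\ bdd g.
Proof.
move=> b11 b12 b21 b22 df dg /existsNP[n /existsNP[i /negP]]; rewrite -ltNge => hi.
have vn := vnorm_fact_gt0 (K := K) n.
apply: contrapT => unb.
set c := iter n _ _ in hi.
pose q := vnorm (dcoef c i) / vnorm (n`!%:R : K).
have q1 : 1 < q by rewrite ltr_pdivlMr // mul1r.
pose k := (1 + q) / 2.
have [k1 kq] : 1 < k /\ k < q by rewrite /k; lra.
have q0 : 0 < q by exact: lt_trans q1.
have kq1 : k / q < 1 by rewrite ltr_pdivrMr // mul1r.
have hk : near1 (fun r => k <= gauss r c / vnorm (n`!%:R : K)).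
  apply: near1W (near1_expr i kq1) _ => r r0 r1; rewrite ler_pdivrMr // => h.
  apply: le_trans h _; rewrite ler_pdivlMr // -mulrA divfK ?gt_eqF //.
  by rewrite mulrC gauss_ub.
have HLE (a1 a2 : discSeries K) r : 0 < r -> r < 1 ->
    fnorm r (hwronsk fder (iota a1) (iota a2) n 1) = gauss r (iter n (detD dd a1 a2) 1) / vnorm (n`!%:R : K).
  move=> r0 r1; rewrite /hwronsk -tofrac1 tofrac_detD fnormM // fnormV // fnorm_nat //.
  by rewrite fnorm_tofrac // mulrC.
have [ap|ap] := approximable_of_unbounded b11 b12 b21 b22 df dg unb.
  apply: unb; apply: (@unsolvable_bounded R p K a11 a12 a21 a22 f g b11 b12 b21 b22 df dg n k k1 _ ap).
  by apply: near1W hk _ => r r0 r1; rewrite HLE.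
suff [bg bf] : bdd g /\ bdd f by apply: unb.
have dg' : dd g = a22 * g + a21 * f by rewrite dg addrC.
have df' : dd f = a12 * g + a11 * f by rewrite df addrC.
apply: (@unsolvable_bounded R p K a22 a21 a12 a11 g f b22 b21 b12 b11 dg' df' n k k1 _ ap).
by apply: near1W hk _ => r r0 r1; rewrite HLE // detD_swap.
Qed.

End Rows.

(** * Taylor coefficients of solutions and the fundamental matrix *)

Section Solutions.
Context {R : realType} {p : nat} {K : cdvfType R p}.
Local Notation dd := (@ds_deriv R p K).
Implicit Types (f g : discSeries K).

Lemma log_growth_bdd delta f : bdd f -> log_growth delta (val f).
Proof.
rewrite /log_growth; case: ifP => // d0 /bounded_seriesP[C C0 hC].
exists C => _ [i _ <-]; apply: le_trans (hC i).
rewrite ler_pdivrMr ?powR_gt0 // ler_peMr ?vnorm_ge0 //.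
by rewrite -[leLHS](powRr0 i.+1%:R) ler_powR ?ler1n.
Qed.

Lemma log_growth1 (s : Defs.pseries K) (C : R) :
  (forall i, vnorm (scoef s i) <= i.+1%:R * C) -> log_growth 1 s.
Proof.
move=> h; rewrite /log_growth ler01; exists C => _ [i _ <-].
by rewrite powRr1 // ler_pdivrMr // mulrC.
Qed.

Variables (a11 a12 a21 a22 : discSeries K).
Local Notation D := (rowD dd a11 a12 a21 a22).

Definition solution f g := dd f = a11 * f + a12 * g /\ dd g = a21 * f + a22 * g.

(** Differentiate n times with [row_solution] and evaluate at 0. *)
Lemma solution_coef f g n : solution f g ->
  n`!%:R * dcoef f n = dcoef (iter n D (1, 0)).1 0 * dcoef f 0 +
                       dcoef (iter n D (1, 0)).2 0 * dcoef g 0 /\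
  n`!%:R * dcoef g n = dcoef (iter n D (0, 1)).1 0 * dcoef f 0 +
                       dcoef (iter n D (0, 1)).2 0 * dcoef g 0.
Proof.
move=> [df dg].
have E (w : discSeries K) : n`!%:R * dcoef w n = dcoef (iter n dd w) 0.
  by rewrite dcoef_iter add0n ffactnn.
have := row_solution n (1, 0) df dg; have := row_solution n (0, 1) df dg.
rewrite /= !mul1r !mul0r addr0 add0r => e1 e2.
by rewrite !E e1 e2 !dcoefD !dcoefM !big_ord_recl !big_ord0 /= !addr0.
Qed.

Lemma solution_eq0 f g : solution f g -> dcoef f 0 = 0 -> dcoef g 0 = 0 ->
  f = 0 /\ g = 0.
Proof.
move=> sol f0 g0.
have nz n : n`!%:R != 0 :> K.
  by case: (n`!) (fact_gt0 n) => // m _; exact: natrS_neq0.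
by split; apply: dcoefP => n; apply: (mulfI (nz n)); have [h k] := solution_coef n sol;
  rewrite dcoef0 mulr0 ?h ?k f0 g0 !mulr0 addr0.
Qed.

Lemma solutionD f g f' g' : solution f g -> solution f' g' ->
  solution (f + f') (g + g').
Proof.
by move=> [e1 e2] [e3 e4]; split; rewrite ds_derivD ?e1 ?e2 ?e3 ?e4; ring.
Qed.

Lemma ds_deriv_const (c : K) f : dd (bs_const c *: f) = bs_const c *: dd f.
Proof.
rewrite ds_derivZ; have -> : bs_deriv (bs_const c) = 0.
  by apply: val_inj; apply/pseriesP => i /=; rewrite mulr0.
by rewrite scale0r add0r.
Qed.

Lemma scale_mulr (c : boundedSeries K) f g : c *: (f * g) = f * (c *: g).
Proof. exact: mulrCA. Qed.

Lemma solutionZ c f g : solution f g -> solution (bs_const c *: f) (bs_const c *: g).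
Proof.
move=> [e1 e2]; split; rewrite ds_deriv_const ?e1 ?e2 scalerDr.
  by rewrite !scale_mulr.
by rewrite !scale_mulr.
Qed.

Lemma dcoef_scale c f : dcoef (bs_const c *: f) 0 = c * dcoef f 0.
Proof.
rewrite -[_ *: f]/(bs_ds (bs_const c) * f) dcoefM big_ord_recl big_ord0 addr0 subn0.
by [].
Qed.

Section Growth.
Variable C : R.
Hypothesis hC : rows_growth a11 a12 a21 a22 C.

Lemma solution_growth f g : solution f g ->
  log_growth 1 (val f) /\ log_growth 1 (val g).
Proof.
move=> sol; pose V := Num.max (vnorm (dcoef f 0)) (vnorm (dcoef g 0)).
have Vf : vnorm (dcoef f 0) <= V by rewrite !le_max lexx.
have Vg : vnorm (dcoef g 0) <= V by rewrite !le_max lexx orbT.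
have V0 : 0 <= V by apply: le_trans Vf; exact: vnorm_ge0.
have main n x (y z : K) : vnorm y <= vnorm (n`!%:R : K) * (n.+1%:R * C) ->
    vnorm z <= vnorm (n`!%:R : K) * (n.+1%:R * C) ->
    n`!%:R * x = y * dcoef f 0 + z * dcoef g 0 -> vnorm x <= n.+1%:R * (C * V).
  move=> hy hz e; have vn := vnorm_fact_gt0 (K := K) n.
  rewrite -(ler_pM2l vn) -vnormM e [_%:R * (C * V)]mulrA mulrA.
  apply: le_trans (vnorm_ultra _ _) _.
  by rewrite ge_max !vnormM !ler_pM ?vnorm_ge0.
split; apply: (@log_growth1 _ (C * V)) => n; have [h1 h2 h3 h4] := hC n;
  have [e1 e2] := solution_coef n sol; [exact: main h1 h2 e1|exact: main h3 h4 e2].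
Qed.

Let fund (pr : discSeries K * discSeries K -> discSeries K)
    (e : discSeries K * discSeries K) : Defs.pseries K :=
  PSeries (fun n => n`!%:R^-1 * dcoef (pr (iter n D e)) 0).

Let fund_growth pr e :
  (forall n, vnorm (dcoef (pr (iter n D e)) 0) <= vnorm (n`!%:R : K) * (n.+1%:R * C)) ->
  fund pr e \in disc_pred.
Proof.
move=> h; apply/asboolP/(@log_growth_disc _ _ _ 1)/(@log_growth1 _ C) => n /=.
have vn := vnorm_fact_gt0 (K := K) n; have v0 : n`!%:R != 0 :> K.
  by apply: contraTneq vn => ->; rewrite vnorm0 ltxx.
by rewrite -(ler_pM2l vn) -vnormM mulrA divff // mul1r.
Qed.

(* The n-th Taylor coefficients of the fundamental matrix are the values at 0 of
   the rows of D^n / n!; [pr] selects the column. *)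
Lemma fundamental_column (pr : discSeries K * discSeries K -> discSeries K) :
  (pr = fst \/ pr = snd) -> exists f g, [/\ solution f g,
    dcoef f 0 = dcoef (pr (1, 0)) 0 & dcoef g 0 = dcoef (pr (0, 1)) 0].
Proof.
move=> hpr.
have m1 : fund pr (1, 0) \in disc_pred.
  by apply: fund_growth => n; case: hpr => ->; have [] := hC n.
have m2 : fund pr (0, 1) \in disc_pred.
  by apply: fund_growth => n; case: hpr => ->; have [] := hC n.
exists (DiscSeries m1), (DiscSeries m2).
have nz n : n`!%:R != 0 :> K.
  by case: (n`!) (fact_gt0 n) => // m _; exact: natrS_neq0.
pose b (c : discSeries K) (x : discSeries K * discSeries K) := (c * x.1, c * x.2).
have prD x y : pr (x + y) = pr x + pr y by case: hpr => ->.
have prb c x : pr (b c x) = c * pr x by case: hpr => ->.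
have pr0 : pr 0 = 0 by case: hpr => ->.
have DD x y : D (x + y) = D x + D y.
  by rewrite [RHS]surjective_pairing /rowD /= !ds_derivD; congr pair; ring.
have Db c x : D (b c x) = b (dd c) x + b c (D x).
  by rewrite [RHS]surjective_pairing /rowD /b /= !ds_derivM; congr pair; ring.
have dd0 : dd 0 = 0 by apply: (addrI (dd 0)); rewrite -ds_derivD !addr0.
have dd1 : dd 1 = 0.
  have := ds_derivM (1 : discSeries K) 1; rewrite !mulr1 mul1r => /eqP.
  by rewrite -subr_eq0 opprD addNKr oppr_eq0 => /eqP.
have iterD n x y : iter n D (x + y) = iter n D x + iter n D y.
  by elim: n => //= n ->; rewrite DD.
(* The sum is the n-th coefficient of the product of c with [fund pr e]: multiplying a row by c
   multiplies its series by c. *)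
have leib n c (e : discSeries K * discSeries K) :
    dcoef (pr (iter n D (b c e))) 0 = n`!%:R *
      \sum_(j < n.+1) dcoef c j * scoef (fund pr e) (n - j).
  rewrite (iter_leibniz DD Db) (big_morph pr prD pr0).
  rewrite (big_morph (fun h => dcoef h 0) (fun x y => dcoefD x y 0) (dcoef0 0)).
  rewrite mulr_sumr; apply: eq_bigr => j _.
  have jn : (j <= n)%N by rewrite -ltnS.
  have prn x k : pr (x *+ k) = pr x *+ k.
    by elim: k => [|k ih]; rewrite ?mulr0n ?mulrS ?prD ?ih.
  have dn (h : discSeries K) k : dcoef (h *+ k) 0 = dcoef h 0 *+ k.
    by elim: k => [|k ih]; rewrite ?mulr0n ?mulrS ?dcoefD ?ih.
  rewrite prn dn prb dcoefM big_ord_recl big_ord0 addr0 /= subn0.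
  rewrite dcoef_iter add0n ffactnn -(bin_fact jn) !natrM -mulr_natl.
  by field; exact: nz.
(* Shifting n by one turns the expansion of [D e] in the standard rows into the differential
   equation of the column. *)
have sol (e : discSeries K * discSeries K) (c1 c2 : discSeries K) me :
    D e = b c1 (1, 0) + b c2 (0, 1) ->
    dd (DiscSeries (me : fund pr e \in disc_pred)) =
      c1 * DiscSeries m1 + c2 * DiscSeries m2.
  move=> De; apply: dcoefP => n; rewrite dcoefD !dcoefM.
  apply: (mulfI (nz n)); rewrite mulrDr -!leib //.
  rewrite -[dcoef (dd _) n]/(n.+1%:R * (n.+1`!%:R^-1 * dcoef (pr (iter n.+1 D e)) 0)).
  rewrite iterSr De iterD prD dcoefD factS natrM.
  rewrite [LHS]mulrA [X in X * _ = _]mulrC mulVKf // mulf_neq0 ?nz //.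
  exact: natrS_neq0.
split.
- by split; apply: sol; rewrite [RHS]surjective_pairing /rowD /b /= ?dd0 ?dd1; congr pair; ring.
- by rewrite /dcoef /= invr1 mul1r.
- by rewrite /dcoef /= invr1 mul1r.
Qed.

End Growth.
End Solutions.

(** * Coordinates on the tensor product *)

Section Tensor.
Context {R : realType} {p : nat} {K : cdvfType R p}.
Variable M : diffModule K.
Variable e : 'I_2 -> M.
Hypothesis ebasis : forall m : M,
  exists! c : {ffun 'I_2 -> boundedSeries K}, m = \sum_(i < 2) c i *: e i.
Local Notation dd := (@ds_deriv R p K).
Local Notation T := (tensor M (discSeries K)).
Implicit Types (f g h : discSeries K) (m : M).

Definition coord m (i : 'I_2) : boundedSeries K := xget [ffun=> 0]
  [set c : {ffun 'I_2 -> boundedSeries K} | m = \sum_(i < 2) c i *: e i] i.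

Let lift01 : lift ord0 ord0 = 1 :> 'I_2. Proof. exact: val_inj. Qed.

Lemma coordE m : m = coord m 0 *: e 0 + coord m 1 *: e 1.
Proof.
rewrite /coord; case: xgetP => [c _ /= mE|h].
  by rewrite {1}mE big_ord_recl big_ord1 lift01.
by have [c [hc _]] := ebasis m; case: (h c).
Qed.

Lemma coord_uniq m (x y : boundedSeries K) : m = x *: e 0 + y *: e 1 ->
  coord m 0 = x /\ coord m 1 = y.
Proof.
move=> mE; have [c [_ cu]] := ebasis m.
have s (a b : boundedSeries K) : \sum_(i < 2) [ffun i : 'I_2 => if i == 0 then a else b] i *: e i
    = a *: e 0 + b *: e 1.
  by rewrite big_ord_recl big_ord1 lift01 !ffunE.
have h1 := cu [ffun i => if i == 0 then x else y]; rewrite s in h1.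
have h2 := cu [ffun i => if i == 0 then coord m 0 else coord m 1]; rewrite s in h2.
have := etrans (esym (h2 (coordE m))) (h1 mE) => h.
have := congr1 (fun c : {ffun _} => c 0) h; have := congr1 (fun c : {ffun _} => c 1) h.
by rewrite !ffunE /=.
Qed.

Definition tens_pair f g : T := tens (e 0) f + tens (e 1) g.

Lemma tens_pairD f g f' g' : tens_pair f g + tens_pair f' g' = tens_pair (f + f') (g + g').
Proof. by rewrite /tens_pair !tensDr addrACA. Qed.

Lemma tens_pairZ (a : boundedSeries K) f g : a *: tens_pair f g = tens_pair (a *: f) (a *: g).
Proof. by rewrite /tens_pair !tensZr scalerDr. Qed.

Lemma tens_tens_pair m h : tens m h = tens_pair (coord m 0 *: h) (coord m 1 *: h).
Proof. by rewrite {1}[m]coordE tensDl !tensZl /tens_pair !tensZr. Qed.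

Lemma tens_pair0 : tens_pair 0 0 = 0.
Proof. by apply: (addrI (tens_pair 0 0)); rewrite tens_pairD !addr0. Qed.

Lemma tens_pair_surj (x : T) : exists f g, x = tens_pair f g.
Proof.
rewrite [x]tensorE; elim: (trepr x) => [|q s [f [g ih]]].
  by exists 0, 0; rewrite big_nil tens_pair0.
rewrite big_cons ih tens_tens_pair tens_pairD.
by eexists; eexists; reflexivity.
Qed.

Let coordD m m' : coord (m + m') 0 = coord m 0 + coord m' 0 /\
  coord (m + m') 1 = coord m 1 + coord m' 1.
Proof.
by apply: coord_uniq; rewrite {1}[m]coordE {1}[m']coordE !scalerDl addrACA.
Qed.

Let coordZ a m : coord (a *: m) 0 = a * coord m 0 /\ coord (a *: m) 1 = a * coord m 1.
Proof.
by apply: coord_uniq; rewrite {1}[m]coordE scalerDr !scalerA.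
Qed.

Let coordE0 : coord (e 0) 0 = 1 /\ coord (e 0) 1 = 0.
Proof. by apply: coord_uniq; rewrite scale1r scale0r addr0. Qed.
Let coordE1 : coord (e 1) 0 = 0 /\ coord (e 1) 1 = 1.
Proof. by apply: coord_uniq; rewrite scale1r scale0r add0r. Qed.

(** The coordinate functionals of M, extended to the tensor product by [tensor_lift], recover f and
    g. *)
Lemma tens_pair_inj f g f' g' : tens_pair f g = tens_pair f' g' -> f = f' /\ g = g'.
Proof.
have P (i : 'I_2) : i = 0 \/ i = 1.
  by case: i => -[|[|//]] h; [left|right]; exact: val_inj.
have E i f1 g1 : tensor_lift (fun m h => coord m i *: h) (tens_pair f1 g1) =
    coord (e 0) i *: f1 + coord (e 1) i *: g1.
  have bDl m m' h : coord (m + m') i *: h = coord m i *: h + coord m' i *: h.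
    by have [d0 d1] := coordD m m'; case: (P i) => ->; rewrite ?d0 ?d1 scalerDl.
  have bDr m h h' : coord m i *: (h + h') = coord m i *: h + coord m i *: h'.
    exact: scalerDr.
  have bZ a m h : coord (a *: m) i *: h = coord m i *: (a *: h).
    have [d0 d1] := coordZ a m.
    by case: (P i) => ->; rewrite ?d0 ?d1 scalerA mulrC.
  by rewrite /tens_pair (tensor_liftD bDl bDr bZ) !(tensor_liftE bDl bDr bZ).
move=> h; have := congr1 (tensor_lift (fun m h => coord m 0 *: h)) h.
have := congr1 (tensor_lift (fun m h => coord m 1 *: h)) h.
have [c0 c1] := coordE0; have [c2 c3] := coordE1.
by rewrite !E c0 c1 c2 c3 !scale1r !scale0r !addr0 !add0r.
Qed.

(** The sign makes horizontality read v' = G v for this matrix G. *)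
Definition connection (i j : 'I_2) : discSeries K := - bs_ds (coord (dm_D (e j)) i).

Lemma bdd_conn i j : bdd (connection i j).
Proof.
apply: bddN; rewrite /bdd; case: (coord _ _) => s hs; exact/asboolP.
Qed.

Lemma tensor_D_tens_pair f g : tensor_D (tens_pair f g) =
  tens_pair (dd f - (connection 0 0 * f + connection 0 1 * g)) (dd g - (connection 1 0 * f + connection 1 1 * g)).
Proof.
rewrite /tens_pair tensor_DD !tensor_DE !(tens_tens_pair (dm_D _)) -/(tens_pair _ _).
rewrite addrACA tens_pairD -/(tens_pair (dd f) (dd g)) tens_pairD.
rewrite /connection !mulNr !opprD !opprK.
by congr tens_pair; rewrite addrC -?addrA.
Qed.

Lemma horizontal_tens_pair f g :
  horizontal M (tens_pair f g) <-> solution (connection 0 0) (connection 0 1) (connection 1 0) (connection 1 1) f g.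
Proof.
rewrite /horizontal /= tensor_D_tens_pair -tens_pair0; split.
  by move=> /tens_pair_inj [/eqP + /eqP]; rewrite !subr_eq0 => /eqP h1 /eqP h2; split.
by move=> [-> ->]; rewrite !subrr.
Qed.

Lemma tensor_growth_tens_pair delta f g : log_growth delta (val f) ->
  log_growth delta (val g) -> tensor_growth M delta (tens_pair f g).
Proof.
move=> hf hg; exists [:: (e 0, f); (e 1, g)]; last by rewrite big_cons big_seq1.
by move=> q; rewrite !inE => /orP[/eqP ->|/eqP ->].
Qed.

(** The columns of the fundamental matrix have initial values (1, 0) and (0, 1); they form a basis
    because a solution is determined by its value at 0. *)
Lemma Kdim_horizontal C :
  rows_growth (connection 0 0) (connection 0 1) (connection 1 0) (connection 1 1) C ->
  Kdim (horizontal M) = 2%N.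
Proof.
move=> hC.
have [f1 [g1 [s1 f10 g10]]] := fundamental_column hC (or_introl erefl : fst = fst \/ _).
have [f2 [g2 [s2 f20 g20]]] := fundamental_column hC (or_intror erefl : _ \/ snd = snd).
rewrite /= in f10 g10 f20 g20.
have o1 : dcoef (1 : discSeries K) 0 = 1 by [].
rewrite o1 dcoef0 in f10 g10 f20 g20.
pose E (i : 'I_2) := if i == 0 then tens_pair f1 g1 else tens_pair f2 g2.
have sumE (c : {ffun 'I_2 -> K}) : \sum_(i < 2) bs_const (c i) *: E i =
    tens_pair (bs_const (c 0) *: f1 + bs_const (c 1) *: f2)
       (bs_const (c 0) *: g1 + bs_const (c 1) *: g2).
  by rewrite big_ord_recl big_ord1 lift01 /E /= !tens_pairZ tens_pairD.
have solE (c : {ffun 'I_2 -> K}) := solutionD (solutionZ (c 0) s1) (solutionZ (c 1) s2).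
have c0E (c : {ffun 'I_2 -> K}) :
    dcoef (bs_const (c 0) *: f1 + bs_const (c 1) *: f2) 0 = c 0 /\
    dcoef (bs_const (c 0) *: g1 + bs_const (c 1) *: g2) 0 = c 1.
  by rewrite !dcoefD !dcoef_scale f10 g10 f20 g20 !mulr1 !mulr0 addr0 add0r.
have basis : is_Kbasis (horizontal M) E.
  split=> [c|x hx]; first by rewrite sumE; apply/horizontal_tens_pair; exact: solE.
  have [f [g xE]] := tens_pair_surj x; rewrite xE in hx *.
  have sol := (horizontal_tens_pair f g).1 hx.
  exists [ffun i => if i == 0 then dcoef f 0 else dcoef g 0]; split.
    rewrite sumE; set c := finfun _.
    have [z1 z2] := c0E c; have [c0 c1] : c 0 = dcoef f 0 /\ c 1 = dcoef g 0.
      by rewrite !ffunE.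
    have sD := solutionD sol (solutionZ (- 1) (solE c)).
    have [||w1 w2] := solution_eq0 sD.
    - by rewrite dcoefD dcoef_scale z1 c0 mulN1r subrr.
    - by rewrite dcoefD dcoef_scale z2 c1 mulN1r subrr.
    have m1 (h : discSeries K) : bs_const (- 1) *: h = - h.
      have -> : bs_const (- 1 : K) = - 1.
        by apply: val_inj; apply/pseriesP => -[|i] //=; rewrite oppr0.
      by rewrite scaleN1r.
    move: w1 w2; rewrite !m1 => /eqP; rewrite subr_eq0 => /eqP <- /eqP.
    by rewrite subr_eq0 => /eqP <-.
  move=> c; rewrite sumE => /tens_pair_inj [-> ->]; have [z1 z2] := c0E c.
  apply/ffunP => i; rewrite ffunE z1 z2.
  by case: i => -[|[|//]] hi; congr (c _); exact: val_inj.
rewrite /Kdim; case: xgetP => [n _ [E' hE']|/(_ 2%N)]; last by case; exists E.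
exact: is_Kbasis_uniq hE' basis.
Qed.

End Tensor.

(** * Comparison of the two spaces of horizontal sections *)

Theorem mainTheorem1 (R : realType) (p : nat) (K : cdvfType R p)
  (M : diffModule K) (rank2 : free_of_rank M 2) :
  let m' := Kdim (horizontal M) in
  horizontal_growth M (m'%:R - 1) = horizontal M.
Proof.
have [e ebasis] := rank2 => m'.
apply/seteqP; split=> [x [] //|x hx]; split=> //.
have [f [g xE]] := tens_pair_surj ebasis x; rewrite xE in hx *.
have [df dg] := (horizontal_tens_pair ebasis f g).1 hx.
have bc := bdd_conn e.
have [[f0 g0]|fg] := pselect (f = 0 /\ g = 0).
  by rewrite f0 g0; apply: tensor_growth_tens_pair; apply: log_growth_bdd; exact: bdd0.
(* If the determinant is not solvable, the section is bounded and so has every growth order,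
   whatever m' is. Otherwise m' = 2 and the order to reach is 1. *)
have [hdet|hdet] := pselect (det_solvable (connection e 0 0) (connection e 1 1)); last first.
  have [bf bg] := unsolvable_solutions_bounded (bc _ _) (bc _ _) (bc _ _) (bc _ _) df dg hdet.
  by apply: tensor_growth_tens_pair; exact: log_growth_bdd.
have fg0 : f != 0 \/ g != 0.
  have [f0|] := eqVneq f 0; [right|by left].
  by apply: contra_notN fg => /eqP.
have [C hC] := solvable_growth (bc _ _) (bc _ _) df dg fg0 hdet.
have -> : m'%:R - 1 = 1 :> R by rewrite /m' (Kdim_horizontal ebasis hC) (natrD _ 1 1) addrK.
by have [gf gg] := solution_growth hC (conj df dg); exact: tensor_growth_tens_pair.
Qed.
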